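(* Let $0\le a,b,\alpha,\beta<1$ with $a+b\le 1$ and $\alpha+\beta\le 1$. For four-parameter coalescing ballistic annihilation (FCBA) with reaction parameters $a,b,\alpha,\beta$ (and any admissible spacing distribution), the critical initial blockade density $p_c$ satisfies $$p_c=\frac{(1-\beta)^2-b(1-\alpha)}{4-(a+b)(1-\alpha)-\beta(3-\alpha-\beta)-3\alpha}.$$
   Context: FCBA is defined as follows. Particles $\bullet_k$, $k\in\mathbb Z$, start at locations $x_k\in\mathbb R$ with $x_0=0$, where the spacings $x_k-x_{k-1}$ are i.i.d. from a continuous distribution supported on a subset of $(0,\infty)$. Independently, each particle is a blockade (velocity $0$) with probability $p$, a right arrow (velocity $+1$) with probability $(1-p)/2$, or a left arrow (velocity $-1$) with probability $(1-p)/2$. Particles move at their velocities until they collide. Each collision has an independent random outcome: - right arrow with left arrow: only a left arrow remains with probability $a/2$; only a right arrow with probability $a/2$; only a blockade with probability $b$; nothing with probability $1-(a+b)$; - blockade with left arrow: only a left arrow remains with probability $\alpha$; only a blockade with probability $\beta$; nothing with probability $1-(\alpha+\beta)$; - right arrow with blockade: only a right arrow remains with probability $\alpha$; only a blockade with probability $\beta$; nothing with probability $1-(\alpha+\beta)$. The remaining particle is located at the collision site. Blockades generated by collisions follow the same reaction rules as initial blockades. When the velocity of the remaining particle matches that of one of the reactants, it is regarded as the continuation of that reactant (which thus survives the collision). The critical density is $p_c:=\sup\{p:\mathbb P_p(\text{no blockades survive})=1\}$, where $\mathbb P_p$ is the law of the process with initial blockade density $p$, and ''no blockades survive'' means that each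 blockade initially present in the system is annihilated after an almost surely finite time.
   Formalization: The formal theorem states p_c = max(0, the displayed quotient): when (1-β)^2 < b(1-α), e.g. a=α=0, b=9/10, β=1/2, the quotient is negative while p_c ≥ 0 because p=0 has no initial blockades, so p_c=0 there; otherwise the equality is as displayed. *)

(* Defs.v *)
From HB Require Import structures.
From mathcomp Require Import all_boot all_order all_algebra.
From mathcomp Require Import all_classical all_reals all_analysis.

Set Implicit Arguments.
Unset Strict Implicit.
Unset Printing Implicit Defensive.

Import Order.TTheory GRing.Theory Num.Theory.

Local Open Scope classical_set_scope.
Local Open Scope ring_scope.

(* [vleft], [vzero], [vright]: left arrow, blockade, right arrow. *)
Inductive velocity := vleft | vzero | vright.

Definition speed (R : realType) (w : velocity) : R :=
  match w with vleft => -1 | vzero => 0 | vright => 1 end.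

(* The reactant written first is the one coming from the left. *)
Inductive reaction := RightLeft | BlockLeft | RightBlock.

Definition reaction_of (w1 w2 : velocity) : option reaction :=
  match w1, w2 with
  | vright, vleft => Some RightLeft
  | vzero, vleft => Some BlockLeft
  | vright, vzero => Some RightBlock
  | _, _ => None
  end.

(* The outcome of a collision is the velocity of the remaining particle, or
   [None] if nothing remains. *)
Definition outcome := option velocity.

Definition reaction_law (R : realType) (a b alpha beta : R)
    (c : reaction) (o : outcome) : R :=
  match c, o with
  | RightLeft, Some vleft => a / 2
  | RightLeft, Some vright => a / 2
  | RightLeft, Some vzero => b
  | RightLeft, None => 1 - (a + b)
  | BlockLeft, Some vleft => alpha
  | BlockLeft, Some vzero => beta
  | BlockLeft, Some vright => 0
  | BlockLeft, None => 1 - (alpha + beta)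
  | RightBlock, Some vright => alpha
  | RightBlock, Some vzero => beta
  | RightBlock, Some vleft => 0
  | RightBlock, None => 1 - (alpha + beta)
  end.

Definition velocity_law (R : realType) (p : R) (w : velocity) : R :=
  match w with vzero => p | _ => (1 - p) / 2 end.

(* Every particle is either initial or a blockade created by the collision of
   the right arrow started from x_i with the left arrow started from x_j: a
   surviving arrow or blockade keeps its identity, so these labels name all
   the particles, and two given particles collide at most once. *)
Inductive particle := Initial of int | Generated of int & int.

Section Dynamics.
Variables (R : realType) (x : int -> R) (v : int -> velocity).
Variable out : reaction -> particle -> particle -> outcome.

Definition velocity_of (q : particle) : velocity :=
  match q with Initial k => v k | Generated _ _ => vzero end.

Definition birth_time (q : particle) : R :=
  match q with Initial _ => 0 | Generated i j => (x j - x i) / 2 end.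

Definition birth_place (q : particle) : R :=
  match q with Initial k => x k | Generated i j => (x i + x j) / 2 end.

Definition location (q : particle) (t : R) : R :=
  birth_place q + speed R (velocity_of q) * (t - birth_time q).

(* [destroyed q] is the set of times at which q disappears; the rules below
   allow at most one such time. *)
Record history := History {
  born : set particle;
  destroyed : particle -> set R
}.

Definition present_until (h : history) (q : particle) (t : R) : Prop :=
  [/\ born h q, birth_time q < t & forall s, destroyed h q s -> t <= s].

(* Reaction c takes place at time t between q, coming from the left, and r. *)
Definition collide (h : history) (c : reaction) (q r : particle) (t : R) :
    Prop :=
  [/\ reaction_of (velocity_of q) (velocity_of r) = Some c,
      present_until h q t, present_until h r t
    & location q t = location r t].

(* The rules determine the history when x is increasing and unbounded in both
   directions, since whether q is destroyed or born at time t depends only on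
   finitely many collisions, all of them before t. *)
Definition follows_rules (h : history) : Prop :=
  [/\ forall k, born h (Initial k),
      forall i j, born h (Generated i j) <->
        (exists t, collide h RightLeft (Initial i) (Initial j) t) /\
        out RightLeft (Initial i) (Initial j) = Some vzero
    & forall q t, destroyed h q t <->
        exists c r,
          (collide h c q r t /\ out c q r <> Some (velocity_of q)) \/
          (collide h c r q t /\ out c r q <> Some (velocity_of q)) ].

Definition no_blockade_survives (h : history) : Prop :=
  forall k, v k = vzero -> exists t, destroyed h (Initial k) t.

End Dynamics.

Definition mutually_independent d (T : measurableType d) (R : realType)
    (P : probability T R) (I : eqType) (F : I -> set (set T)) : Prop :=
  forall (J : seq I) (E : I -> set T), uniq J ->
    (forall i, i \in J -> F i (E i)) ->
    P (\bigcap_(i in [set` J]) E i) = (\prod_(i <- J) P (E i))%E.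

(* A realization of the system on some probability space. The outcome of each
   potential collision is sampled in advance, and used only if the collision
   takes place. *)
Record process (R : realType) := Process {
  disp : measure_display;
  sample : measurableType disp;
  law : probability sample R;
  start : int -> sample -> R;
  vel : int -> sample -> velocity;
  result : reaction -> particle -> particle -> sample -> outcome;
  hist : sample -> history R
}.

Arguments start {R} _ _ _.
Arguments vel {R} _ _ _.
Arguments result {R} _ _ _ _ _.
Arguments hist {R} _ _.

Definition spacing (R : realType) (X : process R) (k : int) (w : sample X) :
    R :=
  start X k w - start X (k - 1) w.

Arguments spacing {R} _ _ _.

Inductive source :=
  | Spacing of int
  | Velocity of int
  | Outcome of reaction & particle & particle.

HB.instance Definition _ := gen_eqMixin source.

Definition source_events (R : realType) (X : process R) (s : source) :
    set (set (sample X)) :=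
  match s with
  | Spacing k =>
      [set E | exists2 B : set (measurableTypeR R),
                 measurable B & E = spacing X k @^-1` B]
  | Velocity k => [set E | exists B : set velocity, E = vel X k @^-1` B]
  | Outcome c q r =>
      [set E | exists B : set outcome, E = result X c q r @^-1` B]
  end.

Arguments source_events {R} _ _.

(* "Continuous distribution" means without atoms, not necessarily with a
   density. *)
Definition admissible_spacing (R : realType)
    (mu : probability (measurableTypeR R) R) : Prop :=
  (forall y : R, mu [set y] = 0%E) /\ mu [set y : R | 0 < y] = 1%E.

Definition is_fcba (R : realType) (mu : probability (measurableTypeR R) R)
    (a b alpha beta p : R) (X : process R) : Prop :=
  [/\ (forall s, source_events X s `<=` measurable) /\
      mutually_independent (law X) (source_events X),
      (forall w : sample X, start X 0 w = 0) /\
      (forall k (B : set (measurableTypeR R)), measurable B ->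
        law X (spacing X k @^-1` B) = mu B),
      forall k u, law X (vel X k @^-1` [set u]) = (velocity_law p u)%:E,
      forall c q r o, law X (result X c q r @^-1` [set o]) =
        (reaction_law a b alpha beta c o)%:E
    & {ae law X, forall w, follows_rules (start X ^~ w) (vel X ^~ w)
        (fun c q r => result X c q r w) (hist X w)}].

(* X p is the process with initial blockade density p. At p = 0 there is no
   initial blockade, so the supremum is never negative. *)
Definition critical_density (R : realType) (X : R -> process R) : R :=
  sup [set p : R | 0 <= p <= 1 /\
    {ae law (X p), forall w,
       no_blockade_survives (vel (X p) ^~ w) (hist (X p) w)}].

(* Main.v *)
Require Import Defs.
From HB Require Import structures.
From mathcomp Require Import all_boot all_order all_algebra.
From mathcomp Require Import all_classical all_reals all_analysis.
From mathcomp Require Import measurable_realfun.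
From mathcomp Require Import zify ring lra.

Set Implicit Arguments.
Unset Strict Implicit.
Unset Printing Implicit Defensive.

Import Order.TTheory GRing.Theory Num.Theory.
Import numFieldNormedType.Exports.
Local Open Scope classical_set_scope.
Local Open Scope ring_scope.

(** The proof is a balance of probabilities on the half-line, carried out with generating functions
    in the number of particles.

    Keep only the particles 1, 2, ... and let q be the probability that some left arrow ever gets
    out on the left. Nothing overtakes a left arrow n from the right, so whether it gets out is
    decided by the particles 1, ..., n. Let F_n be the probability that n is the first to get out; q
    is the sum of the F_n ([survival]). An arrow that gets out separates its two sides for ever, so
    exits form a renewal process: G = F + F * G for the probability G_n that n gets out ([renewal]).
    The probability Y_n that the arrow n reaches a blockade at 0 which has withstood all earlier
    arrivals satisfies Y = F + beta Y * F ([Ys_rec]). If L_n is the probability that 1 and n are a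
    right and a left arrow that meet, then B_n = p [n = 1] + b L_n is the probability of a blockade
    made out of exactly the particles 1, ..., n ([Bs_eq]).

    Two equations come from sorting the fates of particle 1 in the box [1, n] ([fate_split]): it is
    a left arrow, or leaves on the right, or is or generates a blockade, or is removed by a left
    arrow without a blockade arising, or is removed at a blockade. The sure event gives
    [fate_total], where leaving on the right has probability G_n by reflection; the event that n is
    the first to get out gives [first_total]. The delicate fate is a blockade reached by arrow 1
    from the left and by another arrow from the right, as the order of arrival matters. Reflection
    exchanges the two orders ([Us_flip]), ties have probability 0, and together the two orders have
    probability Y_m B_w Y_k by independence ([Us_Ul]). After summation each order takes exactly half
    ([conv3_half]), and the law of the spacings disappears.

    For 0 < z < 1 let f and y be the generating functions of F and Y, so y = f / (1 - beta f).
    Elimination of the other unknowns gives [critical_identity], of the form W(z, y) = (1 - z) K(f,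
    y) with K nonnegative and W(z, y) = 1 - b (1 - alpha) y^2 - z p (1 + (1 - alpha) (2 y + (beta +
    1 - a - b) y^2)). Now let z tend to 1, so that f tends to q. If q = 1, then y tends to 1 / (1 -
    beta) and W(1, 1 / (1 - beta)) >= 0 ([subcritical]). If q < 1, then K stays bounded, so W(1, y)
    = 0 at y = q / (1 - beta q), which is at most 1 / (1 - beta); since W decreases in y, W(1, 1 /
    (1 - beta)) <= 0 ([supercritical]). Multiplied by (1 - beta)^2, this value of W is the numerator
    of the critical density minus p times its denominator ([threshold_algebra]). Hence q = 1 for p
    below the ratio and q < 1 for p above it.

    It remains to relate q to survival. If q = 1, then (1 - beta) times the sum of the Y_n is 1, so
    almost surely every blockade is reached from the right by an arrow that would remove it, and is
    removed then or earlier ([cleared_subcritical], [blockade_destroyed]). If q < 1 and p > 0, then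
    with probability p (1 - q)^2 particle 0 is a blockade that nothing ever reaches
    ([isolated_blockade], [blockade_survives]). At p = 0 there is no initial blockade, whence the
    maximum with 0.

    The factorisations rest on locality. Collisions are a relation determined by a recursion along
    time ([dynamics]); a blockade keeps its two sides apart until it is destroyed
    ([collision_right_arrow]), an exiting arrow does so for ever ([exit_after_exit]), and a meeting
    is decided inside its light cone ([meetRL_local]). Events thus depend on explicit sets of random
    sources, and disjoint sets give independence ([independent]). *)

Definition lo (q : particle) : int :=
  match q with Initial k => k | Generated i _ => i end.
Definition hi (q : particle) : int :=
  match q with Initial k => k | Generated _ j => j end.

(** * Induction along finitely many times *)

Lemma count_ltn (R : realDomainType) (T : seq R) (a b : R) :
  a \in T -> a < b ->
  (count (fun s => (s < a)%R) T < count (fun s => (s < b)%R) T)%N.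
Proof.
elim: T => //= c T IH; rewrite inE => /orP[/eqP->|aT] ab.
  rewrite ltxx ab add0n add1n ltnS; apply: sub_count => s sc.
  exact: lt_trans sc ab.
have := IH aT ab; case: (ltP c a) => [ca|ac]; first by rewrite (lt_trans ca ab).
by move=> H; rewrite add0n; exact: leq_trans H (leq_addl _ _).
Qed.

(** The rank of t, the number of members of T below it, decreases strictly along earlier members.
    Candidate collision times in a box are finite in number, so [agree] can induct on them. *)
Lemma time_ind (R : realDomainType) (T : seq R) (P : R -> Prop) :
  (forall t, t \in T -> (forall s, s \in T -> s < t -> P s) -> P t) ->
  forall t, t \in T -> P t.
Proof.
move=> H t; have [n] := ubnP (count (fun s => s < t) T).
elim: n t => // n IH t tn tT; apply: (H _ tT) => s sT st; apply: IH => //.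
by have := count_ltn sT st; lia.
Qed.

Definition window (i j : int) : seq int :=
  [seq i + k%:Z | k <- iota 0 (absz (j - i)).+1].

Lemma mem_window i j k : i <= k -> k <= j -> k \in window i j.
Proof.
move=> ik kj; apply/mapP; exists (absz (k - i)); last by lia.
by rewrite mem_iota; lia.
Qed.

(** * Collisions as a binary relation on particles *)

Section Dyn.
Variables (R : realType) (x : int -> R) (v : int -> velocity).
Variable out : reaction -> particle -> particle -> outcome.
Implicit Types (q r p b : particle) (i j k m s t : int).

Notation vel := (velocity_of v).

(** Since [lo] and [hi] coincide on initial particles, [mid], [bir] and [loc] give place of birth,
    time of birth and position of both kinds of particle by one formula. *)
Definition mid q : R := (x (lo q) + x (hi q)) / 2.
Definition bir q : R := (x (hi q) - x (lo q)) / 2.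
Definition loc q (u : R) : R := mid q + speed R (vel q) * (u - bir q).

(* The only time at which q and r, with q on the left, can collide; it is
   relevant for reacting pairs only. *)
Definition meet q r : R :=
  match vel q, vel r with
  | vright, vleft => (x (lo r) - x (lo q)) / 2
  | vright, vzero => mid r - x (lo q)
  | vzero, vleft => x (lo r) - mid q
  | _, _ => 0
  end.

Definition res q r : outcome :=
  if reaction_of (vel q) (vel r) is Some c then out c q r else None.

Section Rules.
Variable O : particle -> particle -> Prop.

Definition exist q : Prop :=
  match q with
  | Initial _ => True
  | Generated i j => [/\ v i = vright, v j = vleft, O (Initial i) (Initial j)
                     & out RightLeft (Initial i) (Initial j) = Some vzero]
  end.

(** A reactant survives exactly when the remaining particle has its velocity. Destruction at the
    instant u itself does not count, so both reactants are still present at their own collision. *)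
Definition alive q (u : R) : Prop :=
  (forall r, O q r -> meet q r < u -> res q r = Some (vel q)) /\
  (forall r, O r q -> meet r q < u -> res r q = Some (vel q)).

Definition pres q (u : R) : Prop := [/\ exist q, bir q < u & alive q u].

Definition collides q r : Prop :=
  [/\ reaction_of (vel q) (vel r) <> None, hi q < lo r,
      pres q (meet q r) & pres r (meet q r)].

End Rules.

(* The collisions that take place, as a binary relation on particles: a
   reformulation of [follows_rules] in which times are computed by [meet]. *)
Definition dynamics (O : particle -> particle -> Prop) : Prop :=
  forall q r, O q r <-> collides O q r.

Lemma arrowE q : vel q <> vzero -> q = Initial (lo q).
Proof. by case: q. Qed.

Lemma arrow_lohi q : vel q <> vzero -> lo q = hi q.
Proof. by case: q. Qed.

Variant rx_spec q r : Prop :=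
  | RxRL of vel q = vright & vel r = vleft & lo q = hi q & lo r = hi r
  | RxRB of vel q = vright & vel r = vzero & lo q = hi q
  | RxBL of vel q = vzero & vel r = vleft & lo r = hi r.

Lemma rxP q r : reaction_of (vel q) (vel r) <> None -> rx_spec q r.
Proof.
case eq: (vel q); case er: (vel r) => // _.
- by apply: RxBL => //; apply: arrow_lohi; rewrite er.
- by apply: RxRL => //; apply: arrow_lohi; rewrite ?eq ?er.
- by apply: RxRB => //; apply: arrow_lohi; rewrite ?eq ?er.
Qed.

Hypothesis xlt : forall i j, (x i < x j) = (i < j).

Lemma xle i j : (x i <= x j) = (i <= j).
Proof. by rewrite leNgt xlt -leNgt. Qed.

Lemma xinj i j : x i = x j -> i = j.
Proof.
move=> e; have := xle i j; have := xle j i; rewrite e lexx; lia.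
Qed.

Section Facts.
Variable O : particle -> particle -> Prop.
Hypothesis dO : dynamics O.

Lemma exist_lohi q : exist O q -> lo q <= hi q.
Proof. by case: q => //= i j [_ _ /dO[_ /=]]; lia. Qed.

Lemma bir_ge0 q : exist O q -> 0 <= bir q.
Proof. by move/exist_lohi; rewrite -xle /bir => H; lra. Qed.

Lemma alive_le q (u u' : R) : u' <= u -> alive O q u -> alive O q u'.
Proof.
move=> uu [a1 a2]; split=> r Or ru; [apply: a1|apply: a2] => //;
exact: lt_le_trans ru uu.
Qed.

Lemma pres_le q (u u' : R) : bir q < u' -> u' <= u -> pres O q u -> pres O q u'.
Proof. by move=> bu uu [eq _ aq]; split=> //; exact: alive_le aq. Qed.

(** Births come strictly before collisions, which makes [dynamics] a recursion along time. *)
Lemma meet_gt q r : lo q <= hi q -> lo r <= hi r -> hi q < lo r ->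
  reaction_of (vel q) (vel r) <> None -> bir q < meet q r /\ bir r < meet q r.
Proof.
rewrite -!xle -!xlt => hq hr qr /rxP[] eq er; rewrite /meet eq er /bir /mid.
- by move=> e1 e2; move: hq hr qr; rewrite -e1 -e2; split; lra.
- by move=> e1; move: hq hr qr; rewrite -e1; split; lra.
- by move=> e1; move: hq hr qr; rewrite -e1; split; lra.
Qed.

Lemma loc_meet q r u : reaction_of (vel q) (vel r) <> None ->
  (loc q u < loc r u) = (u < meet q r) /\ (loc q u <= loc r u) = (u <= meet q r).
Proof.
move=> /rxP[] eq er; rewrite /loc /meet eq er /bir /mid /=.
- by move=> <- <-; split; apply/idP/idP => H; lra.
- by move=> <-; split; apply/idP/idP => H; lra.
- by move=> <-; split; apply/idP/idP => H; lra.
Qed.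

Lemma res_neq q r : reaction_of (vel q) (vel r) <> None ->
  ~ (res q r = Some (vel q) /\ res q r = Some (vel r)).
Proof. by move=> /rxP[] -> -> => [_ _|_|_] [-> //]. Qed.

(* A crossing of two present particles would be a collision that both survive. *)
Lemma pres_order q r u : hi q < lo r -> pres O q u -> pres O r u ->
  loc q u <= loc r u.
Proof.
move=> qr pq pr; case rx: (reaction_of (vel q) (vel r)) => [c|].
  have rx' : reaction_of (vel q) (vel r) <> None by rewrite rx.
  have [_ ->] := loc_meet u rx'; rewrite leNgt; apply/negP => mu.
  have [eq bq aq] := pq; have [er br ar] := pr.
  have [mq mr] := meet_gt (exist_lohi eq) (exist_lohi er) qr rx'.
  have Oqr : O q r.
    apply/dO; split => //; [exact: pres_le (ltW mu) pq|exact: pres_le (ltW mu) pr].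
  by apply: (res_neq rx'); split; [apply: (proj1 aq)|apply: (proj2 ar)].
have [eq bq aq] := pq; have [er br ar] := pr.
have := exist_lohi eq; have := exist_lohi er.
rewrite -!xle; move: qr; rewrite -xlt => qr hr hq.
have aux p : vel p = vzero \/ x (lo p) = x (hi p).
  by case e: (vel p); [right; rewrite arrow_lohi ?e|left|right; rewrite arrow_lohi ?e].
have := aux q; have := aux r; rewrite /bir in bq br.
case e1: (vel q) rx; case e2: (vel r) => //= _;
rewrite /loc e1 e2 /mid /bir /= => h1 h2;
by case: h1 => [?|h1]; case: h2 => [?|h2] //; lra.
Qed.

End Facts.
End Dyn.

(* No ties: an arrow from the left and one from the right never reach the same
   blockade, or the collision point of two arrows, simultaneously. *)
Definition generic (R : realType) (x : int -> R) : Prop :=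
  forall i s t k : int, i < s -> s <= t -> t < k -> x i + x k <> x s + x t.

(** * Order and disjointness of the particles present at one time *)

Section Order.
Variables (R : realType) (x : int -> R) (v : int -> velocity).
Variable out : reaction -> particle -> particle -> outcome.
Variable O : particle -> particle -> Prop.
Hypothesis xlt : forall i j, (x i < x j) = (i < j).
Hypothesis xgen : generic x.
Hypothesis dO : dynamics x v out O.

Notation vel := (velocity_of v).
Notation loc := (loc x v).
Notation meet := (meet x v).
Notation bir := (bir x).
Notation pres := (pres x v out O).
Notation res := (res v out).

(** The order of the particles puts m between p and q at time u, so p and q have not crossed. If
    they were at one place, m would be there too, and such a triple collision contradicts the order
    of the starting points or [generic]. *)
Lemma no_particle_between p m q u : hi p < lo m -> hi m < lo q ->
  reaction_of (vel p) (vel q) <> None -> 0 < u ->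
  pres p u -> pres m u -> pres q u -> u < meet p q.
Proof.
move=> pm mq rx u0 pp pm' pq.
have l1 := pres_order xlt dO pm pp pm'.
have l2 := pres_order xlt dO mq pm' pq.
have [lt1 le1] := loc_meet x u rx.
rewrite -lt1 lt_neqAle (le_trans l1 l2) andbT; apply/eqP => lpq.
have hm : lo m <= hi m by case: pm' => /(exist_lohi dO).
have hp : lo p <= hi p by case: pp => /(exist_lohi dO).
have hq : lo q <= hi q by case: pq => /(exist_lohi dO).
have e1 : loc p u = loc m u by apply/le_anti; rewrite l1 lpq l2.
have e2 : loc m u = loc q u by rewrite -e1.
have am : vel m = vzero \/ x (lo m) = x (hi m).
  by case e: (vel m); [right; rewrite (@arrow_lohi v) ?e|left|right; rewrite (@arrow_lohi v) ?e].
have g : x (lo p) + x (hi q) <> x (lo m) + x (hi m).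
  by apply: xgen => //; lia.
have xa : x (lo p) <= x (hi p) by rewrite xle.
have xb : x (hi p) < x (lo m) by rewrite xlt.
have xc : x (lo m) <= x (hi m) by rewrite xle.
have xd : x (hi m) < x (lo q) by rewrite xlt.
have xe : x (lo q) <= x (hi q) by rewrite xle.
have bm : bir m < u by case: pm'.
have bp : bir p < u by case: pp.
have bq : bir q < u by case: pq.
move: bm bp bq e1 e2; rewrite /loc /loc /bir /bir /mid.
case/rxP: rx => -> ->; case em: (vel m) am => /= -[am|am] //;
  try (by move: am; rewrite em); try move=> h1; try move=> h2.
all: rewrite ?h1 ?h2 => *; first [lra | apply: g; rewrite ?h1 ?h2; lra].
Qed.

Lemma destroyed_after_generating k l u :
  O (Initial k) (Initial l) -> v k = vright -> v l = vleft ->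
  out RightLeft (Initial k) (Initial l) = Some vzero ->
  (x l - x k) / 2 < u -> ~ pres (Initial k) u /\ ~ pres (Initial l) u.
Proof.
move=> Okl vk vl okl u1; have mkl : meet (Initial k) (Initial l) = (x l - x k) / 2.
  by rewrite /meet /meet /= vk vl.
split=> -[_ _ [a1 a2]].
  by have := a1 _ Okl; rewrite mkl /res /res /= vk vl /= okl => /(_ u1).
by have := a2 _ Okl; rewrite mkl /res /res /= vk vl /= okl => /(_ u1).
Qed.

Lemma parents_present k l : O (Initial k) (Initial l) -> v k = vright -> v l = vleft ->
  pres (Initial k) ((x l - x k) / 2) /\ pres (Initial l) ((x l - x k) / 2).
Proof. by move=> /dO[_ _]; rewrite /meet /= => + + vk vl; rewrite vk vl. Qed.

(** Induction on the widths of the two hulls. Let r be the younger particle, with parents k and l.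
    If q is present when they meet, its hull avoids k and l by induction, and q cannot lie between
    two colliding particles; so it lies outside [k, l]. *)
Lemma pres_disjoint q r u : q <> r -> pres q u -> pres r u ->
  hi q < lo r \/ hi r < lo q.
Proof.
have [n] := ubnP (absz (hi q - lo q) + absz (hi r - lo r))%N.
elim: n q r u => // n IH q r u nqr.
wlog bqr : q r nqr / bir q <= bir r.
  move=> H qr pq pr; case: (leP (bir q) (bir r)) => b; first exact: H.
  have : r <> q by move=> e; apply: qr.
  move=> rq; have := H r q; rewrite addnC => /(_ nqr (ltW b) rq pr pq); tauto.
move=> qr pq pr.
case: r qr nqr bqr pr => [k|k l] qr nqr bqr pr.
  case: q qr nqr bqr pq => [m|i j] qr nqr bqr pq /=.
    have : m <> k by move=> e; apply: qr; rewrite e.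
    by lia.
  have : exist v out O (Generated i j) by case: pq.
  move=> e; have := exist_lohi dO e; case: e => _ _ /dO[_ /=].
  rewrite -xlt => ij _ _ _ _.
  by exfalso; move: bqr; rewrite /bir /bir /=; lra.
have [er br ar] := pr; have [vk vl Okl okl] := er.
set b := (x l - x k) / 2.
have bb : bir (Generated k l) = b by [].
have kl : k < l by case/dO: Okl.
have [pk pl] := parents_present Okl vk vl.
have [nk nl] := destroyed_after_generating Okl vk vl okl br.
have b0 : 0 < b by rewrite /b; move: kl; rewrite -xlt; lra.
rewrite /=; case: (ltP (bir q) (bir (Generated k l))) => [lt|ge]; last first.
  (* simultaneous births *)
  have ebb : bir q = b by rewrite -bb; lra.
  case: q qr nqr bqr pq ge ebb => [m|i j] qr nqr bqr pq ge ebb.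
    by exfalso; move: ebb b0; rewrite /bir /bir /=; lra.
  have : exist v out O (Generated i j) by case: pq.
  case=> vi vj Oij oij; have [pi pj] := parents_present Oij vi vj.
  have ij : i < j by case/dO: Oij.
  move: ebb; rewrite /bir /bir /= => ebb; rewrite ebb in pi pj.
  have ne : i <> k.
    move=> e; apply: qr; congr Generated => //; apply: (@xinj _ x) => //.
    by move: ebb; rewrite /b e; lra.
  (* For two pairs of arrows meeting at the same time: a right arrow k' starting between i' and j'
     would be beyond j' at that time, against [pres_order]. *)
  have aux i' j' k' l' : v i' = vright -> v j' = vleft -> v k' = vright ->
      (x j' - x i') / 2 = (x l' - x k') / 2 ->
      pres (Initial j') ((x j' - x i') / 2) -> pres (Initial k') ((x j' - x i') / 2) ->
      i' < k' -> j' < k'.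
    move=> vi' vj' vk' e pj' pk' ik; case: (ltP j' k') => // kj.
    have kj' : k' < j'.
      by move: kj; rewrite le_eqVlt => /orP[/eqP e'|//]; move: vj'; rewrite -e' vk'.
    have := @pres_order _ _ _ _ xlt _ dO (Initial k') (Initial j') _ kj' pk' pj'.
    rewrite /loc /= vj' vk' /= /mid /bir /=.
    by move: ik; rewrite -xlt; lra.
  have [ik|ki] := ltP i k.
    by left; apply: (aux i j k l); rewrite ?ebb.
  right; apply: (aux k l i j) => //; rewrite ?ebb //.
  by rewrite lt_neqAle ki andbT; apply/eqP => e; apply: ne.
have pqb : pres q b by apply: pres_le pq => //; rewrite -bb; exact: ltW.
have nqk : q <> Initial k by move=> e; apply: nk; rewrite -e.
have nql : q <> Initial l by move=> e; apply: nl; rewrite -e.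
have IHk := IH q (Initial k) b _ nqk pqb pk.
have IHl := IH q (Initial l) b _ nql pqb pl.
have hyp : (absz (hi q - lo q) + 0 < n)%N by move: nqr => /=; lia.
move: IHk IHl; rewrite /= !subrr => /(_ hyp) hk /(_ hyp) hl.
case: hk => [|kq]; first by left.
case: hl => [ql|]; last by right.
have rx : reaction_of (vel (Initial k)) (vel (Initial l)) <> None by rewrite /= vk vl.
have := @no_particle_between (Initial k) q (Initial l) b kq ql rx b0 pk pqb pl.
by rewrite /meet /= vk vl ltxx.
Qed.

(* While a collision takes place nothing present separates the reactants. *)
Lemma collision_between p q m u : O p q -> u = meet p q -> pres m u ->
  m <> p -> m <> q -> hi m < lo p \/ hi q < lo m.
Proof.
move=> Opq -> pm mp mq; have [rx pq pp pq'] := (dO p q).1 Opq.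
have [|mp'] := pres_disjoint mp pm pp; first by left.
have [mq'|] := pres_disjoint mq pm pq'; last by right.
have [ep bp _] := pp; have b0 := bir_ge0 xlt dO ep.
have := no_particle_between mp' mq' rx (le_lt_trans b0 bp) pp pm pq'.
by rewrite ltxx.
Qed.

End Order.

(* Keeping only the particles in [i, j]: the outer ones fly away unhindered. *)
Definition boxed (i j : int) (v : int -> velocity) (k : int) : velocity :=
  if k < i then vleft else if j < k then vright else v k.

Lemma boxed_in i j v k : i <= k -> k <= j -> boxed i j v k = v k.
Proof. by move=> ik kj; rewrite /boxed !ltNge ik kj. Qed.

Definition within (i j : int) (q : particle) : Prop :=
  [/\ i <= lo q, lo q <= hi q & hi q <= j].

(** Every meeting time of two reacting particles with hulls in [i, j] has one of these two forms;
    for two arrows, c is one of the pair. *)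
Definition times (R : realType) (x : int -> R) (i j : int) : seq R :=
  let W := window i j in
  allpairs (fun ab c => (x ab.1 + x ab.2) / 2 - x c) (allpairs pair W W) W ++
  allpairs (fun ab c => x c - (x ab.1 + x ab.2) / 2) (allpairs pair W W) W.

(** More rounds than there are candidate times, so that the iteration defining [box] has reached its
    fixed point. *)
Definition fuel (i j : int) : nat := (2 * (absz (j - i)).+1 ^ 3).+1.

Lemma size_times (R : realType) (x : int -> R) i j :
  (size (times x i j) < fuel i j)%N.
Proof.
rewrite /times size_cat !size_allpairs /window size_map size_iota /fuel.
by rewrite ltnS !expnS expn0; lia.
Qed.

(** * Finite boxes: comparison of two dynamics, and existence *)

Section Box.
Variables (R : realType) (x : int -> R).

Lemma meet_times v i j q r : within i j q -> within i j r ->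
  reaction_of (velocity_of v q) (velocity_of v r) <> None ->
  meet x v q r \in times x i j.
Proof.
move=> [q1 q2 q3] [r1 r2 r3] /rxP h.
have W k k' k'' : i <= k -> k <= j -> i <= k' -> k' <= j -> i <= k'' -> k'' <= j ->
    ((x k + x k') / 2 - x k'' \in times x i j) /\
    (x k'' - (x k + x k') / 2 \in times x i j).
  move=> *; split; rewrite mem_cat; apply/orP; [left|right];
  by apply: (allpairs_f (fun ab c => _) (x := (k, k')));
     rewrite ?mem_window //; apply: allpairs_f; rewrite mem_window.
case: h => eq er; rewrite /meet eq er /mid.
- move=> e1 e2; rewrite (_ : _ / 2 = (x (lo r) + x (lo q)) / 2 - x (lo q)); last by lra.
  by apply: (proj1 (W _ _ _ _ _ _ _ _ _)); lia.
- by move=> _; apply: (proj1 (W _ _ _ _ _ _ _ _ _)); lia.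
- by move=> _; apply: (proj2 (W _ _ _ _ _ _ _ _ _)); lia.
Qed.

Lemma meet_eq v1 v2 q r : velocity_of v1 q = velocity_of v2 q ->
  velocity_of v1 r = velocity_of v2 r -> meet x v1 q r = meet x v2 q r.
Proof. by rewrite /meet => -> ->. Qed.

Lemma vel_within v1 v2 i j q : (forall k, i <= k -> k <= j -> v1 k = v2 k) ->
  within i j q -> velocity_of v1 q = velocity_of v2 q.
Proof. by case: q => //= k H [/= *]; apply: H. Qed.

Section Agree.
Variable W : particle -> particle -> Prop.

(** Only destroying collisions are asked for, because an earlier collision that a reactant survives
    does not affect its presence. *)
Definition collision_closed v out (O : particle -> particle -> Prop) : Prop :=
  forall q r q' r' p, W q r -> O q' r' -> meet x v q' r' < meet x v q r ->
    p = q \/ p = r -> p = q' \/ p = r' ->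
    res v out q' r' <> Some (velocity_of v p) -> W q' r'.

(** One implication of [agree]. The reactants are present in the second system because the
    collisions that create them and those that could destroy them are earlier members of W, on which
    the two systems agree. *)
Lemma agree_step v1 v2 out1 out2 (O1 O2 : particle -> particle -> Prop) i j q r :
  (forall k, i <= k -> k <= j -> v1 k = v2 k) ->
  (forall q r, W q r -> within i j q /\ within i j r) ->
  (forall q r a b, W q r -> q = Generated a b \/ r = Generated a b ->
    v1 a = vright -> v1 b = vleft -> W (Initial a) (Initial b)) ->
  dynamics x v1 out1 O1 -> dynamics x v2 out2 O2 ->
  collision_closed v2 out2 O2 ->
  (forall q' r', W q' r' -> meet x v1 q' r' < meet x v1 q r ->
     res v1 out1 q' r' = res v2 out2 q' r') ->
  (forall q' r', W q' r' -> meet x v1 q' r' < meet x v1 q r ->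
     (O1 q' r' <-> O2 q' r')) ->
  W q r -> O1 q r -> O2 q r.
Proof.
move=> vv Ww Wb d1 d2 c2 rr IH Wqr /d1[rx qr pq pr].
have [wq wr] := Ww _ _ Wqr.
have eq := vel_within vv wq; have er := vel_within vv wr.
have em := meet_eq eq er.
have key p : p = q \/ p = r -> pres x v1 out1 O1 p (meet x v1 q r) ->
    pres x v2 out2 O2 p (meet x v2 q r).
  move=> hp [ep bp [a1 a2]].
  have wp : within i j p by case: hp => ->.
  have evp := vel_within vv wp; rewrite -em; split => //.
    case: p hp ep bp {a1 a2} wp evp => //= a b hp [va vb Oab oab] bp wp evp.
    have Wab : W (Initial a) (Initial b).
      by apply: (Wb _ _ _ _ Wqr) => //; case: hp => <-; [left|right].
    have [wa wb] := Ww _ _ Wab.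
    have := vel_within vv wa; have := vel_within vv wb => /= eb ea.
    have mab : meet x v1 (Initial a) (Initial b) < meet x v1 q r.
      by rewrite {1}/meet /= va vb.
    split; rewrite -?ea -?eb //; first exact/IH.
    by have := rr _ _ Wab mab; rewrite /res /= -ea -eb va vb /= => <-.
  split=> r' Or; rewrite -evp.
    move=> m2; apply: contrapT => nr.
    have Wr' : W p r'.
      by apply: (c2 q r _ _ p Wqr Or); rewrite -?em -?evp //; left.
    have [wp' wr'] := Ww _ _ Wr'.
    have er' := vel_within vv wr'.
    have m1 : meet x v1 p r' < meet x v1 q r by rewrite (meet_eq evp er').
    by apply: nr; rewrite -rr //; apply: a1 => //; exact/IH.
  move=> m2; apply: contrapT => nr.
  have Wr' : W r' p.
    by apply: (c2 q r _ _ p Wqr Or); rewrite -?em -?evp //; right.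
  have [wr' wp'] := Ww _ _ Wr'.
  have er' := vel_within vv wr'.
  have m1 : meet x v1 r' p < meet x v1 q r by rewrite (meet_eq er' evp).
  by apply: nr; rewrite -rr //; apply: a2 => //; exact/IH.
by apply/d2; split; rewrite -?eq -?er //; apply: key => //; [left|right].
Qed.

(* Two dynamics agree on a family of collisions which is collision_closed under taking
   the earlier collisions that create or destroy the reactants. *)
Lemma agree v1 v2 out1 out2 (O1 O2 : particle -> particle -> Prop) i j :
  (forall k, i <= k -> k <= j -> v1 k = v2 k) ->
  (forall q r, W q r -> within i j q /\ within i j r) ->
  (forall q r a b, W q r -> q = Generated a b \/ r = Generated a b ->
    v1 a = vright -> v1 b = vleft -> W (Initial a) (Initial b)) ->
  dynamics x v1 out1 O1 -> dynamics x v2 out2 O2 ->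
  collision_closed v1 out1 O1 -> collision_closed v2 out2 O2 ->
  (forall q r q' r', W q r -> W q' r' -> meet x v1 q' r' < meet x v1 q r ->
     res v1 out1 q' r' = res v2 out2 q' r') ->
  forall q r, W q r -> (O1 q r <-> O2 q r).
Proof.
move=> vv Ww Wb d1 d2 c1 c2 rr q r Wqr.
have mE q' r' : W q' r' -> meet x v1 q' r' = meet x v2 q' r'.
  by move=> /Ww[w1 w2]; apply: meet_eq; apply: vel_within vv _.
have inT q' r' : W q' r' -> reaction_of (velocity_of v1 q') (velocity_of v1 r') <> None ->
   meet x v1 q' r' \in times x i j.
  by move=> /Ww[w1 w2]; apply: meet_times.
suff H t : t \in times x i j -> forall q r, W q r -> meet x v1 q r = t ->
    (O1 q r <-> O2 q r).
  case rx : (reaction_of (velocity_of v1 q) (velocity_of v1 r)) => [c|].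
    by apply: (H (meet x v1 q r)) => //; apply: inT => //; rewrite rx.
  have [wq wr] := Ww _ _ Wqr.
  split=> [/d1[]|/d2[]] //; rewrite -(vel_within vv wq) -(vel_within vv wr) //.
elim/time_ind: t / => t tT IH {Wqr} {}q {}r Wqr mt.
have IH' q' r' : W q' r' -> meet x v1 q' r' < meet x v1 q r -> (O1 q' r' <-> O2 q' r').
  move=> W' m'; case rx : (reaction_of (velocity_of v1 q') (velocity_of v1 r')) => [c|].
    apply: (IH (meet x v1 q' r')) => //; rewrite -?mt //.
    by apply: inT => //; rewrite rx.
  have [wq wr] := Ww _ _ W'.
  split=> [/d1[]|/d2[]] //; rewrite -(vel_within vv wq) -(vel_within vv wr) //.
split.
  by apply: (agree_step vv Ww Wb d1 d2 c2) => // q' r' W'; apply: rr.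
have vv' k : i <= k -> k <= j -> v2 k = v1 k by move=> *; rewrite vv.
have Wb' q' r' a b : W q' r' -> q' = Generated a b \/ r' = Generated a b ->
    v2 a = vright -> v2 b = vleft -> W (Initial a) (Initial b).
  move=> W' ab va vb; have [wq wr] := Ww _ _ W'.
  have wab : within i j (Generated a b) by case: ab => <-.
  by case: wab => /= *; apply: (Wb _ _ _ _ W' ab); rewrite vv //; lia.
apply: (agree_step vv' Ww Wb' d2 d1 c1) => // q' r' W'; rewrite -!mE //.
  by move=> m'; rewrite (rr q r).
by move=> m'; rewrite IH'.
Qed.

End Agree.

Section Exists.
Variables (v : int -> velocity) (out : reaction -> particle -> particle -> outcome).
Variables i j : int.

(** The collision rule iterated from the empty relation. After n rounds the collisions preceded by
    fewer than n candidate times are settled, by [occ_stable]. *)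
Definition occ (n : nat) : particle -> particle -> Prop :=
  iter n (collides x (boxed i j v) out) (fun _ _ => False).

(** Outer particles move away from the box. A left reactant is not a left arrow, which keeps its
    hull at or to the right of i; symmetrically for a right reactant and j. *)
Lemma collides_within (O : particle -> particle -> Prop) q r :
  (forall q r, O q r -> hi q < lo r) ->
  collides x (boxed i j v) out O q r -> within i j q /\ within i j r.
Proof.
move=> Oh [rx qr [eq _ _] [er _ _]].
have L k : boxed i j v k <> vleft -> i <= k by rewrite /boxed; case: ltP.
have G k : i <= k -> boxed i j v k <> vright -> k <= j.
  by rewrite /boxed ltNge => ->; case: (ltP j k).
have hq : lo q <= hi q.
  by case: q eq {rx qr} => //= a b [_ _ /Oh /= ab _]; exact: ltW.
have hr : lo r <= hi r.
  by case: r er {rx qr} => //= a b [_ _ /Oh /= ab _]; exact: ltW.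
have Lq : i <= lo q.
  case: q eq rx {qr hq} => /= [k _ rx|a b [va _ _ _] _]; apply: L.
    by move=> e; rewrite e in rx; case: (velocity_of _ _) rx.
  by rewrite va.
have Gr : hi r <= j.
  case: r er rx qr hr => /= [k _ rx qr _|a b [_ vb _ _] _ qr hr]; apply: G; try lia.
    by move=> e; rewrite e in rx; case: (velocity_of _ _) rx.
  by rewrite vb.
by split; split => //; lia.
Qed.

Lemma occ_order n q r : occ n q r -> hi q < lo r.
Proof. by case: n => //= n []. Qed.

Lemma occ_within n q r : occ n q r -> within i j q /\ within i j r.
Proof. by case: n => //= n; apply: collides_within => ? ?; apply: occ_order. Qed.

(** A collision depends on strictly earlier ones only, and these have fewer candidate times before
    them. *)
Lemma occ_stable n q r : within i j q -> within i j r ->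
  (count (fun s => (s < meet x (boxed i j v) q r)%R) (times x i j) < n)%N ->
  occ n q r <-> occ n.+1 q r.
Proof.
elim: n q r => // n IH q r wq wr ct.
have ex p : bir x p < meet x (boxed i j v) q r ->
    exist (boxed i j v) out (occ n) p <-> exist (boxed i j v) out (occ n.+1) p.
  case: p => //= a b ba.
  have H : boxed i j v a = vright -> boxed i j v b = vleft ->
      within i j (Initial a) -> within i j (Initial b) ->
      occ n (Initial a) (Initial b) <-> collides x (boxed i j v) out (occ n) (Initial a) (Initial b).
    move=> va vb wa wb; apply: IH => //.
    have mab : meet x (boxed i j v) (Initial a) (Initial b) = (x b - x a) / 2.
      by rewrite /meet /= va vb.
    have : meet x (boxed i j v) (Initial a) (Initial b) \in times x i j.
      by apply: meet_times => //=; rewrite va vb.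
    move=> /count_ltn => /(_ (meet x (boxed i j v) q r)); rewrite mab => /(_ ba).
    by rewrite -mab => lt; exact: leq_trans lt ct.
  split=> -[va vb Oab oab]; split => //.
    by have [wa wb] := occ_within Oab; apply/H.
  have [wa wb] := @occ_within n.+1 _ _ Oab; exact/H.
have st q' r' : meet x (boxed i j v) q' r' < meet x (boxed i j v) q r ->
    occ n q' r' <-> occ n.+1 q' r'.
  move=> mm; case rx: (reaction_of (velocity_of (boxed i j v) q') (velocity_of (boxed i j v) r')) => [c|].
    have H : within i j q' -> within i j r' -> occ n q' r' <-> occ n.+1 q' r'.
      move=> wq' wr'; apply: IH => //.
      have : meet x (boxed i j v) q' r' \in times x i j by apply: meet_times => //; rewrite rx.
      by move=> /count_ltn => /(_ _ mm) lt; exact: leq_trans lt ct.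
    by split=> Oq; [have [w1 w2] := occ_within Oq|have [w1 w2] := @occ_within n.+1 _ _ Oq]; apply/H.
  split; last by case.
  by case: (n) => //= n' [].
have al p : alive x (boxed i j v) out (occ n) p (meet x (boxed i j v) q r) <->
            alive x (boxed i j v) out (occ n.+1) p (meet x (boxed i j v) q r).
  by split=> -[a1 a2]; split=> r' Or mr; [apply: a1|apply: a2|apply: a1|apply: a2] => //; exact/st.
by split=> -[rx qr [e1 b1 a1] [e2 b2 a2]]; split => //; split => //;
   by [exact/ex | exact/al].
Qed.

Definition box : particle -> particle -> Prop := occ (fuel i j).

Lemma box_dynamics : dynamics x (boxed i j v) out box.
Proof.
move=> q r; have st : within i j q -> within i j r -> box q r <-> occ (fuel i j).+1 q r.
  move=> wq wr; apply: occ_stable => //.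
  by apply: leq_ltn_trans (count_size _ _) _; exact: size_times.
split=> [B|C].
  by have [wq wr] := occ_within B; apply/st.
have [wq wr] := @occ_within (fuel i j).+1 q r C; exact/st.
Qed.

End Exists.
End Box.

(** * Reflection of the line *)

Definition vflip (w : velocity) : velocity :=
  match w with vleft => vright | vzero => vzero | vright => vleft end.
Definition oflip (o : outcome) : outcome := omap vflip o.
Definition rflip (c : reaction) : reaction :=
  match c with
  | RightLeft => RightLeft | BlockLeft => RightBlock | RightBlock => BlockLeft
  end.
Definition pflip (c : int) (q : particle) : particle :=
  match q with
  | Initial k => Initial (c - k) | Generated i j => Generated (c - j) (c - i)
  end.

Lemma vflipK : involutive vflip. Proof. by case. Qed.
Lemma rflipK : involutive rflip. Proof. by case. Qed.
Lemma oflipK : involutive oflip. Proof. by do 2?case. Qed.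
Lemma pflipK c : involutive (pflip c).
Proof. by case=> [k|i j] /=; rewrite !subKr. Qed.

Lemma lo_pflip c q : lo (pflip c q) = c - hi q. Proof. by case: q. Qed.
Lemma hi_pflip c q : hi (pflip c q) = c - lo q. Proof. by case: q. Qed.

Section Reflection.
Variables (R : realType) (x : int -> R) (v : int -> velocity).
Variable out : reaction -> particle -> particle -> outcome.
Variables (c : int) (a : R).

(** The constant [a] is a normalisation: with [a] equal to x c, a system with x 0 = 0 is carried to
    another such system. *)
Definition xflip (k : int) : R := a - x (c - k).
Definition velflip (k : int) : velocity := vflip (v (c - k)).
Definition outflip (rc : reaction) (q r : particle) : outcome :=
  oflip (out (rflip rc) (pflip c r) (pflip c q)).

Lemma vel_pflip q : velocity_of velflip q = vflip (velocity_of v (pflip c q)).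
Proof. by case: q. Qed.

Lemma rx_pflip q r : reaction_of (velocity_of velflip q) (velocity_of velflip r) =
  omap rflip (reaction_of (velocity_of v (pflip c r)) (velocity_of v (pflip c q))).
Proof.
by rewrite !vel_pflip; case: (velocity_of v (pflip c q)); case: (velocity_of v (pflip c r)).
Qed.

Lemma res_pflip q r :
  res velflip outflip q r = oflip (res v out (pflip c r) (pflip c q)).
Proof.
by rewrite /res rx_pflip; case: (reaction_of _ _) => //= rc; rewrite /outflip rflipK.
Qed.

Lemma meet_pflip q r : meet xflip velflip q r = meet x v (pflip c r) (pflip c q).
Proof.
rewrite /meet !vel_pflip /mid /xflip !lo_pflip !hi_pflip.
have aq p : velocity_of v (pflip c p) = vzero \/ lo p = hi p.
  by case: p => [k|? ?]; [right|left].
have := aq q; have := aq r.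
case eq: (velocity_of v (pflip c q)); case er: (velocity_of v (pflip c r)) => //= hr hq;
by case: hr => [//|hr]; case: hq => [//|hq]; rewrite ?hr ?hq; lra.
Qed.

Lemma res_velflip q r p : res velflip outflip q r = Some (velocity_of velflip p) <->
  res v out (pflip c r) (pflip c q) = Some (velocity_of v (pflip c p)).
Proof.
rewrite res_pflip vel_pflip; split=> [|-> //].
rewrite -[Some _]/(oflip (Some (velocity_of v (pflip c p)))).
by move/(congr1 oflip); rewrite !oflipK.
Qed.

Section Relation.
Variable O : particle -> particle -> Prop.
Notation O' := (fun q r => O (pflip c r) (pflip c q)).

Lemma pres_pflip p u :
  pres xflip velflip outflip O' p u <-> pres x v out O (pflip c p) u.
Proof.
have ex : exist velflip outflip O' p <-> exist v out O (pflip c p).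
  case: p => //= i j; rewrite /velflip; split=> -[h1 h2 h3 h4]; split=> //.
  - by rewrite -[v _]vflipK h2.
  - by rewrite -[v _]vflipK h1.
  - by move: h4 => /(congr1 oflip); rewrite oflipK.
  - by rewrite h2.
  - by rewrite h1.
  - by rewrite /outflip /= h4.
have al : alive xflip velflip outflip O' p u <-> alive x v out O (pflip c p) u.
  split=> -[a1 a2]; split=> r'.
  - move=> Or mr; have := a2 (pflip c r'); rewrite meet_pflip !pflipK => /(_ Or mr).
    by move/res_velflip; rewrite pflipK.
  - move=> Or mr; have := a1 (pflip c r'); rewrite meet_pflip !pflipK => /(_ Or mr).
    by move/res_velflip; rewrite pflipK.
  - by move=> Or; rewrite meet_pflip => mr; apply/res_velflip; apply: a2.
  - by move=> Or; rewrite meet_pflip => mr; apply/res_velflip; apply: a1.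
have br : bir xflip p = bir x (pflip c p).
  by rewrite /bir /xflip lo_pflip hi_pflip; lra.
by rewrite /pres br; split=> -[/ex h1 h2 /al h3].
Qed.

Lemma collides_pflip q r :
  collides xflip velflip outflip O' q r <->
  collides x v out O (pflip c r) (pflip c q).
Proof.
rewrite /collides meet_pflip lo_pflip hi_pflip rx_pflip.
split=> -[h1 h2 /pres_pflip h3 /pres_pflip h4]; split=> //.
- by move=> e; rewrite e in h1.
- by lia.
- by case: (reaction_of _ _) h1.
- by lia.
Qed.

(** Turns each result about the right side of a blockade into one about its left side. *)
Lemma dynamics_pflip : dynamics x v out O -> dynamics xflip velflip outflip O'.
Proof. by move=> dO q r; rewrite dO -collides_pflip. Qed.

End Relation.

Lemma xflip_lt : (forall i j, (x i < x j) = (i < j)) ->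
  forall i j, (xflip i < xflip j) = (i < j).
Proof. by move=> xlt i j; rewrite /xflip ltrD2l ltrN2 xlt ltrD2l ltrN2. Qed.

Lemma xflip_generic : generic x -> generic xflip.
Proof.
move=> xg i s t k is_ st tk e.
by apply: (xg (c - k) (c - t) (c - s) (c - i)); try lia; move: e; rewrite /xflip; lra.
Qed.

End Reflection.

Lemma velflip_boxed v c i j : i <= j + 1 ->
  velflip (boxed i j v) c = boxed (c - j) (c - i) (velflip v c).
Proof.
move=> ij; apply/funext => k; rewrite /velflip /boxed.
case: (ltP (c - k) i) => h1.
  by case: (ltP k (c - j)) => h2; case: (ltP (c - i) k) => h3 //; lia.
case: (ltP j (c - k)) => h2; case: (ltP k (c - j)) => h3; case: (ltP (c - i) k) => h4 //; lia.
Qed.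

Lemma fuel_flip c i j : fuel (c - j) (c - i) = fuel i j.
Proof. by rewrite /fuel; congr (_ * _ ^ _).+1; lia. Qed.

Lemma eq_collides (R : realType) (x : int -> R) v out O1 O2 :
  (forall q r, O1 q r <-> O2 q r) ->
  forall q r, collides x v out O1 q r <-> collides x v out O2 q r.
Proof.
by move=> /(fun h q r => propext (h q r)) e;
  have -> : O1 = O2 by apply/funext => q; apply/funext => r.
Qed.

Lemma box_pflip (R : realType) (x : int -> R) v out c a i j q r : i <= j + 1 ->
  box (xflip x c a) (velflip v c) (outflip out c) i j q r <->
  box x v out (c - j) (c - i) (pflip c r) (pflip c q).
Proof.
move=> ij; rewrite /box fuel_flip /occ.
elim: (fuel i j) q r => //= n IH q r.
rewrite (eq_collides _ _ _ IH).
by rewrite -(collides_pflip _ _ _ _ a) velflip_boxed ?subKr; last by lia.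
Qed.

(** * The events of a finite box, and their reflections *)

Section Events.
Variables (R : realType) (x : int -> R) (v : int -> velocity).
Variable out : reaction -> particle -> particle -> outcome.

(** Stated in the box [i, j], so as to depend on the particles i, ..., j only; a larger system does
    not change it, by [meetRL_local]. *)
Definition meetRL (i j : int) : Prop :=
  [/\ v i = vright, v j = vleft & box x v out i j (Initial i) (Initial j)].

Definition blockade (b : particle) : Prop :=
  match b with
  | Initial k => v k = vzero
  | Generated i j =>
      meetRL i j /\ out RightLeft (Initial i) (Initial j) = Some vzero
  end.

(* The left arrow k leaves the box [i, k] on the left. *)
Definition exitL (i k : int) : Prop :=
  [/\ i <= k, v k = vleft & forall q, box x v out i k q (Initial k) ->
      res v out q (Initial k) = Some vleft].

Definition exitR (i k : int) : Prop :=
  [/\ i <= k, v i = vright & forall r, box x v out i k (Initial i) r ->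
      res v out (Initial i) r = Some vright].

(* The left arrow k reaches the blockade b if nothing comes from the left. *)
Definition reachL (b : particle) (k : int) : Prop :=
  exitL (hi b + 1) k /\ forall m, hi b < m -> m < k -> exitL (hi b + 1) m ->
    out BlockLeft b (Initial m) = Some vzero.

Definition reachR (i : int) (b : particle) : Prop :=
  exitR i (lo b - 1) /\ forall m, i < m -> m < lo b -> exitR m (lo b - 1) ->
    out RightBlock (Initial m) b = Some vzero.

End Events.

Section EventsFlip.
Variables (R : realType) (x : int -> R) (v : int -> velocity).
Variable out : reaction -> particle -> particle -> outcome.
Variables (c : int) (a : R).
Notation x' := (xflip x c a).
Notation v' := (velflip v c).
Notation out' := (outflip out c).

Lemma meetRL_flip i j : i <= j -> meetRL x' v' out' (c - j) (c - i) <-> meetRL x v out i j.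
Proof.
move=> ij; rewrite /meetRL /velflip !subKr.
split=> -[h1 h2 h3]; split; rewrite ?h1 ?h2 //.
- by move: h2; case: (v i).
- by move: h1; case: (v j).
- by move/box_pflip: h3; rewrite /= !subKr; apply; lia.
- by apply/box_pflip; rewrite /= ?subKr //; lia.
Qed.

Lemma exitL_flip i k : exitL x' v' out' (c - k) (c - i) <-> exitR x v out i k.
Proof.
rewrite /exitL /exitR /velflip subKr; split=> -[h1 h2 h3]; split; try lia.
- by move: h2; case: (v i).
- move=> r Or; have := h3 (pflip c r); rewrite res_pflip pflipK /= subKr => H.
  have /(congr1 oflip) : oflip (res v out (Initial i) r) = Some vleft.
    by apply: H; apply/box_pflip; rewrite ?subKr ?pflipK /= ?subKr //; lia.
  by rewrite oflipK.
- by rewrite h2.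
- move=> q /box_pflip; rewrite /= !subKr => H; rewrite res_pflip /= subKr h3 //.
  by apply: H; lia.
Qed.

Lemma exitR_flip i k : exitR x' v' out' (c - k) (c - i) <-> exitL x v out i k.
Proof.
rewrite /exitL /exitR /velflip subKr; split=> -[h1 h2 h3]; split; try lia.
- by move: h2; case: (v k).
- move=> r Or; have := h3 (pflip c r); rewrite res_pflip pflipK /= subKr => H.
  have /(congr1 oflip) : oflip (res v out r (Initial k)) = Some vright.
    by apply: H; apply/box_pflip; rewrite ?subKr ?pflipK /= ?subKr //; lia.
  by rewrite oflipK.
- by rewrite h2.
- move=> q /box_pflip; rewrite /= !subKr => H; rewrite res_pflip /= subKr h3 //.
  by apply: H; lia.
Qed.

Lemma blockade_flip b : lo b <= hi b ->
  blockade x' v' out' (pflip c b) <-> blockade x v out b.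
Proof.
case: b => [k|i j] /= ij; first by rewrite /velflip subKr; case: (v k).
rewrite (meetRL_flip ij) /outflip /= !subKr; split=> -[h1 h2]; split=> //.
  by move: h2 => /(congr1 oflip); rewrite oflipK.
by rewrite h2.
Qed.

Lemma reachL_flip i b : reachL x' v' out' (pflip c b) (c - i) <-> reachR x v out i b.
Proof.
rewrite /reachL /reachR hi_pflip (_ : c - lo b + 1 = c - (lo b - 1)); last by lia.
rewrite exitL_flip; split=> -[h1 h2]; split=> // m m1 m2 em.
  have := h2 (c - m); rewrite exitL_flip /outflip /= pflipK subKr => H.
  have /(congr1 oflip) := H ltac:(lia) ltac:(lia) em.
  by rewrite oflipK.
rewrite -(subKr c m) exitL_flip in em.
by rewrite /outflip /= pflipK (h2 _ _ _ em) //; lia.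
Qed.

Lemma reachR_flip b k : reachR x' v' out' (c - k) (pflip c b) <-> reachL x v out b k.
Proof.
rewrite /reachL /reachR lo_pflip (_ : c - hi b - 1 = c - (hi b + 1)); last by lia.
rewrite exitR_flip; split=> -[h1 h2]; split=> // m m1 m2 em.
  have := h2 (c - m); rewrite exitR_flip /outflip /= pflipK subKr => H.
  have /(congr1 oflip) := H ltac:(lia) ltac:(lia) em.
  by rewrite oflipK.
rewrite -(subKr c m) exitR_flip in em.
by rewrite /outflip /= pflipK (h2 _ _ _ em) //; lia.
Qed.

End EventsFlip.

(** * Light cones and locality *)

Section Cone.
Variables (R : realType) (x : int -> R).
Hypothesis xlt : forall i j, (x i < x j) = (i < j).

(** The interval from [lend] to [rend] is the base of the backward light cone of the collision: the
    initial positions from which it can be influenced at speed at most 1. *)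
Definition lend v q r : R := loc x v q (meet x v q r) - meet x v q r.
Definition rend v q r : R := loc x v q (meet x v q r) + meet x v q r.

Section OneVelocity.
Variable v : int -> velocity.
Variable out : reaction -> particle -> particle -> outcome.
Notation vel := (velocity_of v).
Notation loc := (loc x v).
Notation meet := (meet x v).

Lemma loc_lip q (u u' : R) : u <= u' ->
  loc q u' - u' <= loc q u - u /\ loc q u + u <= loc q u' + u'.
Proof. by rewrite /loc /loc => uu; case: (vel q) => /=; split; lra. Qed.

Lemma loc_meetE q r : reaction_of (vel q) (vel r) <> None ->
  loc q (meet q r) = loc r (meet q r).
Proof.
move=> rx; have [lt le] := loc_meet x (meet q r) rx.
by apply/eqP; rewrite eq_le le lexx leNgt /=; move: (lt) (le); rewrite ltxx lexx;
  case: (ltgtP (loc q (meet q r)) (loc r (meet q r))).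
Qed.

Variable O : particle -> particle -> Prop.
Hypothesis dO : dynamics x v out O.

Lemma collision_lohi q r : O q r -> lo q <= hi q /\ lo r <= hi r.
Proof. by move/dO=> [_ _ [e1 _ _] [e2 _ _]]; split; apply: exist_lohi; eassumption. Qed.

Lemma meet_gt0 q r : O q r -> 0 < meet q r.
Proof.
move/dO=> [_ _ [e1 b1 _] _]; exact: le_lt_trans (bir_ge0 xlt dO e1) b1.
Qed.

Lemma collision_ends q r : O q r -> lend v q r <= x (lo q) /\ x (hi r) <= rend v q r.
Proof.
move/dO=> [rx qr [e1 b1 _] [e2 b2 _]]; rewrite /lend /rend; split.
  move: b1; rewrite /loc /loc /mid /bir.
  have := exist_lohi dO e1; rewrite -(xle xlt).
  by case: (vel q) rx => //= _; lra.
rewrite -/(loc _ _) loc_meetE //.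
move: b2; rewrite /loc /loc /mid /bir.
have := exist_lohi dO e2; rewrite -(xle xlt).
by case: (vel r) rx => //= _; lra.
Qed.

(** Going back in time along the shared particle p, whose speed is at most 1, the earlier cone stays
    inside the later one. *)
Lemma cone_mono q r q' r' p : reaction_of (vel q) (vel r) <> None -> O q' r' ->
  meet q' r' < meet q r -> p = q \/ p = r -> p = q' \/ p = r' ->
  lend v q r <= lend v q' r' /\ rend v q' r' <= rend v q r.
Proof.
move=> rx Oq mm hp hp'.
have [rx' _ _ _] := (dO _ _).1 Oq.
have e : loc q (meet q r) = loc p (meet q r).
  by case: hp => -> //; exact: loc_meetE.
have e' : loc q' (meet q' r') = loc p (meet q' r').
  by case: hp' => -> //; exact: loc_meetE.
rewrite /lend /rend -/(loc _ _) -/(loc _ _) e e'.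
by have := loc_lip p (ltW mm); lra.
Qed.

End OneVelocity.

Section Locality.
Variables (v : int -> velocity) (out : reaction -> particle -> particle -> outcome).
Variable O : particle -> particle -> Prop.
Hypothesis dO : dynamics x v out O.

Lemma vel_boxed i j q : within i j q -> velocity_of (boxed i j v) q = velocity_of v q.
Proof. by apply: vel_within => k *; rewrite boxed_in. Qed.

Lemma lend_boxed i j q r : within i j q -> within i j r ->
  [/\ meet x (boxed i j v) q r = meet x v q r,
      lend (boxed i j v) q r = lend v q r & rend (boxed i j v) q r = rend v q r].
Proof.
move=> wq wr; have eq := vel_boxed wq; have er := vel_boxed wr.
by rewrite /lend /rend /loc (meet_eq x eq er) eq.
Qed.

Lemma res_boxed i j q r : within i j q -> within i j r ->
  res (boxed i j v) out q r = res v out q r.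
Proof. by move=> wq wr; rewrite /res !vel_boxed. Qed.

(** The light cone of the meeting of i and j has base [x i, x j]. The collisions with cones in this
    interval form a closed family in the sense of [agree], so the full system and the box agree on
    them. *)
Lemma meetRL_local i j : i <= j ->
  meetRL x v out i j <-> [/\ v i = vright, v j = vleft & O (Initial i) (Initial j)].
Proof.
move=> ij.
pose W q r := [/\ within i j q, within i j r,
  reaction_of (velocity_of v q) (velocity_of v r) <> None,
  x i <= lend v q r & rend v q r <= x j].
have cone vv (OO : particle -> particle -> Prop) q r q' r' p :
    dynamics x vv out OO ->
    reaction_of (velocity_of vv q) (velocity_of vv r) <> None ->
    x i <= lend vv q r -> rend vv q r <= x j -> OO q' r' ->
    meet x vv q' r' < meet x vv q r -> p = q \/ p = r -> p = q' \/ p = r' ->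
    [/\ within i j q', within i j r',
      reaction_of (velocity_of vv q') (velocity_of vv r') <> None,
      x i <= lend vv q' r' & rend vv q' r' <= x j].
  move=> dd rx l1 l2 Oq mm hp hp'.
  have [c1 c2] := cone_mono dd rx Oq mm hp hp'.
  have [e1 e2] := collision_ends dd Oq.
  have [h1 h2] := collision_lohi dd Oq.
  have [rx' h3 _ _] := (dd _ _).1 Oq.
  have : x i <= x (lo q') by lra.
  have : x (hi r') <= x j by lra.
  rewrite !(xle xlt) => k1 k2; split => //; try lra; split=> //; lia.
have H : v i = vright -> v j = vleft ->
    O (Initial i) (Initial j) <-> box x v out i j (Initial i) (Initial j).
  move=> vi vj.
  apply: (@agree _ x W v (boxed i j v) out out O (box x v out i j) i j) => //.
  - by move=> k k1 k2; rewrite boxed_in.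
  - by move=> q r [].
  - move=> q r k l [wq wr _ _ _] kl vk vl.
    have /= : within i j (Generated k l) by case: kl => <-.
    case=> /= k1 k2 k3; split; try by split => //=; lia.
    + by rewrite /= vk vl.
    + rewrite /lend /loc /meet /= vk vl /mid /bir /=.
      have := xle xlt i k; rewrite k1; lra.
    + rewrite /rend /loc /meet /= vk vl /mid /bir /=.
      have := xle xlt l j; rewrite k3; lra.
  - exact: box_dynamics.
  - by move=> q r q' r' p [_ _ rx l1 l2] Oq mm hp hp' _; apply: cone hp hp'.
  - move=> q r q' r' p [wq wr rx l1 l2] Oq mm hp hp' _.
    have [w1 w2] := occ_within Oq.
    have [m1 le1 re1] := lend_boxed wq wr.
    have [m2 le2 re2] := lend_boxed w1 w2.
    have := cone _ _ q r q' r' p (box_dynamics x v out i j).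
    by rewrite le1 re1 le2 re2 !vel_boxed //; apply.
  - by move=> q r q' r' _ [w1 w2 _ _ _] _; rewrite res_boxed.
  - split.
    + by split => /=.
    + by split => /=.
    + by rewrite /= vi vj.
    + by rewrite /lend /loc /meet /= vi vj /mid /bir /=; lra.
    + by rewrite /rend /loc /meet /= vi vj /mid /bir /=; lra.
by split=> -[vi vj /(H vi vj)].
Qed.

Lemma blockade_exist b : lo b <= hi b ->
  (velocity_of v b = vzero /\ exist v out O b) <-> blockade x v out b.
Proof.
case: b => [k|i j] /= ij; first by split=> [[]|].
by rewrite (meetRL_local ij); split=> [[_ [*]]|[[*]]]; split.
Qed.

(* Particles starting to the right of t evolve as if there were nothing
   to the left, as long as they are not destroyed from the left at the right
   of x_t. *)
Definition shielded (t : int) (T : R) : Prop :=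
  forall p r, O p r -> lo p <= t -> t < lo r -> meet x v p r < T ->
    res v out p r <> Some (velocity_of v r) -> loc x v r (meet x v p r) <= x t.

Lemma right_loc q u t : lo q <= hi q -> t < lo q -> 0 <= u ->
  velocity_of v q <> vleft -> x t < loc x v q u.
Proof.
rewrite -(xle xlt) -xlt /loc /mid /bir => h1 h2 u0.
have : velocity_of v q = vzero \/ x (lo q) = x (hi q).
  by case: (q) => [k|? ?]; [right|left].
by case e: (velocity_of v q) => //= -[//|h] _; lra.
Qed.

(** Comparison through [agree]. The family could only be left through a reactant destroyed by a
    particle starting at or left of t. By the shield this happens at or left of x t, so the reactant
    is a left arrow, and it could not later meet a particle that started right of t and does not
    move left. *)
Lemma cut_agree t k T q r : shielded t T ->
  within (t + 1) k q -> within (t + 1) k r ->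
  reaction_of (velocity_of v q) (velocity_of v r) <> None -> hi q < lo r ->
  rend v q r <= x k -> meet x v q r <= T ->
  (O q r <-> box x v out (t + 1) k q r).
Proof.
move=> sh wq wr rx qr re mT.
pose W q r := [/\ within (t + 1) k q /\ within (t + 1) k r,
  reaction_of (velocity_of v q) (velocity_of v r) <> None, hi q < lo r,
  rend v q r <= x k & meet x v q r <= T].
apply: (@agree _ x W v (boxed (t + 1) k v) out out O (box x v out (t + 1) k) (t + 1) k) => //.
- by move=> m *; rewrite boxed_in.
- by move=> ? ? [].
- move=> {wq wr rx qr re mT}q {}r i j [[wq wr] rx qr re mT] ij vi vj.
  have w : within (t + 1) k (Generated i j) by case: ij => <-.
  case: (w) => /= k1 k2 k3; split; try by split; split => //=; lia.
  + by rewrite /= vi vj.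
  + by rewrite lt_neqAle k2 andbT; apply/eqP => /= e; rewrite e vj in vi.
  + by rewrite /rend /loc /meet /= vi vj /mid /bir /=; have := xle xlt j k; rewrite k3; lra.
  + have [hq1 hq2 hq3] := wq; have [hr1 hr2 hr3] := wr.
    rewrite /meet /= vi vj -[(_ / 2)]/(bir x (Generated i j)).
    apply: le_trans mT.
    by have [b1 b2] := meet_gt xlt hq2 hr2 qr rx; case: ij => <-; exact: ltW.
- exact: box_dynamics.
- move=> {wq wr rx qr re mT}q {}r q' r' p [[wq wr] rx qr re mT] Oq mm hp hp' nr.
  have [c1 c2] := cone_mono dO rx Oq mm hp hp'.
  have [e1 e2] := collision_ends dO Oq.
  have [h1 h2] := collision_lohi dO Oq.
  have [rx' h3 _ _] := (dO _ _).1 Oq.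
  have m0 := meet_gt0 dO Oq.
  have k1 : hi r' <= k by rewrite -(xle xlt); lra.
  have wp : within (t + 1) k p by case: hp => ->.
  case: (leP (lo q') t) => lt; last first.
    split; [split; split; lia|exact: rx'|exact: h3|lra|lra].
  have pr : p = r' by case: hp' => // e; move: wp; rewrite e => -[]; lia.
  rewrite pr in hp nr wp.
  have lr' : t < lo r' by case: wp; lia.
  have l1 := sh _ _ Oq lt lr' (lt_le_trans mm mT) nr.
  exfalso.
  have vr' : velocity_of v r' = vleft.
    apply: contrapT => ne; have := right_loc h2 lr' (ltW m0) ne; lra.
  have er : r' = r.
    by case: hp => // e; rewrite -e vr' in rx; case: (velocity_of v r) rx.
  have [q1 q2 q3] := wq.
  have lq : x t < loc x v q (meet x v q r).
    apply: right_loc => //; [lia|lra|].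
    by move=> e; rewrite e in rx; case: (velocity_of v r) rx.
  rewrite loc_meetE // -er in lq.
  have := lq; rewrite er in l1 lq vr' *; move: l1; rewrite /loc vr' /=.
  by move: mm; rewrite er; lra.
- move=> {wq wr rx qr re mT}q {}r q' r' p [[wq wr] rx qr re mT] Oq mm hp hp' nr.
  have [w1 w2] := occ_within Oq.
  have [m1 le1 re1] := lend_boxed wq wr.
  have [m2 le2 re2] := lend_boxed w1 w2.
  have [rx' qr' _ _] := (box_dynamics x v out (t+1) k _ _).1 Oq.
  have := cone_mono (box_dynamics x v out (t + 1) k) _ Oq mm hp hp'.
  rewrite re1 re2 !vel_boxed // => /(_ rx) [_ h].
  rewrite !vel_boxed // in rx'.
  rewrite m1 m2 in mm; split; [by split|exact: rx'|exact: qr'|lra|lra].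
- by move=> ? ? ? ? _ [[w1 w2] _ _ _ _] _; rewrite res_boxed.
Qed.

End Locality.
End Cone.

(** * Arrivals at a blockade from its two sides *)

Section FromTheRight.
Variables (R : realType) (x : int -> R) (v : int -> velocity).
Variable out : reaction -> particle -> particle -> outcome.
Variable O : particle -> particle -> Prop.
Hypothesis xlt : forall i j, (x i < x j) = (i < j).
Hypothesis xgen : generic x.
Hypothesis dO : dynamics x v out O.

Lemma left_partner q r : O q r -> velocity_of v q <> vleft.
Proof. by move/dO=> [rx _ _ _] e; rewrite e in rx; case: (velocity_of v r) rx. Qed.

Lemma right_partner q r : O q r -> velocity_of v r <> vright.
Proof. by move/dO=> [rx _ _ _] e; rewrite e in rx; case: (velocity_of v q) rx. Qed.

Lemma left_arrow_collision q k : O q (Initial k) -> v k = vleft ->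
  [/\ lo q <= hi q, hi q < k, reaction_of (velocity_of v q) vleft <> None
    & rend x v q (Initial k) = x k].
Proof.
move=> Oq vk; have [rx qr [eq _ _] _] := (dO _ _).1 Oq.
have h := exist_lohi dO eq; rewrite /= vk in rx; split => //.
rewrite /rend loc_meetE /=; last by rewrite vk.
by rewrite /loc /= vk /mid /bir /=; lra.
Qed.

(** While b is present it separates its two sides; before its birth its right parent, the left arrow
    started at [hi b], does so. *)
Lemma crosses_blockade b T p r : pres x v out O b T -> O p r ->
  lo p <= hi b -> hi b < lo r -> meet x v p r < T -> p = b.
Proof.
move=> pb Opr pb' br mT; apply: contrapT => pnb.
have m0 := meet_gt0 xlt dO Opr.
have hb : lo b <= hi b by case: pb => e _ _; exact: exist_lohi dO _ e.
have [hp hr] := collision_lohi dO Opr.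
have rnb : b <> r by move=> e; rewrite -e in br; lia.
case: (ltP (bir x b) (meet x v p r)) => bu.
  have pbu := pres_le bu (ltW mT) pb.
  by have := collision_between xlt xgen dO Opr erefl pbu (nesym pnb) rnb; lia.
case: b pb hb pb' br pnb rnb bu => [k|s t] pb hb pb' br pnb rnb bu.
  by move: bu; rewrite /bir /= ; lra.
have [[vs vt Ost ost] _ _] := pb.
have [_ pt] := parents_present dO Ost vs vt.
have pt' : pres x v out O (Initial t) (meet x v p r).
  by apply: pres_le pt => //; rewrite /bir /=; lra.
have ntp : Initial t <> p by move=> e; apply: (left_partner Opr); rewrite -e.
have ntr : Initial t <> r by move=> e; move: br; rewrite -e /=; lia.
by have /= := collision_between xlt xgen dO Opr erefl pt' ntp ntr; move: pb' br => /=; lia.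
Qed.

Lemma shielded_blockade b T : velocity_of v b = vzero -> pres x v out O b T ->
  shielded x v out O (hi b) T.
Proof.
move=> vb pb p r Opr pb' br mT _.
have e := crosses_blockade pb Opr pb' br mT.
have [rx _ _ _] := (dO _ _).1 Opr.
have hb : lo b <= hi b by case: pb => e' _ _; exact: exist_lohi dO _ e'.
rewrite -(loc_meetE x rx) e /loc vb /= /mid.
by move: hb; rewrite -(xle xlt); lra.
Qed.

Lemma box_before t k q : box x v out (t + 1) k q (Initial k) -> v k = vleft ->
  [/\ t < lo q, lo q <= hi q, hi q < k, reaction_of (velocity_of v q) vleft <> None
    & meet x v q (Initial k) < x k - x t].
Proof.
move=> Bq vk; have [wq wk] := occ_within Bq.
have [rx qk _ _] := (box_dynamics x v out (t + 1) k _ _).1 Bq.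
rewrite !vel_boxed //= vk in rx.
have [q1 q2 q3] := wq; split => //; first by lia.
have rx' : reaction_of (velocity_of v q) (velocity_of v (Initial k)) <> None.
  by rewrite /= vk.
have m0 : 0 < meet x v q (Initial k).
  have [e _ _] := lend_boxed x v wq wk.
  by rewrite -e; exact: (meet_gt0 xlt (box_dynamics x v out (t + 1) k) Bq).
have ql : velocity_of v q <> vleft by move=> e; rewrite e in rx.
have := right_loc xlt q2 (_ : t < lo q) (ltW m0) ql.
rewrite loc_meetE // /loc /= vk /mid /bir /= => /(_ ltac:(lia)); lra.
Qed.

Lemma cut_left_arrow t T k q : shielded x v out O t T -> v k = vleft ->
  t < lo q -> lo q <= hi q -> hi q < k ->
  reaction_of (velocity_of v q) vleft <> None -> meet x v q (Initial k) <= T ->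
  (O q (Initial k) <-> box x v out (t + 1) k q (Initial k)).
Proof.
move=> sh vk tq hq qk rx mT; apply: (cut_agree xlt dO sh) => //=.
- by split; lia.
- by split => /=; lia.
- by rewrite vk.
- rewrite /rend loc_meetE /= ?vk // /loc /= vk /mid /bir /=; lra.
Qed.

Lemma exitL_survives t T k q : shielded x v out O t T -> exitL x v out (t + 1) k ->
  O q (Initial k) -> t < lo q -> meet x v q (Initial k) <= T ->
  res v out q (Initial k) = Some vleft.
Proof.
move=> sh [tk vk ex] Oq tq mT; apply: ex.
have [h1 h2 h3 _] := left_arrow_collision Oq vk.
by apply/(cut_left_arrow sh).
Qed.

(** At time x k - x t the arrow k is at x t, and by [box_before] every collision of k in the box
    happens before that time. *)
Lemma exitL_alive t T k : shielded x v out O t T -> t < k -> v k = vleft ->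
  x k - x t <= T -> alive x v out O (Initial k) (x k - x t) ->
  exitL x v out (t + 1) k.
Proof.
move=> sh tk vk kT [_ al]; split=> //; first by lia.
move=> q Bq; have [h1 h2 h3 h4 h5] := box_before Bq vk.
have Oq : O q (Initial k) by apply/(cut_left_arrow sh) => //; lra.
by rewrite al //= vk.
Qed.

(** Until the collision b shields its right side, so the box [hi b + 1, k] shows the true evolution.
    An arrow m that leaves its own box before k does hit b, and b has survived this since it is
    still there for k. *)
Lemma collision_reachL b k : O b (Initial k) -> velocity_of v b = vzero ->
  reachL x v out b k.
Proof.
move=> Ob vb; have [rx bk pb pk] := (dO _ _).1 Ob.
have vk : v k = vleft by move: rx; rewrite vb /=; case: (v k).
have hb : lo b <= hi b by case: pb => e' _ _; exact: exist_lohi dO _ e'.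
have sh := shielded_blockade vb pb.
have mE m : v m = vleft -> meet x v b (Initial m) = x m - mid x b.
  by move=> vm; rewrite /meet vb /= vm.
have mb : mid x b <= x (hi b) by move: hb; rewrite -(xle xlt) /mid; lra.
split.
  apply: (exitL_alive sh) => //; first by rewrite mE //; lra.
  by case: pk => _ _ /alive_le; apply; rewrite mE //; lra.
move=> m bm mk em; have [_ vm _] := em.
have mm : meet x v b (Initial m) < meet x v b (Initial k).
  by rewrite !mE //; move: mk; rewrite -xlt; lra.
have Om : O b (Initial m).
  apply/dO; split => //=; first by rewrite vb vm.
    apply: pres_le pb; last exact: ltW.
    have /= := @meet_gt _ _ v xlt b (Initial m) hb (lexx _) bm.
    by rewrite vb vm => /(_ ltac:(done)) [].
  split => //=.
    by rewrite mE // /bir /=; move: bm; rewrite -xlt; lra.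
  split=> q Oq; first by have := left_partner Oq; rewrite /= vm.
  move=> mq; rewrite /= vm; case: (leP (lo q) (hi b)) => lq.
    have e := crosses_blockade pb Oq lq bm (lt_trans mq mm).
    by move: mq; rewrite e ltxx.
  by apply: (exitL_survives sh em) => //; apply: ltW (lt_trans mq mm).
have [_ _ [al _]] := pb; have := al _ Om mm.
by rewrite /res vb /= vm.
Qed.

End FromTheRight.

Section Merge.
Variables (R : realType) (x : int -> R) (v : int -> velocity).
Variable out : reaction -> particle -> particle -> outcome.
Variable O : particle -> particle -> Prop.
Hypothesis xlt : forall i j, (x i < x j) = (i < j).
Hypothesis xgen : generic x.
Hypothesis dO : dynamics x v out O.

Let xlt' := @xflip_lt _ x 0 0 xlt.
Let xgen' := @xflip_generic _ x 0 0 xgen.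
Let dO' := dynamics_pflip 0 0 dO.
Notation x' := (xflip x 0 0).
Notation v' := (velflip v 0).
Notation out' := (outflip out 0).
Notation O' := (fun q r => O (pflip 0 r) (pflip 0 q)).

Lemma collision_reachR i b : O (Initial i) b -> velocity_of v b = vzero ->
  reachR x v out i b.
Proof.
move=> Ob vb; have := @collision_reachL _ _ _ _ _ xlt' xgen' dO' (pflip 0 b) (0 - i).
by rewrite vel_pflip !pflipK /= subKr vb reachL_flip; apply.
Qed.

Lemma crosses_blockadeL b T p r : pres x v out O b T -> O p r ->
  hi p < lo b -> lo b <= hi r -> meet x v p r < T -> r = b.
Proof.
move=> pb Opr pb' br mT.
have := @crosses_blockade _ _ _ _ _ xlt' xgen' dO' (pflip 0 b) T (pflip 0 r) (pflip 0 p).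
rewrite pres_pflip meet_pflip !pflipK !lo_pflip !hi_pflip => /(_ pb Opr).
move=> /(_ ltac:(lia) ltac:(lia) mT) e.
by rewrite -(pflipK 0 r) e pflipK.
Qed.

Lemma exitR_survives b T i r : velocity_of v b = vzero -> pres x v out O b T ->
  exitR x v out i (lo b - 1) -> O (Initial i) r -> hi r < lo b ->
  meet x v (Initial i) r <= T -> res v out (Initial i) r = Some vright.
Proof.
move=> vb pb ei Or rb mT.
have pb' : pres x' v' out' O' (pflip 0 b) T by rewrite pres_pflip pflipK.
have vb' : velocity_of v' (pflip 0 b) = vzero by rewrite vel_pflip pflipK vb.
have sh := shielded_blockade xlt' xgen' dO' vb' pb'.
have := @exitL_survives _ _ _ _ _ xlt' dO' _ T (0 - i) (pflip 0 r) sh.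
rewrite hi_pflip (_ : 0 - lo b + 1 = 0 - (lo b - 1)); last by lia.
rewrite exitL_flip lo_pflip res_pflip pflipK /= subKr meet_pflip pflipK /= subKr.
move=> /(_ ei Or ltac:(lia) mT) /(congr1 oflip).
by rewrite oflipK.
Qed.

(* The two sides of a blockade evolve independently until it is destroyed. *)
Lemma collision_right_arrow i b : lo b <= hi b -> i < lo b ->
  O (Initial i) b /\ velocity_of v b = vzero <->
  [/\ v i = vright, blockade x v out b, reachR x v out i b
    & forall k, reachL x v out b k -> x k - mid x b < mid x b - x i ->
        out BlockLeft b (Initial k) = Some vzero].
Proof.
move=> hb ib; split.
  move=> [Ob vb]; have [rx _ pi pb] := (dO _ _).1 Ob.
  have vi : v i = vright by move: rx; rewrite vb /=; case: (v i).
  have mib : meet x v (Initial i) b = mid x b - x i by rewrite /meet vb /= vi.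
  split => //.
  - by apply/(blockade_exist xlt dO hb); split => //; case: pb.
  - exact: collision_reachR.
  move=> k rk mk; have [[bk vk _] _] := rk.
  have sh := shielded_blockade xlt xgen dO vb pb.
  have mbk : meet x v b (Initial k) = x k - mid x b by rewrite /meet vb /= vk.
  have Ok : O b (Initial k).
    apply/dO; split => //=; first by rewrite vb vk.
    - by lia.
    - apply: pres_le pb; last by rewrite mib mbk ltW.
      have /= := @meet_gt _ _ v xlt b (Initial k) hb (lexx _) ltac:(move=> /=; lia).
      by rewrite vb vk => /(_ ltac:(done)) [].
    split => //=.
      rewrite mbk /bir /=; have : x (hi b) < x k by rewrite xlt; lia.
      by move: hb; rewrite -(xle xlt) /mid; lra.
    split=> q Oq; first by have := left_partner dO Oq; rewrite /= vk.
    move=> mq; rewrite /= vk.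
    have mq' : meet x v q (Initial k) < meet x v (Initial i) b.
      by rewrite mib; apply: lt_trans mq _; rewrite mbk.
    case: (leP (lo q) (hi b)) => lq.
      have e := crosses_blockade xlt xgen dO pb Oq lq ltac:(move=> /=; lia) mq'.
      by move: mq; rewrite e ltxx.
    by case: rk => rk _; apply: (exitL_survives xlt dO sh rk) => //; apply: ltW.
  have [_ _ [al _]] := pb; have := al _ Ok.
  by rewrite mbk mib /res vb /= vk; apply.
move=> [vi bb ri rk].
have [vb eb] := (blockade_exist xlt dO hb).2 bb.
have mib : meet x v (Initial i) b = mid x b - x i by rewrite /meet vb /= vi.
have rx : reaction_of (velocity_of v (Initial i)) (velocity_of v b) <> None.
  by rewrite /= vi vb.
have [b1 b2] := @meet_gt _ _ v xlt (Initial i) b (lexx _) hb ib rx.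
have pb : pres x v out O b (meet x v (Initial i) b).
  split => //; split=> r Or mr; have [rx' br pr1 pr2] := (dO _ _).1 Or.
    have vr : velocity_of v r = vleft.
      by move: rx'; rewrite vb; case: (velocity_of v r).
    have [k er] : exists k, r = Initial k by exists (lo r); apply: (@arrowE v); rewrite vr.
    subst r; move: vr => /= vr; rewrite /res /= vb vr /=.
    apply: rk; first exact: (collision_reachL xlt xgen dO).
    by move: mr; rewrite mib /meet /= vb vr.
  have vr : velocity_of v r = vright.
    by move: rx'; rewrite vb; case: (velocity_of v r).
  have [m er] : exists m, r = Initial m by exists (lo r); apply: (@arrowE v); rewrite vr.
  subst r; move: vr => /= vr; rewrite /res /= vb vr /=.
  have [er' _] := collision_reachR Or vb.
  apply: (proj2 ri) => //.
  by move: mr; rewrite mib /meet /= vb vr -(xlt i); lra.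
split => //; apply/dO; split => //.
split => //; split=> r Or mr; last by have := right_partner dO Or; rewrite /= vi.
rewrite /= vi; case: (ltP (hi r) (lo b)) => br.
  by apply: (exitR_survives vb pb) => //; [case: ri|exact: ltW].
by have e := crosses_blockadeL pb Or ib br mr; move: mr; rewrite e ltxx.
Qed.

End Merge.

(** * Events of a sub-box, computed in a larger box *)

Section Boxed.
Variables (R : realType) (x : int -> R) (v : int -> velocity).
Variable out : reaction -> particle -> particle -> outcome.
Variables i n : int.
Notation v' := (boxed i n v).

Lemma boxed_boxed i' j' : i <= i' -> j' <= n -> boxed i' j' v' = boxed i' j' v.
Proof.
move=> ii jj; apply/funext => k; rewrite {1}/boxed [in RHS]/boxed.
case: ltP => // ik; case: ltP => // kj; rewrite boxed_in //; lia.
Qed.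

Lemma box_boxed i' j' q r : i <= i' -> j' <= n ->
  box x v' out i' j' q r <-> box x v out i' j' q r.
Proof. by move=> ii jj; rewrite /box /occ boxed_boxed. Qed.

Lemma res_boxed_within i' j' q r : i <= i' -> j' <= n ->
  within i' j' q -> within i' j' r -> res v' out q r = res v out q r.
Proof.
move=> ii jj [q1 q2 q3] [r1 r2 r3]; apply: res_boxed; split; lia.
Qed.

Lemma exitL_boxed i' k : i <= i' -> k <= n ->
  exitL x v' out i' k <-> exitL x v out i' k.
Proof.
move=> ii kn; split=> -[h1 h2 h3]; split => //.
- by move: h2; rewrite boxed_in //; lia.
- move=> q /[dup] /occ_within[wq wk] /(@box_boxed i' k _ _ ii kn) /h3.
  by rewrite (res_boxed_within ii kn).
- by rewrite boxed_in //; lia.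
- move=> q /(@box_boxed i' k _ _ ii kn) /[dup] /occ_within[wq wk] /h3.
  by rewrite (res_boxed_within ii kn).
Qed.

Lemma exitR_boxed i' k : i <= i' -> k <= n ->
  exitR x v' out i' k <-> exitR x v out i' k.
Proof.
move=> ii kn; split=> -[h1 h2 h3]; split => //.
- by move: h2; rewrite boxed_in //; lia.
- move=> q /[dup] /occ_within[wq wk] /(@box_boxed i' k _ _ ii kn) /h3.
  by rewrite (res_boxed_within ii kn).
- by rewrite boxed_in //; lia.
- move=> q /(@box_boxed i' k _ _ ii kn) /[dup] /occ_within[wq wk] /h3.
  by rewrite (res_boxed_within ii kn).
Qed.

Lemma reachL_boxed b k : i <= lo b -> lo b <= hi b -> k <= n ->
  reachL x v' out b k <-> reachL x v out b k.
Proof.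
move=> ib hb kn.
have E m : m <= n -> exitL x v' out (hi b + 1) m <-> exitL x v out (hi b + 1) m.
  by move=> mn; apply: exitL_boxed => //; lia.
rewrite /reachL (E k) //.
by split=> -[h1 h2]; split=> // m m1 m2 em; apply: h2 => //; apply/E => //; lia.
Qed.

Lemma reachR_boxed m b : i <= m -> hi b <= n -> lo b <= hi b ->
  reachR x v' out m b <-> reachR x v out m b.
Proof.
move=> ib hb kn.
have E l : m <= l -> exitR x v' out l (lo b - 1) <-> exitR x v out l (lo b - 1).
  by move=> mn; apply: exitR_boxed => //; lia.
rewrite /reachR (E m) //.
by split=> -[h1 h2]; split=> // l m1 m2 em; apply: h2 => //; apply/E => //; lia.
Qed.

Lemma meetRL_boxed k l : i <= k -> k <= l -> l <= n ->
  meetRL x v' out k l <-> meetRL x v out k l.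
Proof.
move=> ik kl ln; rewrite /meetRL !boxed_in //; try lia.
have E := @box_boxed k l (Initial k) (Initial l) ik ln.
by split=> -[h1 h2 h3]; split => //; apply/E.
Qed.

Lemma blockade_boxed b : i <= lo b -> lo b <= hi b -> hi b <= n ->
  blockade x v' out b <-> blockade x v out b.
Proof.
case: b => [k|k l] /= ik kl ln; first by rewrite boxed_in.
by rewrite meetRL_boxed.
Qed.

Lemma exitL_left i' k : exitL x v out i' k -> v k = vleft.
Proof. by case. Qed.

End Boxed.

Section Merge2.
Variables (R : realType) (x : int -> R) (v : int -> velocity).
Variable out : reaction -> particle -> particle -> outcome.
Variable O : particle -> particle -> Prop.
Hypothesis xlt : forall i j, (x i < x j) = (i < j).
Hypothesis xgen : generic x.
Hypothesis dO : dynamics x v out O.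

Lemma collision_left_arrow b k : lo b <= hi b -> hi b < k ->
  O b (Initial k) /\ velocity_of v b = vzero <->
  [/\ v k = vleft, blockade x v out b, reachL x v out b k
    & forall i, reachR x v out i b -> mid x b - x i < x k - mid x b ->
        out RightBlock (Initial i) b = Some vzero].
Proof.
move=> hb bk.
have := @collision_right_arrow _ _ _ _ _ (@xflip_lt _ x 0 0 xlt) (@xflip_generic _ x 0 0 xgen)
  (dynamics_pflip 0 0 dO) (0 - k) (pflip 0 b).
rewrite lo_pflip hi_pflip pflipK /= subKr vel_pflip pflipK => /(_ ltac:(lia) ltac:(lia)) H.
have -> : velocity_of v b = vzero <-> vflip (velocity_of v b) = vzero.
  by case: (velocity_of v b).
have hbE := propext (blockade_flip x v out 0 0 hb).
rewrite H hbE (propext (reachR_flip x v out 0 0 b k)).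
have mE : mid (xflip x 0 0) (pflip 0 b) = - mid x b.
  by rewrite /mid /xflip lo_pflip hi_pflip !subKr; lra.
split=> -[h1 h2 h3 h4]; split => //.
- by move: h1; rewrite /velflip subKr; case: (v k).
- move=> i ri mi; have := h4 (0 - i); rewrite reachL_flip /outflip /= pflipK subKr => /(_ ri).
  rewrite mE /xflip !subKr => /(_ ltac:(lra)) /(congr1 oflip).
  by rewrite oflipK.
- by rewrite /velflip subKr h1.
- move=> i; rewrite -{1}(subKr 0 i) reachL_flip => ri.
  rewrite mE /xflip !subKr => mi; rewrite /outflip /= pflipK h4 //.
  by lra.
Qed.

End Merge2.

(** * Arrows that leave a box *)

Section Exits.
Variables (R : realType) (x : int -> R) (v : int -> velocity).
Variable out : reaction -> particle -> particle -> outcome.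
Hypothesis xlt : forall i j, (x i < x j) = (i < j).
Hypothesis xgen : generic x.
Variables i n : int.
Notation v' := (boxed i n v).
Notation O := (box x v out i n).
Let dO : dynamics x v' out O := box_dynamics x v out i n.

(** Vacuous: no collision of the box involves a particle started left of i. *)
Lemma box_shield T : shielded x v' out O (i - 1) T.
Proof. by move=> p r /occ_within[[? _ _] _]; lia. Qed.

(** The partners of a left arrow k start on its left, so an exit from [i, k] can be read off in any
    larger box [i, n]. *)
Lemma exitL_box k : i <= k -> k <= n ->
  exitL x v out i k <->
  v k = vleft /\ forall q, O q (Initial k) -> res v' out q (Initial k) = Some vleft.
Proof.
move=> ik kn; rewrite -(@exitL_boxed _ x v out i n) //.
have vk : v' k = v k by rewrite boxed_in.
have e : i - 1 + 1 = i by lia.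
split=> [ex|[vl h]].
  split; first by rewrite -vk; exact: exitL_left ex.
  move=> q Oq; have [[iq hq _] _] := occ_within Oq.
  have := @exitL_survives _ _ _ _ _ xlt dO (i - 1) _ k q (@box_shield (meet x (boxed i n v) q (Initial k))).
  by rewrite e; apply => //; lia.
split=> //; first by rewrite vk.
move=> q Bq; have Bq' : box x v' out (i - 1 + 1) k q (Initial k) by rewrite e.
have vk' : v' k = vleft by rewrite vk.
have [h1 h2 h3 h4 h5] := box_before xlt Bq' vk'.
by apply: h; apply/(cut_left_arrow xlt dO (@box_shield (meet x v' q (Initial k)))).
Qed.

Lemma exitR_box : i <= n ->
  exitR x v out i n <->
  v i = vright /\ forall r, O (Initial i) r -> res v' out (Initial i) r = Some vright.
Proof.
move=> i_n; rewrite -(@exitR_boxed _ x v out i n) // /exitR boxed_in //.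
have E r : box x v' out i n (Initial i) r <-> O (Initial i) r by apply: box_boxed.
by split=> [[_ ? h]|[? h]]; split=> // r /E/h.
Qed.

Lemma exitL_present k u : i <= k -> k <= n -> exitL x v out i k -> 0 < u ->
  pres x v' out O (Initial k) u.
Proof.
move=> ik kn /(exitL_box ik kn)[vk h] u0; split => //=; first by rewrite /bir /=; lra.
split=> q Oq _; last by rewrite h //= boxed_in // vk.
by have := left_partner dO Oq; rewrite /= boxed_in // vk.
Qed.

(* The right arrow i kills the left arrows that it meets while it is alive. *)
Lemma no_exit_before k u : v i = vright -> i < k -> k <= n ->
  pres x v' out O (Initial i) u -> (x k - x i) / 2 < u -> ~ exitL x v out i k.
Proof.
move=> vi ik kn pi ku ex.
have vk := exitL_left ex.
have vi' : v' i = vright by rewrite boxed_in //; lia.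
have vk' : v' k = vleft by rewrite boxed_in //; lia.
have k0 : 0 < (x k - x i) / 2 by move: ik; rewrite -xlt; lra.
have mE : meet x v' (Initial i) (Initial k) = (x k - x i) / 2 by rewrite /meet /= vi' vk'.
have Oik : O (Initial i) (Initial k).
  apply/dO; split => //=; first by rewrite vi' vk'.
    by rewrite mE; apply: pres_le pi; [rewrite /bir /=; lra|exact: ltW].
  by rewrite mE; apply: exitL_present => //; lia.
have [_ h] := (exitL_box (ltW ik) kn).1 ex.
have [_ _ [h' _]] := pi.
by have := h' _ Oik; rewrite mE h //= vi' => /(_ ku).
Qed.

(** With a permanent shield at t, the encounters of k with particles started right of t are those of
    the box [t + 1, k]; the others are listed separately. *)
Lemma split_exit t k : i <= t -> t < k -> k <= n ->
  (forall T, shielded x v' out O t T) ->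
  exitL x v out i k <-> exitL x v out (t + 1) k /\
    (forall q, O q (Initial k) -> lo q <= t -> res v' out q (Initial k) = Some vleft).
Proof.
move=> it tk kn sh; rewrite exitL_box //; last by lia.
rewrite -(@exitL_boxed _ x v out i n) //; last by lia.
have vk : v' k = v k by rewrite boxed_in //; lia.
split=> [[vl h]|[ex h]]; split => //.
- split => //; [lia|by rewrite vk|].
  have vk' : v' k = vleft by rewrite vk.
  move=> q Bq; have [h1 h2 h3 h4 h5] := box_before xlt Bq vk'.
  apply: h; apply/(cut_left_arrow xlt dO (sh (meet x v' q (Initial k)))) => //.
- by move=> q Oq _; apply: h.
- by rewrite -vk; exact: exitL_left ex.
move=> q Oq; case: (leP (lo q) t) => lq; first exact: h.
exact: (exitL_survives xlt dO (sh (meet x v' q (Initial k))) ex).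
Qed.

(** The exiting arrow m lives for ever and no collision takes place across it, so the particles
    right of m behave as if they were alone. This is the source of the renewal equations. *)
Lemma exit_after_exit m k : i <= m -> m < k -> k <= n -> exitL x v out i m ->
  exitL x v out i k <-> exitL x v out (m + 1) k.
Proof.
move=> im mk kn em.
have nc p r : O p r -> lo p <= m -> m < lo r -> False.
  move=> Opr pm mr; have m0 := meet_gt0 xlt dO Opr.
  have pm' := exitL_present im (ltW (lt_le_trans mk kn)) em m0.
  have vm : v' m = vleft by rewrite boxed_in ?(exitL_left em) //; lia.
  have nmp : Initial m <> p.
    by move=> e; apply: (left_partner dO Opr); rewrite -e.
  have nmr : Initial m <> r by move=> e; move: mr; rewrite -e ltxx.
  have [hp hr] := collision_lohi dO Opr.
  by have /= := collision_between xlt xgen dO Opr erefl pm' nmp nmr; lia.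
rewrite (split_exit im mk kn); first by split=> [[]|h] //; split=> // q Oq qm; case: (nc _ _ Oq).
by move=> T p r Opr pm mr; case: (nc _ _ Opr).
Qed.

End Exits.

(** * The fate of the leftmost particle of a box and its effect on exits *)

Section FirstParticle.
Variables (R : realType) (x : int -> R) (v : int -> velocity).
Variable out : reaction -> particle -> particle -> outcome.
Hypothesis xlt : forall i j, (x i < x j) = (i < j).
Hypothesis xgen : generic x.
Variables i n : int.
Notation v' := (boxed i n v).
Notation O := (box x v out i n).
Let dO : dynamics x v' out O := box_dynamics x v out i n.

(** By [hitsP], that the right arrow i really collides with b in the box [i, n]: every left arrow
    that would be faster must leave b standing. *)
Definition hits (b : particle) : Prop :=
  [/\ v i = vright, blockade x v out b, reachR x v out i b
    & forall k, k <= n -> reachL x v out b k -> x k - mid x b < mid x b - x i ->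
        out BlockLeft b (Initial k) = Some vzero].

Lemma hitsP b : lo b <= hi b -> i < lo b -> hi b <= n ->
  hits b <-> O (Initial i) b /\ velocity_of v' b = vzero.
Proof.
move=> hb ib bn; rewrite (collision_right_arrow xlt xgen dO hb ib) /hits.
have bB : blockade x v' out b <-> blockade x v out b by apply: blockade_boxed => //; lia.
have rB : reachR x v' out i b <-> reachR x v out i b by apply: reachR_boxed => //; lia.
have lB k : k <= n -> reachL x v' out b k <-> reachL x v out b k.
  by move=> kn; apply: reachL_boxed => //; lia.
rewrite boxed_in //; last by lia.
split=> -[h1 /bB h2 /rB h3 h4]; split=> // k.
  move=> rk; apply: h4; last by apply/lB => //; case: rk => -[? /[swap] _]; rewrite /boxed;
    case: ltP => //; case: ltP => // ? ? _; lia.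
  by case: rk => -[_ + _] _; rewrite /boxed; case: ltP => [|_]; [lia|case: ltP].
by move=> kn /(lB _ kn); apply: h4.
Qed.

Lemma boxed_blockade b : lo b <= hi b -> i <= lo b -> hi b <= n ->
  blockade x v out b -> velocity_of v' b = vzero /\ exist v' out O b.
Proof.
move=> hb ib bn bb; apply/(blockade_exist xlt dO hb).
by apply/blockade_boxed.
Qed.

Lemma pres_parent p u : pres x v' out O p u -> bir x p <= 0 \/
  exists k l, [/\ p = Generated k l, v' k = vright, v' l = vleft,
     O (Initial k) (Initial l) & pres x v' out O (Initial k) (bir x p)].
Proof.
move=> [ep _ _]; case: p ep => [k _|k l [vk vl Okl okl]].
  by left; rewrite /bir /=; lra.
right; exists k, l; split=> //.
by have [] := parents_present dO Okl vk vl.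
Qed.

Lemma no_crossing_before_birth b p r : exist v' out O b -> O p r -> lo p <= hi b ->
  hi b < lo r -> meet x v' p r <= bir x b -> False.
Proof.
case: b => [k|s t] eb Opr pb br mb; have m0 := meet_gt0 xlt dO Opr.
  by move: mb m0; rewrite /bir /=; lra.
have [vs vt Ost ost] := eb; have [_ pt] := parents_present dO Ost vs vt.
have pt' : pres x v' out O (Initial t) (meet x v' p r).
  by apply: pres_le pt => //; rewrite /bir /=; lra.
have ntp : Initial t <> p by move=> e; apply: (left_partner dO Opr); rewrite -e.
have ntr : Initial t <> r by move=> e; move: br; rewrite -e /=; lia.
have [hp hr] := collision_lohi dO Opr.
by have /= := collision_between xlt xgen dO Opr erefl pt' ntp ntr; move: pb br => /=; lia.
Qed.

(** Once b is born, nothing else is left of the particles in its hull, and there is nothing further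
    left in the box; so b alone can meet particles from beyond. *)
Lemma crossing_edge b p r : blockade x v out b -> lo b <= hi b -> lo b = i ->
  hi b <= n -> O p r -> lo p <= hi b -> hi b < lo r -> p = b.
Proof.
move=> bb hb ib bn Opr pb br; apply: contrapT => npb.
have [vb eb] := boxed_blockade hb ltac:(lia) bn bb.
case: (leP (meet x v' p r) (bir x b)) => [|bu].
  exact: (no_crossing_before_birth eb Opr).
set u := meet x v' p r in bu.
(* [u0] is u itself if b is still alive then, and otherwise the time of a collision that destroyed
   b. *)
have [u0 [bu0 u0u pu0]] : exists u0, [/\ bir x b < u0, u0 <= u & pres x v' out O b u0].
  case: (pselect (alive x v' out O b u)) => [al|/not_andP[]]; first by exists u.
    move=> /existsNP[r'] /not_implyP[Or'] /not_implyP[mr' _].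
    have [_ _ pb' _] := (dO _ _).1 Or'.
    by exists (meet x v' b r'); split=> //; [case: pb'|exact: ltW].
  move=> /existsNP[r'] /not_implyP[Or'] /not_implyP[mr' _].
  have [_ _ _ pb'] := (dO _ _).1 Or'.
  by exists (meet x v' r' b); split=> //; [case: pb'|exact: ltW].
have [[ip hp pn] _] := occ_within Opr.
have [_ _ pp _] := (dO _ _).1 Opr.
have b0 := bir_ge0 xlt dO eb.
case: (ltP (bir x p) u0) => bp.
  have pp' := pres_le bp u0u pp.
  by have := pres_disjoint xlt xgen dO npb pp' pu0; lia.
case: (pres_parent pp) => [|[k [l [ep vk vl Okl pk]]]]; first by lra.
have pk' : pres x v' out O (Initial k) u0.
  by apply: pres_le pk => //; rewrite /bir /=; lra.
have nkb : Initial k <> b by move=> e; move: vb; rewrite -e /= vk.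
by have /= := pres_disjoint xlt xgen dO nkb pk' pu0; move: ip pb; rewrite ep /=; lia.
Qed.

(** When arrow i hits b, the particles i, ..., hi b have been reduced to these two, and i does not
    survive the collision. *)
Lemma crossing_hit b p r : O (Initial i) b -> velocity_of v' b = vzero ->
  res v' out (Initial i) b <> Some vright ->
  O p r -> lo p <= hi b -> hi b < lo r -> p = b.
Proof.
move=> Oib vb kill Opr pb br; apply: contrapT => npb.
have [rx ib pi pb'] := (dO _ _).1 Oib; rewrite /= in ib.
have [hi' hb] := collision_lohi dO Oib.
have vi : v' i = vright by move: rx; rewrite vb /=; case: (v' i).
set T := meet x v' (Initial i) b in pi pb'.
have TE : T = mid x b - x i by rewrite /T /meet /= vi vb.
set u := meet x v' p r.
case: (ltP u T) => uT; first exact: npb (crosses_blockade xlt xgen dO pb' Opr pb br uT).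
have [[ip hp pn] _] := occ_within Opr.
have [rxp _ pp pr] := (dO _ _).1 Opr; rewrite -/u in pp pr.
have T0 : 0 < T := meet_gt0 xlt dO Oib.
have dead u' : T < u' -> ~ pres x v' out O (Initial i) u'.
  move=> Tu [_ _ [al _]]; apply: kill; rewrite (al _ Oib) /= ?vi //.
have aux q : i <= lo q -> lo q <= hi b -> q <> Initial i -> q <> b ->
    lo q <= hi q -> ~ pres x v' out O q T.
  move=> iq qb nqi nqb hq pq.
  by have /= := collision_between xlt xgen dO Oib erefl pq nqi nqb; lia.
(* A left arrow l reaching b at the same time as i would be a tie. *)
have tie l : x l + x i <> x (lo b) + x (hi b).
  move=> e; have bl : hi b < l by rewrite -xlt; move: ib hb; rewrite -!xlt -(xle xlt); lra.
  by apply: (xgen ib hb bl); lra.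
case: (ltP (bir x p) T) => bp.
  have pp' := pres_le bp uT pp.
  case: (pselect (p = Initial i)) => [e|ne]; last exact: (aux p).
  case: (ltP T u) => Tu; first by apply: (dead u) => //; rewrite -e.
  have uE : u = T by apply/le_anti; rewrite Tu uT.
  move: uE; rewrite TE /u /meet e /= vi; rewrite e /= vi in rxp.
  case er: (velocity_of v' r) rxp => // _ e1.
    by apply: (tie (lo r)); move: e1; rewrite /mid; lra.
  have [_ hr] := collision_lohi dO Opr.
  move: e1 br hb hr; rewrite /mid -!(xle xlt) -xlt; lra.
case: (pres_parent pp) => [|[k [l [ep vk vl Okl pk]]]]; first by lra.
case: (eqVneq k i) => [ki|nki]; last first.
  apply: (aux (Initial k)) => //=.
  - by move: ip; rewrite ep.
  - by move: pb; rewrite ep.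
  - by case=> e; rewrite e eqxx in nki.
  - by move=> e; move: vb; rewrite -e /= vk.
  - by apply: pres_le pk => //; rewrite /bir /=; lra.
case: (ltP T (bir x p)) => Tb; first by rewrite ki in pk; apply: (dead (bir x p)).
apply: (tie l); have : bir x p = T by lra.
by rewrite TE ep /bir /mid /= ki; lra.
Qed.

(** When i and j meet, nothing else is left of the particles i, ..., j, and neither a right arrow
    nor a blockade comes out; what remains cannot meet anything started further right. *)
Lemma no_crossing_annihilated j p r : meetRL x v out i j -> i < j -> j <= n ->
  out RightLeft (Initial i) (Initial j) <> Some vright ->
  out RightLeft (Initial i) (Initial j) <> Some vzero ->
  O p r -> lo p <= j -> j < lo r -> False.
Proof.
move=> mij ij jn nr nz Opr pj jr.
have [vi vj Oij] : [/\ v' i = vright, v' j = vleft & O (Initial i) (Initial j)].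
  by apply/(meetRL_local xlt dO (ltW ij)); apply/meetRL_boxed => //; exact: ltW.
have [pi pj'] := parents_present dO Oij vi vj.
set T := (x j - x i) / 2 in pi pj'.
have ntp : Initial j <> p by move=> e; apply: (left_partner dO Opr); rewrite -e.
have ntr : Initial j <> r by move=> e; move: jr; rewrite -e /=; lia.
have [[ip hp pn] [ir hr rn]] := occ_within Opr.
have m0 := meet_gt0 xlt dO Opr.
case: (leP (meet x v' p r) T) => uT.
  have pju : pres x v' out O (Initial j) (meet x v' p r).
    by apply: pres_le pj' => //; rewrite /bir /=; lra.
  by have /= := collision_between xlt xgen dO Opr erefl pju ntp ntr; lia.
have [_ _ pp _] := (dO _ _).1 Opr.
have TE : T = meet x v' (Initial i) (Initial j) by rewrite /meet /= vi vj.
have T0 : 0 < T by rewrite TE; exact: (meet_gt0 xlt dO Oij).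
have dead u' : T < u' -> ~ pres x v' out O (Initial i) u'.
  move=> Tu [_ _ [al _]]; apply: nr.
  by have := al _ Oij; rewrite -TE /res /= vi vj; apply.
have aux q : i <= lo q -> lo q <= j -> q <> Initial i -> q <> Initial j ->
    lo q <= hi q -> ~ pres x v' out O q T.
  move=> iq qb nqi nqb hq pq.
  by have /= := collision_between xlt xgen dO Oij TE pq nqi nqb; lia.
case: (ltP (bir x p) T) => bp.
  have pp' := pres_le bp (ltW uT) pp.
  case: (pselect (p = Initial i)) => [e|ne]; first by apply: (dead _ uT); rewrite -e.
  by apply: (aux p) => //; exact: nesym.
case: (pres_parent pp) => [|[k [l [ep vk vl Okl pk]]]]; first by lra.
case: (eqVneq k i) => [ki|nki]; last first.
  apply: (aux (Initial k)) => //=.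
  - by move: ip; rewrite ep.
  - by move: pj; rewrite ep.
  - by case=> e; rewrite e eqxx in nki.
  - by case=> e; move: vk; rewrite e vj.
  - by apply: pres_le pk => //; rewrite /bir /=; lra.
case: (ltP T (bir x p)) => Tb; first by rewrite ki in pk; apply: (dead (bir x p)).
have lj : l = j.
  apply: (@xinj _ x xlt); have : bir x p = T by lra.
  by rewrite ep /T /bir /= ki; lra.
by have [] := pp; rewrite ep ki lj => -[_ _ _].
Qed.

(* Exits through a place crossed by a single blockade. *)
Lemma exit_through b k : lo b <= hi b -> i <= lo b -> hi b < k -> k <= n ->
  velocity_of v' b = vzero ->
  (forall p r, O p r -> lo p <= hi b -> hi b < lo r -> p = b) ->
  exitL x v out i k <-> exitL x v out (hi b + 1) k /\
    (O b (Initial k) -> out BlockLeft b (Initial k) = Some vleft).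
Proof.
move=> hb ib bk kn vb H.
have rE : exitL x v out (hi b + 1) k -> res v' out b (Initial k) = out BlockLeft b (Initial k).
  by move=> ex; rewrite /res vb /= boxed_in ?(exitL_left ex) //; lia.
rewrite (@split_exit _ _ _ _ xlt i n (hi b) k) //; try lia.
  split=> -[h1 h2]; split=> //.
    by move=> Ob; rewrite -rE //; apply: h2.
  move=> q Oq qb; have e := H q (Initial k) Oq qb bk.
  by rewrite e rE //; apply: h2; rewrite -e.
move=> T p r Opr pb br _ _; have [rx _ _ _] := (dO _ _).1 Opr.
by rewrite -(loc_meetE x rx) (H _ _ Opr pb br) /loc vb /= /mid; move: hb; rewrite -(xle xlt); lra.
Qed.

Lemma collision_left_box b k : lo b <= hi b -> i <= lo b -> hi b < k -> k <= n ->
  blockade x v out b ->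
  O b (Initial k) <-> reachL x v out b k /\
    forall m, i <= m -> reachR x v out m b -> mid x b - x m < x k - mid x b ->
      out RightBlock (Initial m) b = Some vzero.
Proof.
move=> hb ib bk kn bb; have bn : hi b <= n by lia.
have [vb _] := boxed_blockade hb ib bn bb.
have := collision_left_arrow xlt xgen dO hb bk.
have -> : (O b (Initial k) /\ velocity_of v' b = vzero) <-> O b (Initial k).
  by split=> [[]|].
move=> ->; have lB : reachL x v' out b k <-> reachL x v out b k by apply: reachL_boxed.
have rB m : i <= m -> reachR x v' out m b <-> reachR x v out m b.
  by move=> im; apply: reachR_boxed.
split=> [[h1 h2 /lB h3 h4]|[h3 h4]].
  by split=> // m im /rB rm; apply: h4; exact: rm.
split.
- by case: h3 => -[_ vk _] _; rewrite boxed_in //; lia.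
- exact/blockade_boxed.
- exact/lB.
move=> m rm; have im : i <= m.
  by case: rm => -[_ + _] _; rewrite /boxed; case: ltP.
by apply: h4 => //; exact/rB.
Qed.

Lemma exit_edge b k : blockade x v out b -> lo b <= hi b -> lo b = i ->
  hi b < k -> k <= n ->
  exitL x v out i k <-> exitL x v out (hi b + 1) k /\
    (reachL x v out b k -> out BlockLeft b (Initial k) = Some vleft).
Proof.
move=> bb hb ib bk kn.
have bn : hi b <= n by lia.
have ib' : i <= lo b by lia.
have [vb eb] := boxed_blockade hb ib' bn bb.
rewrite (@exit_through b) //; last by move=> p r Opr; apply: crossing_edge.
rewrite collision_left_box //.
suff -> : (reachL x v out b k /\ forall m, i <= m -> reachR x v out m b ->
   mid x b - x m < x k - mid x b -> out RightBlock (Initial m) b = Some vzero) <->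
   reachL x v out b k by [].
by split=> [[]|] //; split=> // m im [[mb _ _] _]; lia.
Qed.

(** All right arrows reaching b leave it standing, those after i by [reachR] and i by assumption, so
    b acts like a blockade at the edge of the box, as in [exit_edge]. *)
Lemma exit_hit_blocked b k : hits b -> lo b <= hi b -> i < lo b -> hi b < k -> k <= n ->
  out RightBlock (Initial i) b = Some vzero ->
  exitL x v out i k <-> exitL x v out (hi b + 1) k /\
    (reachL x v out b k -> out BlockLeft b (Initial k) = Some vleft).
Proof.
move=> hit hb ib bk kn ob; have [vi bb rb _] := hit.
have bn : hi b <= n by lia.
have ib' : i <= lo b by lia.
have [Oib vb] := (hitsP hb ib bn).1 hit.
have kill : res v' out (Initial i) b <> Some vright.
  have vi' : v' i = vright by rewrite boxed_in //; lia.
  by rewrite /res vb /= vi' /= ob.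
rewrite (@exit_through b) //; last by move=> p r; apply: crossing_hit.
rewrite collision_left_box //.
suff -> : (reachL x v out b k /\ forall m, i <= m -> reachR x v out m b ->
   mid x b - x m < x k - mid x b -> out RightBlock (Initial m) b = Some vzero) <->
   reachL x v out b k by [].
split=> [[]|] //; split=> // m im rm _; case: (eqVneq m i) => [-> //|mi].
by have [em _] := rm; have [mb _ _] := em; case: rb => _; apply=> //; lia.
Qed.

(** An arrow arriving before i collides with b, which survives it by [hits], so that arrow does not
    leave. An arrow arriving after i finds the way free. *)
Lemma exit_hit_cleared b k : hits b -> lo b <= hi b -> i < lo b -> hi b < k -> k <= n ->
  out RightBlock (Initial i) b <> Some vzero -> out RightBlock (Initial i) b <> Some vright ->
  exitL x v out i k <-> exitL x v out (hi b + 1) k /\ mid x b - x i < x k - mid x b.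
Proof.
move=> hit hb ib bk kn ob ob'; have [vi bb rb lb] := hit.
have bn : hi b <= n by lia.
have ib' : i <= lo b by lia.
have [Oib vb] := (hitsP hb ib bn).1 hit.
have kill : res v' out (Initial i) b <> Some vright.
  have vi' : v' i = vright by rewrite boxed_in //; lia.
  by rewrite /res vb /= vi'.
rewrite (@exit_through b) //; last by move=> p r; apply: crossing_hit.
rewrite collision_left_box //.
have ne : mid x b - x i <> x k - mid x b.
  by have := xgen ib hb bk; rewrite /mid => ne e; apply: ne; lra.
have zero m : m <= k -> exitL x v out (hi b + 1) m -> x m - mid x b < mid x b - x i ->
    reachL x v out b m.
  have [d] := ubnP (absz (m - hi b)); elim: d m => // d IH m md mk em mT.
  split=> // l bl lm el.
  have lT : x l - mid x b < mid x b - x i by move: lm; rewrite -xlt; lra.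
  by apply: lb => //; [lia|apply: IH => //; lia].
split=> -[ex h]; split=> //.
  rewrite ltNge le_eqVlt; apply/negP => /orP[/eqP e|lt]; first exact: ne.
  have rk := zero k (lexx _) ex lt.
  have := h; rewrite (lb k kn rk lt) => h'.
  have: Some vzero = Some vleft; last by [].
  apply: h'; split=> // m im rm mm; case: (eqVneq m i) => [mi|mi].
    by exfalso; move: mm lt; rewrite mi; lra.
  by have [em _] := rm; have [mb _ _] := em; case: rb => _; apply=> //; lia.
by move=> [_ /(_ i (lexx i) rb h)].
Qed.

Lemma no_exit_hit b k : hits b -> lo b <= hi b -> i < lo b -> hi b <= n ->
  i <= k -> k <= hi b -> ~ exitL x v out i k.
Proof.
move=> hit hb ib bn ik kb ex; have [vi bb rb _] := hit.
have [Oib vb] := (hitsP hb ib bn).1 hit.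
have [_ _ pi _] := (dO _ _).1 Oib.
have ik' : i < k.
  rewrite lt_neqAle ik andbT; apply/eqP => e; have := exitL_left ex.
  by rewrite -e vi.
apply: (no_exit_before xlt vi ik' (le_trans kb bn) pi) => //.
rewrite /meet vb /= boxed_in ?vi //; last by lia.
by rewrite /mid; move: kb ib; rewrite -(xle xlt) -xlt; lra.
Qed.

Lemma meetRL_parents j : meetRL x v out i j -> i < j -> j <= n ->
  [/\ v' i = vright, v' j = vleft, O (Initial i) (Initial j),
     pres x v' out O (Initial i) ((x j - x i) / 2) &
     pres x v' out O (Initial j) ((x j - x i) / 2)].
Proof.
move=> mij ij jn.
have [vi vj Oij] : [/\ v' i = vright, v' j = vleft & O (Initial i) (Initial j)].
  by apply/(meetRL_local xlt dO (ltW ij)); apply/meetRL_boxed => //; exact: ltW.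
by have [] := parents_present dO Oij vi vj.
Qed.

Lemma no_exit_meet j k : meetRL x v out i j -> i < j -> j <= n -> i <= k -> k < j ->
  ~ exitL x v out i k.
Proof.
move=> mij ij jn ik kj ex; have [vi _ _ pi _] := meetRL_parents mij ij jn.
rewrite boxed_in // in vi; last by lia.
have ik' : i < k.
  rewrite lt_neqAle ik andbT; apply/eqP => e; have := exitL_left ex.
  by rewrite -e vi.
apply: (no_exit_before xlt vi ik' _ pi) => //; first by lia.
by move: kj; rewrite -xlt; lra.
Qed.

Lemma no_exit_met j : meetRL x v out i j -> i < j -> j <= n ->
  out RightLeft (Initial i) (Initial j) <> Some vleft -> ~ exitL x v out i j.
Proof.
move=> mij ij jn nl /(@exitL_box _ x v out xlt i n j (ltW ij) jn)[_ h].
have [vi vj Oij _ _] := meetRL_parents mij ij jn.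
by apply: nl; have := h _ Oij; rewrite /res /= vi vj.
Qed.

Lemma no_exit_edge b k : blockade x v out b -> lo b <= hi b -> lo b = i ->
  hi b <= n -> i <= k -> k <= hi b -> ~ exitL x v out i k.
Proof.
case: b => [j|s j] /= bb hb ib bn ik kb; rewrite ib in bb hb *.
  by move=> /exitL_left; rewrite (_ : k = i) ?bb //; lia.
have [mij ob] := bb; have [[vi vj _] _] := bb.
have ij : i < j.
  rewrite lt_neqAle hb andbT; apply/eqP => e; move: vj.
  by rewrite -e vi.
case: (eqVneq k j) => [->|kj]; first by apply: no_exit_met => //; rewrite ob.
by apply: no_exit_meet mij ij bn ik _; lia.
Qed.

(** Up to its meeting with i the arrow j has survived; afterwards nothing started in [i, j) is left
    to meet it. *)
Lemma exit_met j : meetRL x v out i j -> i < j -> j <= n ->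
  out RightLeft (Initial i) (Initial j) = Some vleft -> exitL x v out i j.
Proof.
move=> mij ij jn ol; apply/(@exitL_box _ x v out xlt i n j (ltW ij) jn).
have [vi vj Oij pi pj] := meetRL_parents mij ij jn.
split; first by move: vj; rewrite boxed_in //; lia.
move=> q Oq; case: (pselect (q = Initial i)) => [->|nqi].
  by rewrite /res /= vi vj.
have [_ _ [_ al]] := pj.
case: (ltP (meet x v' q (Initial j)) ((x j - x i) / 2)) => mq.
  by have := al _ Oq mq; rewrite /= vj.
exfalso; have [[iq hq qn] _] := occ_within Oq.
have [_ qj pq _] := (dO _ _).1 Oq; rewrite /= in qj.
have TE : (x j - x i) / 2 = meet x v' (Initial i) (Initial j) by rewrite /meet /= vi vj.
have nqj : q <> Initial j by move=> e; move: qj; rewrite e /= ltxx.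
case: (ltP (bir x q) ((x j - x i) / 2)) => bq.
  have pq' := pres_le bq mq pq.
  by have /= := collision_between xlt xgen dO Oij TE pq' nqi nqj; lia.
move: bq; rewrite /bir.
by move: iq qj; rewrite -(xle xlt) -xlt; lra.
Qed.

Lemma exit_annihilated j k : meetRL x v out i j -> i < j -> j < k -> k <= n ->
  out RightLeft (Initial i) (Initial j) <> Some vright ->
  out RightLeft (Initial i) (Initial j) <> Some vzero ->
  exitL x v out i k <-> exitL x v out (j + 1) k.
Proof.
move=> mij ij jk kn nr nz.
have jn : j <= n by lia.
rewrite (@split_exit _ _ _ _ xlt i n j k) //; first last.
- by move=> T p r Opr pj jr; case: (no_crossing_annihilated mij ij jn nr nz Opr pj jr).
- by lia.
split=> [[]|ex] //; split=> // q Oq qj.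
by case: (no_crossing_annihilated mij ij jn nr nz Oq qj jk).
Qed.

Lemma exitR_exitL j : i <= n -> exitR x v out i n -> i <= j -> j <= n ->
  ~ exitL x v out i j.
Proof.
move=> i_n /(@exitR_box _ x v out i n i_n)[vi h] ij jn ex.
have ij' : i < j.
  rewrite lt_neqAle ij andbT; apply/eqP => e; have := exitL_left ex.
  by rewrite -e vi.
have vi' : v' i = vright by rewrite boxed_in.
have uT : (x j - x i) / 2 < (x j - x i) / 2 + 1 by rewrite ltrDl.
apply: (no_exit_before xlt vi ij' jn _ uT ex).
split=> //; first by rewrite /bir /=; move: ij'; rewrite -xlt; lra.
split=> r Or _; first by rewrite h //= vi'.
by have := right_partner dO Or; rewrite /= vi'.
Qed.

(* A right arrow is destroyed at most once. *)
Lemma killer_unique r r' : v i = vright -> O (Initial i) r -> O (Initial i) r' ->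
  res v' out (Initial i) r <> Some vright -> res v' out (Initial i) r' <> Some vright ->
  r = r'.
Proof.
move=> vi Or Or' nr nr'.
have [_ ri pi pr] := (dO _ _).1 Or; have [_ ri' pi' pr'] := (dO _ _).1 Or'.
have vi' : v' i = vright.
  by have [[_ _ /= i_n] _] := occ_within Or; rewrite boxed_in.
have [le|lt|e] := ltgtP (meet x v' (Initial i) r) (meet x v' (Initial i) r').
- by case: pi' => _ _ [al _]; case: nr; rewrite (al _ Or le) /= vi'.
- by case: pi => _ _ [al _]; case: nr'; rewrite (al _ Or' lt) /= vi'.
apply: contrapT => ne; rewrite -e in pr'.
have := collision_between xlt xgen dO Or erefl pr' _ (nesym ne).
have n' : r' <> Initial i by move=> e'; move: ri'; rewrite e' /= ltxx.
move=> /(_ n') /= [h|h].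
  by have [_ h'] := collision_lohi dO Or'; move: ri' => /=; lia.
have n'' : r <> Initial i by move=> e'; move: ri; rewrite e' /= ltxx.
rewrite e in pr.
have /= [h'|h'] := collision_between xlt xgen dO Or' erefl pr n'' ne.
  by have [_ h''] := collision_lohi dO Or; move: ri => /=; lia.
have [_ k1] := collision_lohi dO Or; have [_ k2] := collision_lohi dO Or'.
by lia.
Qed.

End FirstParticle.

(** * Renewal structure of exits and arrivals; the first exit *)

Section FirstExit.
Variables (R : realType) (x : int -> R) (v : int -> velocity).
Variable out : reaction -> particle -> particle -> outcome.

Definition firstL (i k : int) : Prop :=
  exitL x v out i k /\ forall m, i <= m -> m < k -> ~ exitL x v out i m.

(* The right arrow i reaches the blockade b before, resp. after, the left
   arrow k. *)
Definition sooner (i : int) (b : particle) (k : int) : Prop :=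
  x (lo b) - x i < x k - x (hi b).
Definition later (i : int) (b : particle) (k : int) : Prop :=
  x k - x (hi b) < x (lo b) - x i.

Hypothesis xlt : forall i j, (x i < x j) = (i < j).
Hypothesis xgen : generic x.

Notation exitL := (exitL x v out).
Notation reachL := (reachL x v out).
Notation hits := (hits x v out).

Lemma soonerE i b k : sooner i b k <-> mid x b - x i < x k - mid x b.
Proof. by rewrite /sooner /mid; split; lra. Qed.

Lemma laterE i b k : later i b k <-> x k - mid x b < mid x b - x i.
Proof. by rewrite /later /mid; split; lra. Qed.

Lemma not_later i b k : i < lo b -> lo b <= hi b -> hi b < k ->
  ~ later i b k <-> sooner i b k.
Proof.
move=> ib hb bk; have := xgen ib hb bk; rewrite /later /sooner => ne.
split; first by move/negP; rewrite -leNgt le_eqVlt => /orP[/eqP e|//]; exfalso; apply: ne; lra.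
by move=> h h'; have := lt_trans h h'; rewrite ltxx.
Qed.

Lemma exit_chain i m k : i <= m -> m < k -> exitL i m ->
  exitL i k <-> exitL (m + 1) k.
Proof. by move=> im mk; apply: (@exit_after_exit _ _ _ _ xlt xgen i k m k). Qed.

Lemma last_exit i k : (exists2 m, i <= m < k & exitL i m) ->
  exists m, [/\ i <= m, m < k, exitL i m & forall l, m < l -> l < k -> ~ exitL i l].
Proof.
move=> [m]; have [d] := ubnP (absz (k - m)); elim: d m => // d IH m md /andP[im mk] em.
case: (pselect (exists2 l, m < l < k & exitL i l)) => [[l /andP[ml lk] el]|ne].
  by apply: (IH l) => //; [lia|rewrite lk andbT; lia].
exists m; split=> // l ml lk el; apply: ne; exists l => //; by rewrite ml lk.
Qed.

Lemma first_exit i k : (exists2 m, i <= m < k & exitL i m) ->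
  exists m, [/\ i <= m, m < k & firstL i m].
Proof.
move=> [m]; have [d] := ubnP (absz (m - i)); elim: d m => // d IH m md /andP[im mk] em.
case: (pselect (exists2 l, i <= l < m & exitL i l)) => [[l /andP[il lm] el]|ne].
  by apply: (IH l) => //; [lia|rewrite il; lia].
exists m; split=> //; split=> // l il lm el; apply: ne; exists l => //; by rewrite il lm.
Qed.

Lemma firstL_unique i k k' : firstL i k -> firstL i k' -> k = k'.
Proof.
move=> [e1 h1] [e2 h2]; have [i1 _ _] := e1; have [i2 _ _] := e2.
by case: (ltgtP k k') => // kk; [case: (h2 _ i1 kk)|case: (h1 _ i2 kk)].
Qed.

Lemma firstL_le i k : firstL i k -> i <= k. Proof. by case=> -[]. Qed.

Lemma exitL_renewal i k : exitL i k <->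
  firstL i k \/ exists m, [/\ i <= m, m < k, firstL i m & exitL (m + 1) k].
Proof.
split.
  move=> ek; case: (pselect (exists2 m, i <= m < k & exitL i m)) => [h|ne].
    have [m [im mk fm]] := first_exit h; right; exists m; split=> //.
    by apply/(exit_chain im mk (proj1 fm)).
  by left; split=> // m im mk em; apply: ne; exists m => //; rewrite im mk.
by case=> [[]//|[m [im mk [em _] ek]]]; apply/(exit_chain im mk em).
Qed.

Lemma firstL_after i m k : i <= m -> m < k -> exitL i m ->
  (forall l, m < l -> l < k -> ~ exitL i l) -> exitL i k -> firstL (m + 1) k.
Proof.
move=> im mk em nl ek; split; first by apply/(exit_chain im mk em).
move=> l ml lk el; apply: (nl l) => //; first by lia.
by apply/(exit_chain im _ em) => //; lia.
Qed.

(** Successive arrivals at b are first exits from the boxes that begin after the previous arrival.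
    Naming the last arrival m before k is enough, since reaching b already records the outcomes
    before m. *)
Lemma reachL_renewal b k : reachL b k <-> firstL (hi b + 1) k \/
  exists m, [/\ hi b < m, m < k, reachL b m,
     out BlockLeft b (Initial m) = Some vzero & firstL (m + 1) k].
Proof.
split.
  move=> [ek zk]; case: (pselect (exists2 m, hi b + 1 <= m < k & exitL (hi b + 1) m)).
    move=> /last_exit [m [bm mk em nl]]; right; exists m; have bm' : hi b < m by lia.
    split=> //; last exact: firstL_after nl ek.
      by split=> // l bl lm; apply: zk => //; lia.
    exact: zk.
  move=> ne; left; split=> // m im mk em; apply: ne; exists m => //; by rewrite im mk.
case=> [[ek nk]|[m [bm mk [em zm] om [ek nk]]]].
  by split=> // m bm mk em; case: (nk m _ mk em); lia.
have bm' : hi b + 1 <= m by lia.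
split; first by apply/(exit_chain bm' mk em).
move=> l bl lk el; case: (ltgtP l m) => [lm|ml|-> //]; first exact: zm.
case: (nk l) => //; first by lia.
by apply/(exit_chain bm' ml em).
Qed.

(* The arrow preceding k in the exits on the right of b is unique. *)
Lemma predecessor_unique b m m' k : hi b < m -> m < k -> hi b < m' -> m' < k ->
  reachL b m -> reachL b m' -> firstL (m + 1) k -> firstL (m' + 1) k -> m = m'.
Proof.
have aux m1 m2 : hi b < m1 -> m1 < m2 -> m2 < k -> reachL b m1 -> reachL b m2 ->
    firstL (m1 + 1) k -> False.
  move=> bm mm mk [e1 _] [e2 _] [_ nk]; apply: (nk m2) => //; first by lia.
  have bm' : hi b + 1 <= m1 by lia.
  by apply/(exit_chain bm' mm e1).
move=> bm mk bm' mk' r1 r2 f1 f2.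
by case: (ltgtP m m') => // mm; [case: (aux m m')|case: (aux m' m)].
Qed.

Lemma killer_unique_right b k k' : hi b < k -> hi b < k' ->
  reachL b k -> reachL b k' ->
  out BlockLeft b (Initial k) <> Some vzero -> out BlockLeft b (Initial k') <> Some vzero ->
  k = k'.
Proof.
move=> bk bk' [e1 z1] [e2 z2] n1 n2.
by case: (ltgtP k k') => // kk; [case: n1; apply: z2|case: n2; apply: z1].
Qed.

Lemma firstL_left i n : i <= n -> v i = vleft -> firstL i n <-> n = i.
Proof.
move=> i_n vi.
have ei : exitL i i.
  split=> // q Oq; have [[q1 q2 q3] _] := occ_within Oq.
  by have /= := occ_order Oq; lia.
split=> [[en nn]|->].
  by apply/eqP; rewrite eq_le i_n andbT leNgt; apply/negP => lt; apply: (nn i).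
by split=> // m im mi; lia.
Qed.

Lemma firstL_cleared i t n : i <= t ->
  (forall k, t < k -> k <= n -> exitL i k <-> exitL (t + 1) k) ->
  (forall k, i <= k -> k <= t -> k <= n -> ~ exitL i k) ->
  firstL i n <-> t < n /\ firstL (t + 1) n.
Proof.
move=> it E N; split.
  move=> [en nn]; have i_n : i <= n by case: en.
  have tn : t < n by rewrite ltNge; apply/negP => nt; apply: (N n).
  split=> //; split; first exact/E.
  by move=> m tm mn em; apply: (nn m) => //; [lia|apply/E => //; lia].
move=> [tn [en nn]]; split; first exact/E.
move=> m im mn em; case: (leP m t) => mt; first by apply: (N m) => //; exact: ltW.
by apply: (nn m) => //; [lia|apply/(E m mt (ltW mn))].
Qed.

(** The first arrow k that does not leave b standing decides. Either it survives and is itself the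
    first to leave, or the way is then free and the first to leave is the first exit after k. *)
Lemma firstL_blocked i b n : i <= hi b ->
  (forall k, hi b < k -> k <= n -> exitL i k <-> exitL (hi b + 1) k /\
     (reachL b k -> out BlockLeft b (Initial k) = Some vleft)) ->
  (forall k, i <= k -> k <= hi b -> k <= n -> ~ exitL i k) ->
  firstL i n <-> exists k, [/\ hi b < k, k <= n, reachL b k &
    out BlockLeft b (Initial k) = Some vleft /\ k = n \/
    [/\ out BlockLeft b (Initial k) <> Some vleft,
        out BlockLeft b (Initial k) <> Some vzero, k < n & firstL (k + 1) n]].
Proof.
move=> ib E N.
(* before the destruction of b nothing leaves, afterwards everything does *)
have before k m : reachL b k -> hi b < m -> m < k -> k <= n -> ~ exitL i m.
  move=> [ek zk] bm mk kn /E[//||em h]; first by lia.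
  have rm : reachL b m by split=> // l bl lm; apply: zk => //; lia.
  by have := h rm; rewrite zk.
have after k m : reachL b k -> out BlockLeft b (Initial k) <> Some vzero ->
    hi b < k -> k < m -> m <= n -> exitL i m <-> exitL (k + 1) m.
  move=> rk nz bk km mn; have [ek zk] := rk.
  have bk' : hi b + 1 <= k by lia.
  rewrite E //; last by lia.
  rewrite (exit_chain bk' km ek); split=> [[]|em] //; split=> // -[_ zm].
  by case: nz; apply: zm.
have killer m : exitL i m -> hi b < m -> m <= n ->
    exists k, [/\ hi b < k, k <= m, reachL b k & out BlockLeft b (Initial k) <> Some vzero].
  move=> /[swap] bm /[swap] mn /E[//|//|em h].
  case: (pselect (reachL b m)) => [rm|nrm].
    by exists m; split=> //; rewrite h.
  have : exists2 l, hi b < l < m & exitL (hi b + 1) l /\ out BlockLeft b (Initial l) <> Some vzero.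
    apply: contrapT => ne; apply: nrm; split=> // l bl lm el; apply: contrapT => nl.
    by apply: ne; exists l => //; rewrite bl lm.
  move=> [l]; have [d] := ubnP (absz (l - hi b)); elim: d l => // d IH l ld /andP[bl lm] [el nl].
  case: (pselect (reachL b l)) => [rl|nrl].
    by exists l; split=> //; exact: ltW.
  have : exists2 l', hi b < l' < l & exitL (hi b + 1) l' /\ out BlockLeft b (Initial l') <> Some vzero.
    apply: contrapT => ne; apply: nrl; split=> // l' bl' lm' el'; apply: contrapT => nl'.
    by apply: ne; exists l' => //; rewrite bl' lm'.
  move=> [l' /andP[bl' ll'] h']; apply: (IH l') => //; first by lia.
  by rewrite bl'; lia.
split.
  move=> [en nn]; have i_n : i <= n by case: en.
  have bn : hi b < n by rewrite ltNge; apply/negP => nt; apply: (N n).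
  have [k [bk kn rk nz]] := killer _ en bn (lexx _).
  exists k; split=> //.
  case: (pselect (out BlockLeft b (Initial k) = Some vleft)) => [ol|nol].
    left; split=> //; apply/eqP; rewrite eq_le kn leNgt; apply/negP => lt.
    apply: (nn k) => //; first by lia.
    by apply/E => //; split=> //; case: rk.
  right; have kn' : k < n.
    rewrite lt_neqAle kn andbT; apply/eqP => e; rewrite e in rk nol.
    by have [_ h] := (E n bn (lexx _)).1 en; case: nol; apply: h.
  split=> //; split; first exact/(after k n rk nz bk kn').
  move=> m km mn em; apply: (nn m) => //; first by lia.
  have km' : k < m by lia.
  by apply/(after k m rk nz bk km' (ltW mn)).
move=> [k [bk kn rk]] [[ol kE]|[nol nz kn' [en nn]]].
  rewrite -kE; split; first by apply/E => //; split=> //; case: rk.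
  move=> m im mk em; case: (leP m (hi b)) => mb.
    by apply: (N m) => //; lia.
  exact: (before k m).
split; first exact/(after k n rk nz bk kn').
move=> m im mn em; case: (leP m (hi b)) => mb; first by apply: (N m) => //; exact: ltW.
case: (ltgtP m k) => mk.
- exact: (before k m).
- by apply: (nn m) => //; [lia|apply/(after k m rk nz bk mk (ltW mn))].
- by have [_ h] := (E m mb (ltW mn)).1 em; apply: nol; rewrite -mk; apply: h; rewrite mk.
Qed.

(** The first to leave is the first arrow arriving after i: it arrives after i and its predecessor
    does not. The outcome at b of a predecessor arriving after i is fictitious, as b is gone by
    then; it is included so that both parts are expressed by [reachL] and can be subtracted in
    [first_of_hit_cleared]. *)
Lemma firstL_hit_cleared i b n : hits i n b -> lo b <= hi b -> i < lo b -> hi b <= n ->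
  out RightBlock (Initial i) b <> Some vzero -> out RightBlock (Initial i) b <> Some vright ->
  firstL i n <-> [/\ hi b < n, reachL b n, sooner i b n &
    ~ exists k, [/\ hi b < k, k < n, reachL b k &
        [/\ sooner i b k, out BlockLeft b (Initial k) = Some vzero & firstL (k + 1) n]]].
Proof.
move=> hit hb ib bn oz or.
have E k : hi b < k -> k <= n -> exitL i k <-> exitL (hi b + 1) k /\ sooner i b k.
  move=> bk kn; rewrite soonerE.
  apply: (@exit_hit_cleared _ _ _ _ xlt xgen i n b k) => //.
have N k : i <= k -> k <= hi b -> ~ exitL i k.
  by move=> ik kb; apply: (@no_exit_hit _ _ _ _ xlt xgen i n b k).
have sm k m : k <= m -> sooner i b k -> sooner i b m.
  by rewrite /sooner -(xle xlt); lra.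
have [_ _ _ lb] := hit.
have rl m : hi b < m -> m <= n -> exitL (hi b + 1) m ->
    (forall l, hi b < l -> l < m -> exitL (hi b + 1) l -> ~ sooner i b l) -> reachL b m.
  have [d] := ubnP (absz (m - hi b)); elim: d m => // d IH m md bm mn em h.
  split=> // l bl lm el; apply: lb; first by lia.
    apply: IH => //; [lia|lia|] => l' bl' ll' el'; apply: h => //; lia.
  apply/laterE; apply: contrapT => /(not_later ib hb bl); exact: h.
split.
  move=> [en nn]; have i_n : i <= n by case: en.
  have bn' : hi b < n by rewrite ltNge; apply/negP => nt; apply: (N n).
  have [en' sn] := (E n bn' (lexx _)).1 en; split=> //.
    apply: rl => // l bl ln el sl; apply: (nn l) => //; first by lia.
    by apply/E => //; exact: ltW.
  move=> [k [bk kn [ek _] [sk _ _]]]; apply: (nn k) => //; first by lia.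
  by apply/E => //; exact: ltW.
move=> [bn' [en zn] sn nk]; split; first exact/E.
move=> m im mn em; case: (leP m (hi b)) => mb; first exact: (N m).
have [em' sm'] := (E m mb (ltW mn)).1 em; apply: nk.
have : exists2 m, hi b + 1 <= m < n & exitL (hi b + 1) m.
  by exists m => //; rewrite mn andbT; lia.
move=> /last_exit [k [bk kn ek nl]]; exists k.
have mk : m <= k by rewrite leNgt; apply/negP => km; apply: (nl m).
have bk' : hi b < k by lia.
split=> //; first by split=> // l bl lk; apply: zn => //; lia.
split; [exact: sm sm'|exact: zn|exact: firstL_after nl en].
Qed.

End FirstExit.

(** * From histories to the collision relation, and the survival of a blockade *)

Section Histories.
Variables (R : realType) (x : int -> R) (v : int -> velocity).
Variable out : reaction -> particle -> particle -> outcome.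
Variable h : history R.
Hypothesis xlt : forall i j, (x i < x j) = (i < j).
Hypothesis hr : follows_rules x v out h.

Definition hist_collision q r : Prop := exists c t, collide x v h c q r t.
Notation O := hist_collision.

Lemma locationE q t : location x v q t = loc x v q t.
Proof.
rewrite /location /loc; congr (_ + _ * (_ - _)); case: q => //= k.
- by rewrite /mid /=; field.
- by rewrite /bir /= subrr mul0r.
Qed.

Lemma birth_timeE q : birth_time x q = bir x q.
Proof. by case: q => //= k; rewrite /bir /= subrr mul0r. Qed.

Lemma collide_time c q r t : collide x v h c q r t -> t = meet x v q r.
Proof.
move=> [rx _ _]; rewrite !locationE => e.
have rx' : reaction_of (velocity_of v q) (velocity_of v r) <> None by rewrite rx.
have [h1 h2] := loc_meet x t rx'; apply/eqP; rewrite eq_le -h2 e lexx /=.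
by rewrite leNgt -h1 e ltxx.
Qed.

Lemma hist_exist q : born h q <-> exist v out O q.
Proof.
have [h1 h2 _] := hr; case: q => [k|i j] /=; first by split.
rewrite (propext (h2 i j)); split=> [[[t ct] oz]|[vi vj [c [t ct]] oz]]; split=> //.
- by have [rx _ _ _] := ct; move: rx => /=; case: (v i); case: (v j).
- by have [rx _ _ _] := ct; move: rx => /=; case: (v i); case: (v j).
- by exists RightLeft, t.
by have [rx _ _ _] := ct; move: rx; rewrite /= vi vj => -[e]; exists t; rewrite e.
Qed.

Lemma hist_res c q r t : collide x v h c q r t -> res v out q r = out c q r.
Proof. by case=> rx _ _ _; rewrite /res rx. Qed.

Lemma destroyedE q s : destroyed h q s <->
  (exists r, [/\ O q r, meet x v q r = s & res v out q r <> Some (velocity_of v q)]) \/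
  (exists r, [/\ O r q, meet x v r q = s & res v out r q <> Some (velocity_of v q)]).
Proof.
have [_ _ h3] := hr; rewrite (propext (h3 q s)); split.
  by move=> [c [r [[ct o]|[ct o]]]]; [left|right]; exists r; rewrite (hist_res ct) (collide_time ct);
    split=> //; exists c, s.
move=> [[r [[c [t ct]] e o]]|[r [[c [t ct]] e o]]]; exists c, r; [left|right];
  by move: o; rewrite (hist_res ct) -e -(collide_time ct).
Qed.

Lemma hist_pres q t : present_until x h q t <-> pres x v out O q t.
Proof.
rewrite /present_until /pres birth_timeE; split=> [[bq bt dq]|[eq bt [a1 a2]]]; split=> //.
- exact/hist_exist.
- split=> r Or mt; apply: contrapT => nr; move: mt; rewrite ltNge; apply/negP; rewrite negbK;
    apply: dq; apply/destroyedE; [left|right]; by exists r.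
- exact/hist_exist.
move=> s /destroyedE[[r [Or <- nr]]|[r [Or <- nr]]]; rewrite leNgt; apply/negP => mt.
- by apply: nr; exact: a1.
- by apply: nr; exact: a2.
Qed.

(** Brings the rules of a history, where collision times are unknowns, under [dynamics], where the
    time of a pair is explicit. All deterministic results then apply to the given process. *)
Lemma hist_dynamics : dynamics x v out O.
Proof.
move=> q r; split; last first.
  move=> [rx _ pq pr]; case e: (reaction_of _ _) rx => [c|] // _.
  exists c, (meet x v q r); split=> //; try exact/hist_pres.
  by rewrite !locationE; apply: loc_meetE; rewrite e.
move=> [c [t ct]]; have et := collide_time ct.
have [rx pq pr _] := ct; rewrite et in pq pr.
have rx' : reaction_of (velocity_of v q) (velocity_of v r) <> None by rewrite rx.
have wf p : born h p -> lo p <= hi p.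
  case: p => [k|i j] //= /hist_exist[vi vj [c' [s cs]] _]; have es := collide_time cs.
  have [_ [_ + _] _ _] := cs; rewrite es /= /meet /= vi vj => pos.
  by apply: ltW; rewrite -xlt; lra.
have /hist_pres pq' := pq; have /hist_pres pr' := pr; split=> //.
have [bq tq _] := pq'; have [br tr _] := pr'.
(* That q starts on the left of r follows from both being born before they meet. *)
rewrite -xlt; move: tq tr; rewrite /bir /meet.
case: (rxP rx') => -> -> => [e1 e2|e1|e2] /=; rewrite /mid -?e1 -?e2; lra.
Qed.

End Histories.

Section Survival.
Variables (R : realType) (x : int -> R) (v : int -> velocity).
Variable out : reaction -> particle -> particle -> outcome.
Variable h : history R.
Hypothesis xlt : forall i j, (x i < x j) = (i < j).
Hypothesis xgen : generic x.
Hypothesis hr : follows_rules x v out h.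
Variable j : int.
Hypothesis vj : v j = vzero.
Notation O := (hist_collision x v h).
Notation b := (Initial j).
Let dO : dynamics x v out O := hist_dynamics xlt hr.

(** If no right arrow arriving before k can remove b, then k collides with b and removes it.
    Otherwise such a right arrow does, because the left arrows that are faster still come before k
    and leave b standing. *)
Lemma blockade_destroyed k : reachL x v out b k ->
  out BlockLeft b (Initial k) <> Some vzero -> exists t, destroyed h b t.
Proof.
move=> rk nz; have [ek hk] := rk.
have jk : hi b < k by case: ek => /=; lia.
have vk : v k = vleft by exact: exitL_left ek.
have dest r : (O b r /\ res v out b r <> Some vzero) \/ (O r b /\ res v out r b <> Some vzero) ->
    exists t, destroyed h b t.
  case=> -[Or nr]; [exists (meet x v b r)|exists (meet x v r b)];
    apply/(destroyedE hr); [left|right]; by exists r; rewrite /= vj.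
case: (pselect (forall i, reachR x v out i b -> mid x b - x i < x k - mid x b ->
    out RightBlock (Initial i) b = Some vzero)) => [hi_|].
  have /(collision_left_arrow xlt xgen dO (b := b) (lexx j) jk)[Ok _] :
      [/\ v k = vleft, blockade x v out b, reachL x v out b k
       & forall i, reachR x v out i b -> mid x b - x i < x k - mid x b ->
         out RightBlock (Initial i) b = Some vzero] by [].
  by apply: (dest (Initial k)); left; split=> //; rewrite /res /= vj vk.
move=> /existsNP[i /not_implyP[ri /not_implyP[ik ni]]].
have vi : v i = vright by case: ri => -[].
have ij : i < lo b by case: ri => -[] /=; lia.
have /(collision_right_arrow xlt xgen dO (b := b) (lexx j) ij)[Oi _] :
    [/\ v i = vright, blockade x v out b, reachR x v out i b
     & forall l, reachL x v out b l -> x l - mid x b < mid x b - x i ->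
       out BlockLeft b (Initial l) = Some vzero].
  split=> // l [el _] li; apply: hk => //; first by case: el => /=; lia.
  by rewrite -xlt; lra.
by apply: (dest (Initial i)); right; split=> //; rewrite /res /= vj vi.
Qed.

Lemma blockade_survives : (forall k, ~ exitL x v out (j + 1) k) ->
  (forall i, ~ exitR x v out i (j - 1)) -> ~ exists t, destroyed h b t.
Proof.
move=> nl nr [t /(destroyedE hr)[[r [Or _ _]]|[r [Or _ _]]]].
  have [rx _ _ _] := (dO _ _).1 Or.
  have er : r = Initial (lo r).
    by apply: (@arrowE v); move: rx; rewrite /= vj; case: (velocity_of v r).
  rewrite er in Or; have [e _] := collision_reachL xlt xgen dO Or vj.
  exact: (nl _ e).
have [rx _ _ _] := (dO _ _).1 Or.
have er : r = Initial (lo r).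
  by apply: (@arrowE v); move: rx; rewrite /= vj; case: (velocity_of v r).
rewrite er in Or; have [e _] := collision_reachR xlt xgen dO Or vj.
exact: (nr _ e).
Qed.

End Survival.

(** * The canonical probability space: independence and symmetry *)

Section Canonical.
Variable R : realType.

(** All randomness as a point of a product of real lines, one coordinate per source; velocities and
    outcomes enter through numerical codes. *)
Definition sources := source -> R.
HB.instance Definition _ := gen_eqMixin sources.
HB.instance Definition _ := gen_choiceMixin sources.
HB.instance Definition _ := isPointed.Build sources (fun _ => 0).

Definition cylinder (J : seq source) (E : source -> set R) : set sources :=
  [set d | forall s, s \in J -> E s (d s)].

Definition cylinders : set (set sources) :=
  [set A | exists J E, (forall s, measurable (E s : set (measurableTypeR R))) /\
     A = cylinder J E].

Definition Omega : measurableType _ := g_sigma_algebraType cylinders.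

Lemma cylinders_setI : setI_closed cylinders.
Proof.
move=> _ _ [J [E [mE ->]]] [K [F [mF ->]]].
exists (J ++ K), (fun s => (if s \in J then E s else setT) `&` (if s \in K then F s else setT)).
split; first by move=> s; apply: measurableI; case: ifP.
apply/seteqP; split=> d.
  move=> [h1 h2] s _; split; case: ifP => // sJ; [exact: h1|exact: h2].
move=> h; split=> s sJ.
  by have [+ _] := h s ltac:(by rewrite mem_cat sJ); rewrite sJ.
by have [_ +] := h s ltac:(by rewrite mem_cat sJ orbT); rewrite sJ.
Qed.

Lemma measurable_cylinder J E : (forall s, measurable (E s : set (measurableTypeR R))) ->
  measurable (cylinder J E : set Omega).
Proof. by move=> mE; apply: sub_sigma_algebra; exists J, E. Qed.

Lemma measurable_coord s :
  measurable_fun [set: Omega] (fun d : Omega => d s : measurableTypeR R).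
Proof.
move=> _ B mB; rewrite setTI.
rewrite (_ : _ @^-1` B = cylinder [:: s] (fun _ => B)); first exact: measurable_cylinder.
apply/seteqP; split=> d /=; first by move=> h t; rewrite inE => /eqP ->.
by move=> /(_ s); apply; rewrite inE.
Qed.

Lemma measurable_to_Omega d (T : measurableType d) (f : T -> Omega) :
  (forall s, measurable_fun [set: T] (fun w => f w s : measurableTypeR R)) ->
  measurable_fun [set: T] f.
Proof.
move=> mf; apply: (@measurability _ _ T Omega setT f cylinders) => // _ [_ [J [E [mE ->]]] <-].
rewrite setTI (_ : _ @^-1` _ = \bigcap_(s in [set` J]) ((fun w => f w s) @^-1` E s)) //.
apply: fin_bigcap_measurable => // s _; rewrite -[X in measurable X]setTI.
exact: mf.
Qed.

Definition depends (S : set source) (A : set Omega) : Prop :=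
  forall d d' : Omega, (forall s, S s -> d s = d' s) -> A d -> A d'.

Variable Q : probability Omega R.
Hypothesis Qind : forall J E, uniq J ->
  (forall s, measurable (E s : set (measurableTypeR R))) ->
  Q (cylinder J E) = (\prod_(s <- J) Q [set d : Omega | E s (d s)])%E.

Lemma canonical_unique (m : {measure set Omega -> \bar R}) :
  (forall J E, uniq J -> (forall s, measurable (E s : set (measurableTypeR R))) ->
    m (cylinder J E) = Q (cylinder J E)) ->
  forall A, measurable A -> m A = Q A.
Proof.
move=> mQ A mA; apply: (@measure_unique _ _ Omega cylinders (fun _ => setT)) => //.
- exact: cylinders_setI.
- by move=> _; exists [::], (fun _ => setT); split=> //; apply/seteqP; split.
- by apply/seteqP; split=> // d _; exists 0%N.
- move=> _ [J [E [mE ->]]].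
  have -> : cylinder J E = cylinder (undup J) E.
    by apply/seteqP; split=> d h s; [rewrite mem_undup|rewrite -mem_undup]; apply: h.
  by apply: mQ => //; exact: undup_uniq.
move=> _; have -> : [set: Omega] = cylinder [::] (fun _ => setT).
  by apply/seteqP; split.
by rewrite mQ // -ge0_fin_numE //; exact: fin_num_measure (measurable_cylinder _ _).
Qed.

Section Independence.
Variable S : set source.

(** Coordinates in S come from the first sample, the others from the second. Two independent samples
    give again the law Q ([mix_law]); hence events with disjoint supports are independent, and
    Fubini applies to S and its complement. *)
Definition mix (dd : Omega * Omega) : Omega :=
  fun s => if `[< S s >] then dd.1 s else dd.2 s.

Lemma measurable_mix : measurable_fun [set: Omega * Omega] mix.
Proof.
apply: measurable_to_Omega => s; rewrite /mix; case: `[< S s >].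
  exact: (measurableT_comp (measurable_coord s) measurable_fst).
exact: (measurableT_comp (measurable_coord s) measurable_snd).
Qed.

HB.instance Definition _ := isMeasurableFun.Build _ _ _ _ mix measurable_mix.

Lemma mix_cylinder J E : mix @^-1` cylinder J E =
  cylinder [seq s <- J | `[< S s >]] E `*` cylinder [seq s <- J | ~~ `[< S s >]] E.
Proof.
apply/seteqP; split=> -[d d'] /=.
  by move=> h; split=> s; rewrite mem_filter => /andP[Ss sJ]; have := h s sJ;
     rewrite /mix /=; move: Ss; case: `[< S s >].
move=> [h1 h2] s sJ; rewrite /mix /=; case: ifP => Ss.
  by apply: h1; rewrite mem_filter Ss.
by apply: h2; rewrite mem_filter Ss.
Qed.

Lemma mix_law A : measurable A -> pushforward (Q \x Q)%E mix A = Q A.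
Proof.
have := @canonical_unique (pushforward (Q \x Q)%E mix).
move/(_ measurable_mix); apply=> J E uJ mE.
rewrite [LHS](congr1 (Q \x Q)%E (mix_cylinder J E)).
rewrite [LHS](_ : _ = (Q (cylinder [seq s <- J | `[< S s >]] E) *
    Q (cylinder [seq s <- J | ~~ `[< S s >]] E))%E); last first.
  by apply: product_measure1E; exact: measurable_cylinder.
rewrite (Qind (filter_uniq _ uJ) mE) (Qind (filter_uniq _ uJ) mE) (Qind uJ mE).
by rewrite !big_filter [in RHS](bigID (fun s => `[< S s >])).
Qed.

Lemma independent A B : measurable A -> measurable B ->
  depends S A -> depends (~` S) B -> Q (A `&` B) = (Q A * Q B)%E.
Proof.
move=> mA mB dA dB; rewrite -mix_law; last exact: measurableI.
rewrite /pushforward (_ : mix @^-1` (A `&` B) = A `*` B) ?product_measure1E //.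
have mS d d' s : S s -> mix (d, d') s = d s.
  by move=> Ss; rewrite /mix; case: asboolP.
have mS' d d' s : (~` S) s -> mix (d, d') s = d' s.
  by move=> Ss; rewrite /mix; case: asboolP.
apply/seteqP; split=> -[d d'] /= [h1 h2]; split.
- by apply: dA h1 => s; exact: mS.
- by apply: dB h2 => s; exact: mS'.
- by apply: dA h1 => s /mS ->.
- by apply: dB h2 => s /mS' ->.
Qed.

Lemma null_sections A : measurable A ->
  (forall d, Q [set d' | A (mix (d, d'))] = 0%E) -> Q A = 0%E.
Proof.
move=> mA h; rewrite -mix_law // /pushforward /= /product_measure1.
apply: integral0_eq => d _ /=; rewrite -[RHS](h d); congr (Q _).
by apply/seteqP; split=> d'; rewrite /xsection /= inE.
Qed.

End Independence.

Section Symmetry.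
Variables (sg : source -> R -> R) (sw : source -> source).
Hypothesis swK : involutive sw.
Hypothesis sgK : forall s, sg (sw s) = sg s.
Hypothesis msg : forall s,
  measurable_fun [set: measurableTypeR R] (sg s : measurableTypeR R -> measurableTypeR R).
Hypothesis Qsym : forall s (E : set R), measurable (E : set (measurableTypeR R)) ->
  Q [set d : Omega | E (sg s (d (sw s)))] = Q [set d : Omega | E (d s)].

(** Permutes the sources by the involution [sw] and acts on their values by [sg]; reflections of the
    system have this form. *)
Definition transform (d : Omega) : Omega := fun s => sg s (d (sw s)).

Lemma measurable_transform : measurable_fun [set: Omega] transform.
Proof.
apply: measurable_to_Omega => s; rewrite /transform.
exact: (measurableT_comp (msg s) (measurable_coord (sw s))).
Qed.

HB.instance Definition _ := isMeasurableFun.Build _ _ _ _ transform measurable_transform.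

Lemma transform_invariant A : measurable A -> Q (transform @^-1` A) = Q A.
Proof.
move=> mA; rewrite -[LHS]/(pushforward Q transform A).
have := @canonical_unique (pushforward Q transform).
move/(_ measurable_transform); apply=> // J E uJ mE.
pose F s : set R := [set r | E (sw s) (sg s r)].
have mF s : measurable (F s : set (measurableTypeR R)).
  by rewrite -[F s]setTI; apply: (msg s) => //; exact: mE.
have e : transform @^-1` cylinder J E = cylinder (map sw J) F.
  apply/seteqP; split=> d h s.
    by move=> /mapP[t tJ ->]; have := h t tJ; rewrite /F /= /transform swK sgK.
  by move=> sJ; have := h (sw s) (map_f _ sJ); rewrite /F /= swK sgK.
rewrite [LHS](congr1 Q e) !Qind ?map_inj_uniq //; last exact: inv_inj.
rewrite big_map; apply: eq_bigr => s _; rewrite /F /= swK sgK; exact: Qsym.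
Qed.

End Symmetry.
End Canonical.

(** * Decoding the sources; measurability of the events *)

Definition particle_code (q : particle) : int + int * int :=
  match q with Initial k => inl k | Generated i j => inr (i, j) end.
Definition particle_decode (c : int + int * int) : particle :=
  match c with inl k => Initial k | inr (i, j) => Generated i j end.
Lemma particle_codeK : cancel particle_code particle_decode.
Proof. by case. Qed.
HB.instance Definition _ := Countable.copy particle (can_type particle_codeK).

Section Decode.
Variable R : realType.
Notation Omega := (Omega R).

Definition vdec (r : R) : velocity :=
  if r == -1 then vleft else if r == 1 then vright else vzero.
Definition vcode (w : velocity) : R := speed R w.
Definition odec (r : R) : outcome :=
  if r == -1 then Some vleft else if r == 1 then Some vright
  else if r == 0 then Some vzero else None.
Definition ocode (o : outcome) : R := if o is Some w then speed R w else 2.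

Lemma code_neq : [/\ (0 == -1 :> R) = false, (0 == 1 :> R) = false,
  (1 == -1 :> R) = false, (2 == -1 :> R) = false & (2 == 1 :> R) = false /\ (2 == 0 :> R) = false].
Proof. by split; [| | | |split]; apply/eqP => h; lra. Qed.

Lemma vcodeK : cancel vcode vdec.
Proof.
by have [e1 e2 e3 _ _] := code_neq; case; rewrite /vcode /vdec /= ?eqxx ?e1 ?e2 ?e3.
Qed.

Lemma ocodeK : cancel ocode odec.
Proof.
have [e1 e2 e3 e4 [e5 e6]] := code_neq.
by case=> [[]|]; rewrite /ocode /odec /= ?eqxx ?e1 ?e2 ?e3 ?e4 ?e5 ?e6.
Qed.

Lemma vdecN r : vdec (- r) = vflip (vdec r).
Proof.
have [e1 e2 e3 _ _] := code_neq.
rewrite /vdec eqr_oppLR opprK eqr_oppLR; case: (eqVneq r 1) => [->|r1].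
  by rewrite e3.
by case: ifP.
Qed.

Lemma odecN r : odec (- r) = oflip (odec r).
Proof.
have [e1 e2 e3 _ _] := code_neq.
rewrite /odec eqr_oppLR opprK eqr_oppLR oppr_eq0; case: (eqVneq r 1) => [->|r1].
  by rewrite e3.
by case: ifP => //; case: ifP.
Qed.

(* The reflection of outcome codes: it exchanges 1 and -1, and fixes 0 and the code 2 of [None]. *)
Definition oneg (r : R) : R := if r == 2 then r else - r.

Lemma odec_oneg r : odec (oneg r) = oflip (odec r).
Proof.
rewrite /oneg; case: (eqVneq r 2) => [->|_]; last exact: odecN.
by have [_ _ _ e4 [e5 e6]] := code_neq; rewrite /odec e4 e5 e6.
Qed.

Lemma measurable_oneg :
  measurable_fun [set: measurableTypeR R] (oneg : measurableTypeR R -> measurableTypeR R).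
Proof.
apply: measurable_fun_ifT; last exact: oppr_measurable.
  by apply: measurable_fun_eqr; [exact: measurable_id|exact: measurable_cst].
exact: measurable_id.
Qed.

(** Normalised by x 0 = 0. [Spacing k] is the gap between k - 1 and k, hence the indices 1, 2, ...
    upwards and 0, -1, ... downwards. *)
Definition xpos (d : Omega) (k : int) : R :=
  match k with
  | Posz n => \sum_(j < n) d (Spacing j.+1%:Z)
  | Negz n => - \sum_(j < n.+1) d (Spacing (- j%:Z))
  end.
Definition velo (d : Omega) (k : int) : velocity := vdec (d (Velocity k)).
Definition outs (d : Omega) (c : reaction) (q r : particle) : outcome :=
  odec (d (Outcome c q r)).

Lemma xpos_step d k : xpos d k = xpos d (k - 1) + d (Spacing k).
Proof.
case: k => [[|n]|n].
- rewrite (_ : 0%:Z - 1 = Negz 0) // /xpos big_ord0 big_ord1.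
  by rewrite (_ : - 0%N%:Z = 0%:Z) //; lra.
- rewrite (_ : n.+1%:Z - 1 = n%:Z); last by lia.
  by rewrite /xpos big_ord_recr.
- rewrite (_ : Negz n - 1 = Negz n.+1); last by lia.
  rewrite /xpos [in RHS]big_ord_recr /= (_ : - n.+1%:Z = Negz n); last by lia.
  lra.
Qed.

Lemma xpos0 d : xpos d 0 = 0. Proof. exact: big_ord0. Qed.

Lemma xpos_agree (d d' : Omega) i k : i <= k ->
  (forall m, i < m -> m <= k -> d (Spacing m) = d' (Spacing m)) ->
  xpos d k - xpos d i = xpos d' k - xpos d' i.
Proof.
have [n] := ubnP (absz (k - i)); elim: n k => // n IH k nk.
rewrite le_eqVlt => /orP[/eqP <- _|ik h]; first by rewrite !subrr.
rewrite (xpos_step d) (xpos_step d') h //.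
by have := IH (k - 1) ltac:(lia) ltac:(lia) ltac:(move=> *; apply: h; lia); lra.
Qed.

(* Measurability *)
Definition evt (phi : Omega -> Prop) : Prop := measurable ([set d | phi d] : set Omega).

Lemma evt_cst P : evt (fun _ => P).
Proof.
case: (pselect P) => p.
  by rewrite /evt (_ : [set _ | _] = setT) //; apply/seteqP; split.
by rewrite /evt (_ : [set _ | _] = set0) //; apply/seteqP; split.
Qed.

Lemma evt_not phi : evt phi -> evt (fun d => ~ phi d).
Proof. exact: measurableC. Qed.

Lemma evt_and phi psi : evt phi -> evt psi -> evt (fun d => phi d /\ psi d).
Proof. exact: measurableI. Qed.

Lemma evt_or phi psi : evt phi -> evt psi -> evt (fun d => phi d \/ psi d).
Proof. exact: measurableU. Qed.

Lemma evt_imp phi psi : evt phi -> evt psi -> evt (fun d => phi d -> psi d).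
Proof.
move=> h1 h2; rewrite /evt (_ : [set _ | _] = [set d | ~ phi d \/ psi d]).
  by apply: evt_or => //; exact: evt_not.
apply/seteqP; split=> d /=; last by move=> [n /n|].
by move=> h; case: (pselect (phi d)) => p; [right; exact: h|left].
Qed.

Lemma evt_ext phi psi : (forall d, phi d <-> psi d) -> evt phi -> evt psi.
Proof.
by move=> h; rewrite /evt (_ : [set d | psi d] = [set d | phi d]) //;
  apply/seteqP; split=> d /h.
Qed.

Lemma evt_forall (T : countType) (phi : T -> Omega -> Prop) :
  (forall t, evt (phi t)) -> evt (fun d => forall t, phi t d).
Proof.
move=> h; rewrite /evt (_ : [set _ | _] =
    \bigcap_n [set d | if unpickle n is Some t then phi t d else True]).
  apply: bigcapT_measurable => n; case: (unpickle n) => [t|]; [exact: h|exact: evt_cst].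
apply/seteqP; split=> d /=; first by move=> hd n _ /=; case: (unpickle n).
by move=> hd t; have := hd (pickle t) I; rewrite /= pickleK.
Qed.

Lemma evt_exists (T : countType) (phi : T -> Omega -> Prop) :
  (forall t, evt (phi t)) -> evt (fun d => exists t, phi t d).
Proof.
move=> h; apply: (@evt_ext (fun d => ~ forall t, ~ phi t d)).
  by move=> d; split=> [/existsNP[t /contrapT]|[t pt] /(_ t)] //; exists t.
by apply: evt_not; apply: evt_forall => t; apply: evt_not.
Qed.

Definition rv (f : Omega -> R) : Prop :=
  measurable_fun [set: Omega] (f : Omega -> measurableTypeR R).

Lemma evt_lt f g : rv f -> rv g -> evt (fun d => f d < g d).
Proof.
move=> mf mg; have := measurable_fun_ltr mf mg.
move=> /(_ measurableT [set true]); rewrite setTI; apply => //.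
Qed.

Lemma rv_xpos k : rv (xpos^~ k).
Proof.
case: k => n; rewrite /rv /xpos.
  by apply: (@measurable_sum _ _ R) => j; exact: measurable_coord.
apply: measurable_funN; apply: (@measurable_sum _ _ R) => j; exact: measurable_coord.
Qed.

Lemma evt_velo k w : evt (fun d => velo d k = w).
Proof.
rewrite /evt /velo (_ : [set _ | _] = (fun d : Omega => d (Velocity k)) @^-1` (vdec @^-1` [set w])) //.
rewrite -[X in measurable X]setTI; apply: measurable_coord => //.
have s1 (y : R) : measurable ([set y] : set (measurableTypeR R)) by exact: measurable_set1.
case: w.
- rewrite (_ : _ @^-1` _ = [set -1]) //; apply/seteqP; split=> r /=; rewrite /vdec.
    by case: eqP => // _; case: eqP.
  by move=> ->; rewrite eqxx.
- rewrite (_ : _ @^-1` _ = ~` ([set -1] `|` [set 1])).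
    by apply: measurableC; apply: measurableU.
  apply/seteqP; split=> r /=; rewrite /vdec.
    by case: eqP => // n1; case: eqP => // n2 _ [].
  by move=> n; case: eqP => [e|_]; [case: n; left|case: eqP => [e|//]; case: n; right].
- rewrite (_ : _ @^-1` _ = [set 1]) //; apply/seteqP; split=> r /=; rewrite /vdec.
    by case: eqP => // _; case: eqP.
  by move=> ->; exact: (vcodeK vright).
Qed.

Lemma evt_outs c q r o : evt (fun d => outs d c q r = o).
Proof.
rewrite /evt /outs (_ : [set _ | _] =
  (fun d : Omega => d (Outcome c q r)) @^-1` (odec @^-1` [set o])) //.
rewrite -[X in measurable X]setTI; apply: measurable_coord => //.
have s1 (y : R) : measurable ([set y] : set (measurableTypeR R)) by exact: measurable_set1.
have sv w : measurable (odec @^-1` [set Some w] : set (measurableTypeR R)).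
  rewrite (_ : _ @^-1` _ = [set speed R w]) //; apply/seteqP; split=> r' /=; rewrite /odec.
    by case: w; (do 3?case: eqP => //).
  by move=> ->; exact: (ocodeK (Some w)).
case: o => [w|]; first exact: sv.
rewrite (_ : _ @^-1` _ = ~` (odec @^-1` [set Some vleft] `|` odec @^-1` [set Some vzero]
   `|` odec @^-1` [set Some vright])).
  by apply: measurableC; apply: measurableU => //; apply: measurableU.
apply/seteqP; split=> r' /=; first by move=> -> [[]|].
by case: (odec r') => // -[] n; exfalso; apply: n; [left; left|left; right|right].
Qed.

Lemma evt_case (w : Omega -> velocity) (phi : velocity -> Omega -> Prop) :
  (forall u, evt (fun d => w d = u)) -> (forall u, evt (phi u)) ->
  evt (fun d => phi (w d) d).
Proof.
move=> hw hp; apply: (@evt_ext (fun d => (w d = vleft /\ phi vleft d) \/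
    ((w d = vzero /\ phi vzero d) \/ (w d = vright /\ phi vright d)))).
  by move=> d; split=> [[[->]|[[->]|[->]]]|] //; case: (w d); tauto.
by do ?apply: evt_or; apply: evt_and.
Qed.

Lemma rv_case (w : Omega -> velocity) (f : velocity -> Omega -> R) :
  (forall u, evt (fun d => w d = u)) -> (forall u, rv (f u)) ->
  rv (fun d => f (w d) d).
Proof.
move=> hw hf _ B mB; rewrite setTI.
apply: (@evt_case w (fun u d => B (f u d))) => // u.
by have := hf u measurableT B mB; rewrite setTI.
Qed.

Section BoxEvents.
Variables i j : int.
Notation V d := (boxed i j (velo d)).

Lemma evt_vel q w : evt (fun d => velocity_of (V d) q = w).
Proof.
case: q => [k|a b]; last exact: (evt_cst (vzero = w)).
rewrite /= /boxed; case: ltP => _; first exact: evt_cst.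
by case: ltP => _; [exact: evt_cst|exact: evt_velo].
Qed.

Lemma rv_half f : rv f -> rv (fun d => f d / 2).
Proof. by move=> mf; exact: (measurableT_comp (@mulrr_measurable _ setT 2^-1) mf). Qed.

Lemma rv_add f g : rv f -> rv g -> rv (fun d => f d + g d).
Proof. exact: measurable_funD. Qed.

Lemma rv_sub f g : rv f -> rv g -> rv (fun d => f d - g d).
Proof. exact: measurable_funB. Qed.

Lemma rv_meet q r : rv (fun d => meet (xpos d) (V d) q r).
Proof.
rewrite /meet /mid.
apply: (@rv_case (fun d => velocity_of (V d) q) (fun u d =>
  match u, velocity_of (V d) r with
  | vright, vleft => (xpos d (lo r) - xpos d (lo q)) / 2
  | vright, vzero => (xpos d (lo r) + xpos d (hi r)) / 2 - xpos d (lo q)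
  | vzero, vleft => xpos d (lo r) - (xpos d (lo q) + xpos d (hi q)) / 2
  | _, _ => 0
  end)) => [u|u]; first exact: evt_vel.
apply: (@rv_case (fun d => velocity_of (V d) r) (fun u' d =>
  match u, u' with
  | vright, vleft => (xpos d (lo r) - xpos d (lo q)) / 2
  | vright, vzero => (xpos d (lo r) + xpos d (hi r)) / 2 - xpos d (lo q)
  | vzero, vleft => xpos d (lo r) - (xpos d (lo q) + xpos d (hi q)) / 2
  | _, _ => 0
  end)) => [u'|u']; first exact: evt_vel.
have c0 : rv (fun _ => 0) by exact: measurable_cst.
by case: u; case: u' => //; do ?[apply: rv_half|apply: rv_sub|apply: rv_add|exact: rv_xpos].
Qed.

Lemma rv_bir q : rv (fun d => bir (xpos d) q).
Proof. by apply: rv_half; apply: rv_sub; exact: rv_xpos. Qed.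

Lemma evt_res (v : Omega -> int -> velocity) q r o :
  (forall p w, evt (fun d => velocity_of (v d) p = w)) ->
  evt (fun d => res (v d) (outs d) q r = o).
Proof.
move=> hv; rewrite /res.
apply: (@evt_case (fun d => velocity_of (v d) q) (fun u d =>
  (if reaction_of u (velocity_of (v d) r) is Some c then outs d c q r else None) = o)) => // u.
apply: (@evt_case (fun d => velocity_of (v d) r) (fun u' d =>
  (if reaction_of u u' is Some c then outs d c q r else None) = o)) => // u'.
by case: (reaction_of u u') => [c|]; [exact: evt_outs|exact: evt_cst].
Qed.

Lemma evt_collides (O : Omega -> particle -> particle -> Prop) q r :
  (forall q r, evt (fun d => O d q r)) ->
  evt (fun d => collides (xpos d) (V d) (outs d) (O d) q r).
Proof.
move=> hO.
have res_ok q' r' p : evt (fun d => res (V d) (outs d) q' r' = Some (velocity_of (V d) p)).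
  apply: (@evt_case (fun d => velocity_of (V d) p)
    (fun u d => res (V d) (outs d) q' r' = Some u)) => u; first exact: evt_vel.
  by apply: evt_res; exact: evt_vel.
have pr p : evt (fun d => pres (xpos d) (V d) (outs d) (O d) p (meet (xpos d) (V d) q r)).
  apply: (@evt_ext (fun d => exist (V d) (outs d) (O d) p /\
      (bir (xpos d) p < meet (xpos d) (V d) q r /\
       alive (xpos d) (V d) (outs d) (O d) p (meet (xpos d) (V d) q r)))).
    by move=> d; split=> [[? []]|[]].
  apply: evt_and.
    case: p => [k|a b] /=; first exact: evt_cst.
    apply: (@evt_ext (fun d => (V d a = vright /\ V d b = vleft) /\
      (O d (Initial a) (Initial b) /\ outs d RightLeft (Initial a) (Initial b) = Some vzero))).
      by move=> d; split=> [[[? ?] []]|[]].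
    apply: evt_and; apply: evt_and => //; last exact: evt_outs.
      exact: (evt_vel (Initial a)).
    exact: (evt_vel (Initial b)).
  apply: evt_and; first by apply: evt_lt; [exact: rv_bir|exact: rv_meet].
  by apply: evt_and; apply: evt_forall => r'; apply: evt_imp => //; apply: evt_imp => //;
    apply: evt_lt; exact: rv_meet.
apply: (@evt_ext (fun d => (reaction_of (velocity_of (V d) q) (velocity_of (V d) r) <> None /\
    hi q < lo r) /\ (pres (xpos d) (V d) (outs d) (O d) q (meet (xpos d) (V d) q r) /\
    pres (xpos d) (V d) (outs d) (O d) r (meet (xpos d) (V d) q r)))).
  by move=> d; split=> [[[? ?] []]|[]].
apply: evt_and; last exact: evt_and.
apply: evt_and; last exact: evt_cst.
apply: evt_not.
apply: (@evt_case (fun d => velocity_of (V d) q) (fun u d =>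
  reaction_of u (velocity_of (V d) r) = None)) => u; first exact: evt_vel.
apply: (@evt_case (fun d => velocity_of (V d) r) (fun u' d =>
  reaction_of u u' = None)) => u'; [exact: evt_vel|exact: evt_cst].
Qed.

Lemma evt_box q r : evt (fun d => box (xpos d) (velo d) (outs d) i j q r).
Proof.
rewrite /box /occ; elim: (fuel i j) q r => [|n IH] q r; first exact: evt_cst.
exact: (@evt_collides (fun d => occ (xpos d) (velo d) (outs d) i j n)).
Qed.

End BoxEvents.

Definition dmeet (i j : int) (d : Omega) := meetRL (xpos d) (velo d) (outs d) i j.
Definition dblock (b : particle) (d : Omega) := blockade (xpos d) (velo d) (outs d) b.
Definition dexitL (i k : int) (d : Omega) := exitL (xpos d) (velo d) (outs d) i k.
Definition dexitR (i k : int) (d : Omega) := exitR (xpos d) (velo d) (outs d) i k.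
Definition dfirst (i k : int) (d : Omega) := firstL (xpos d) (velo d) (outs d) i k.
Definition dreachL b k (d : Omega) := reachL (xpos d) (velo d) (outs d) b k.
Definition dreachR i b (d : Omega) := reachR (xpos d) (velo d) (outs d) i b.
Definition dsooner i b k (d : Omega) := sooner (xpos d) i b k.
Definition dlater i b k (d : Omega) := later (xpos d) i b k.

Lemma evt_vel' q w : evt (fun d => velocity_of (velo d) q = w).
Proof. by case: q => [k|? ?]; [exact: evt_velo|exact: (evt_cst (vzero = w))]. Qed.

Lemma evt_meet i j : evt (dmeet i j).
Proof.
apply: (@evt_ext (fun d => velo d i = vright /\ (velo d j = vleft /\
  box (xpos d) (velo d) (outs d) i j (Initial i) (Initial j)))).
  by move=> d; split=> [[? []]|[]].
by do ?apply: evt_and; rewrite ?evt_box //; try exact: evt_velo; exact: evt_box.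
Qed.

Lemma evt_block b : evt (dblock b).
Proof.
case: b => [k|i j]; first exact: evt_velo.
by apply: evt_and; [exact: evt_meet|exact: evt_outs].
Qed.

Lemma evt_exitL i k : evt (dexitL i k).
Proof.
apply: (@evt_ext (fun d => i <= k /\ (velo d k = vleft /\ forall q,
   box (xpos d) (velo d) (outs d) i k q (Initial k) ->
      res (velo d) (outs d) q (Initial k) = Some vleft))).
  by move=> d; split=> [[? []]|[]].
apply: evt_and; first exact: evt_cst.
apply: evt_and; first exact: evt_velo.
apply: evt_forall => q; apply: evt_imp; first exact: evt_box.
by apply: evt_res => p w; exact: evt_vel'.
Qed.

Lemma evt_exitR i k : evt (dexitR i k).
Proof.
apply: (@evt_ext (fun d => i <= k /\ (velo d i = vright /\ forall r,
   box (xpos d) (velo d) (outs d) i k (Initial i) r ->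
      res (velo d) (outs d) (Initial i) r = Some vright))).
  by move=> d; split=> [[? []]|[]].
apply: evt_and; first exact: evt_cst.
apply: evt_and; first exact: evt_velo.
apply: evt_forall => q; apply: evt_imp; first exact: evt_box.
by apply: evt_res => p w; exact: evt_vel'.
Qed.

Lemma evt_first i k : evt (dfirst i k).
Proof.
apply: evt_and; first exact: evt_exitL.
apply: evt_forall => m; apply: evt_imp; first exact: evt_cst.
by apply: evt_imp; [exact: evt_cst|apply: evt_not; exact: evt_exitL].
Qed.

Lemma evt_reachL b k : evt (dreachL b k).
Proof.
apply: evt_and; first exact: evt_exitL.
apply: evt_forall => m; do 2 (apply: evt_imp; first exact: evt_cst).
by apply: evt_imp; [exact: evt_exitL|exact: evt_outs].
Qed.

Lemma evt_reachR i b : evt (dreachR i b).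
Proof.
apply: evt_and; first exact: evt_exitR.
apply: evt_forall => m; do 2 (apply: evt_imp; first exact: evt_cst).
by apply: evt_imp; [exact: evt_exitR|exact: evt_outs].
Qed.

Lemma evt_sooner i b k : evt (dsooner i b k).
Proof. by apply: evt_lt; apply: rv_sub; exact: rv_xpos. Qed.

Lemma evt_later i b k : evt (dlater i b k).
Proof. by apply: evt_lt; apply: rv_sub; exact: rv_xpos. Qed.

End Decode.

(** * The sources on which an event depends *)

Section Agreement.
Variables (R : realType) (i j : int).

Lemma collides_eq (x1 x2 : int -> R) V out1 out2 (O1 O2 : particle -> particle -> Prop) q r :
  within i j q -> within i j r ->
  (forall q' r', O1 q' r' -> within i j q' /\ within i j r') ->
  (forall q' r', within i j q' -> within i j r' -> meet x1 V q' r' = meet x2 V q' r') ->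
  (forall q', within i j q' -> bir x1 q' = bir x2 q') ->
  (forall q' r', O2 q' r' -> within i j q' /\ within i j r') ->
  (forall c q' r', within i j q' -> within i j r' -> meet x1 V q' r' < meet x1 V q r ->
    out1 c q' r' = out2 c q' r') ->
  (forall q' r', within i j q' -> within i j r' -> meet x1 V q' r' < meet x1 V q r ->
    O1 q' r' <-> O2 q' r') ->
  collides x1 V out1 O1 q r <-> collides x2 V out2 O2 q r.
Proof.
move=> wq wr w1 mE bE w2 oE OE.
have rE q' r' : within i j q' -> within i j r' -> meet x1 V q' r' < meet x1 V q r ->
    res V out1 q' r' = res V out2 q' r'.
  by move=> wq' wr' m; rewrite /res; case: (reaction_of _ _) => // c; exact: oE.
have pE p : within i j p ->
    pres x1 V out1 O1 p (meet x1 V q r) <-> pres x2 V out2 O2 p (meet x2 V q r).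
  move=> wp; rewrite /pres -(mE _ _ wq wr) -bE //.
  have ex : bir x1 p < meet x1 V q r -> exist V out1 O1 p <-> exist V out2 O2 p.
    case: p wp => //= a b [/= ia ab bj] bm.
    have wa : within i j (Initial a) by split=> //=; exact: le_trans ab bj.
    have wb : within i j (Initial b) by split=> //=; exact: le_trans ia ab.
    have mab : V a = vright -> V b = vleft -> meet x1 V (Initial a) (Initial b) < meet x1 V q r.
      by move=> va vb; rewrite {1}/meet /= va vb.
    split=> -[va vb Oab oab]; have m := mab va vb; split=> //.
    - by apply/OE.
    - by rewrite -oE.
    - by apply/OE.
    - by rewrite oE.
  have al : alive x1 V out1 O1 p (meet x1 V q r) <-> alive x2 V out2 O2 p (meet x1 V q r).
    split=> -[a1 a2]; split=> r' Or mr.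
    - have [_ wr'] := w2 _ _ Or; rewrite -mE // in mr.
      by rewrite -rE //; apply: a1 => //; apply/OE.
    - have [wr' _] := w2 _ _ Or; rewrite -mE // in mr.
      by rewrite -rE //; apply: a2 => //; apply/OE.
    - have [_ wr'] := w1 _ _ Or.
      by rewrite rE //; apply: a1; rewrite -?mE //; apply/OE.
    - have [wr' _] := w1 _ _ Or.
      by rewrite rE //; apply: a2; rewrite -?mE //; apply/OE.
  by split=> -[h1 h2 /al h3]; split=> //; apply/ex.
rewrite /collides; split=> -[h1 h2 h3 h4]; split=> //; try exact/pE.
Qed.

(** Only outcomes of strictly earlier collisions enter. So whether a pair collides does not depend
    on its own outcome, which [meet_support] exploits. *)
Lemma occ_eq (x1 x2 : int -> R) v1 v2 out1 out2 n q r :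
  (forall k, i <= k -> k <= j -> v1 k = v2 k) ->
  (forall k l, i <= k -> k <= j -> i <= l -> l <= j -> x1 k - x1 l = x2 k - x2 l) ->
  within i j q -> within i j r ->
  (forall c q' r', within i j q' -> within i j r' ->
    meet x1 (boxed i j v1) q' r' < meet x1 (boxed i j v1) q r ->
    out1 c q' r' = out2 c q' r') ->
  occ x1 v1 out1 i j n q r <-> occ x2 v2 out2 i j n q r.
Proof.
move=> vv xx.
have VE : boxed i j v1 = boxed i j v2.
  apply/funext => k; rewrite /boxed; case: ltP => // ik; case: ltP => // kj; exact: vv.
have mE V q' r' : within i j q' -> within i j r' -> meet x1 V q' r' = meet x2 V q' r'.
  move=> [q1 q2 q3] [r1 r2 r3]; rewrite /meet /mid.
  have a1 := xx (lo r') (lo q') ltac:(lia) ltac:(lia) ltac:(lia) ltac:(lia).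
  have a2 := xx (hi r') (lo q') ltac:(lia) ltac:(lia) ltac:(lia) ltac:(lia).
  have a3 := xx (lo r') (hi q') ltac:(lia) ltac:(lia) ltac:(lia) ltac:(lia).
  by case: (velocity_of V q'); case: (velocity_of V r') => //; lra.
have bE q' : within i j q' -> bir x1 q' = bir x2 q'.
  move=> [q1 q2 q3]; rewrite /bir.
  by have := xx (hi q') (lo q') ltac:(lia) ltac:(lia) ltac:(lia) ltac:(lia); lra.
elim: n q r => //= n IH q r wq wr oE.
rewrite -VE; apply: collides_eq => //.
- by move=> q' r' h; exact: (@occ_within _ x1 v1 out1 i j n q' r' h).
- exact: (mE (boxed i j v1)).
- by move=> q' r' h; exact: (@occ_within _ x2 v2 out2 i j n q' r' h).
move=> q' r' wq' wr' m; rewrite (IH q' r' wq' wr') ?/occ -?VE //.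
by move=> c q'' r'' wq'' wr'' m'; apply: oE => //; exact: lt_trans m' m.
Qed.

Lemma box_eq (x1 x2 : int -> R) v1 v2 out1 out2 q r :
  (forall k, i <= k -> k <= j -> v1 k = v2 k) ->
  (forall k l, i <= k -> k <= j -> i <= l -> l <= j -> x1 k - x1 l = x2 k - x2 l) ->
  (forall c q' r', within i j q' -> within i j r' -> out1 c q' r' = out2 c q' r') ->
  box x1 v1 out1 i j q r <-> box x2 v2 out2 i j q r.
Proof.
move=> vv xx oo.
have H : within i j q -> within i j r -> box x1 v1 out1 i j q r <-> box x2 v2 out2 i j q r.
  by move=> wq wr; apply: occ_eq => // *; apply: oo.
by split=> h; have [wq wr] := occ_within h; apply/H.
Qed.

End Agreement.

Section Supports.
Variable R : realType.
Notation Omega := (Omega R).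
Implicit Types (d : Omega) (b : particle).

(** A box involves only differences of positions inside it; the gap [Spacing k] ends at k, hence the
    strict inequality on the left. *)
Definition in_box (i j : int) : set source := fun s =>
  match s with
  | Spacing k => i < k /\ k <= j
  | Velocity k => i <= k /\ k <= j
  | Outcome c q r => within i j q /\ within i j r
  end.

Definition spacings (i j : int) : set source := fun s =>
  if s is Spacing k then i < k /\ k <= j else False.

(* The outcomes of the collisions of b with the arrows strictly between. *)
Definition outcomesL b k : set source := fun s =>
  if s is Outcome BlockLeft q (Initial m) then q = b /\ hi b < m /\ m < k else False.
Definition outcomesR i b : set source := fun s =>
  if s is Outcome RightBlock (Initial m) q then q = b /\ i < m /\ m < lo b else False.

Definition agree_on (S : set source) d d' := forall s, S s -> d s = d' s.

Lemma agree_sub S S' d d' : S' `<=` S -> agree_on S d d' -> agree_on S' d d'.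
Proof. by move=> SS h s /SS /h. Qed.

Lemma agree_sym S d d' : agree_on S d d' -> agree_on S d' d.
Proof. by move=> h s /h. Qed.

Lemma agree_xpos i j d d' k l : agree_on (spacings i j) d d' ->
  i <= k -> k <= j -> i <= l -> l <= j -> xpos d k - xpos d l = xpos d' k - xpos d' l.
Proof.
move=> h ik kj il lj.
have A m : i <= m -> m <= j -> xpos d m - xpos d i = xpos d' m - xpos d' i.
  by move=> im mj; apply: xpos_agree => // p ip pm; apply: h; split=> //; lia.
by have := A k ik kj; have := A l il lj; lra.
Qed.

Lemma agree_box_eq i j d d' : agree_on (in_box i j) d d' ->
  [/\ forall k, i <= k -> k <= j -> velo d k = velo d' k,
      forall k l, i <= k -> k <= j -> i <= l -> l <= j ->
        xpos d k - xpos d l = xpos d' k - xpos d' l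
    & forall c q r, within i j q -> within i j r -> outs d c q r = outs d' c q r].
Proof.
move=> h; split.
- by move=> k ik kj; rewrite /velo h.
- by move=> k l; apply: agree_xpos => s; case: s => // m; exact: (h (Spacing m)).
- by move=> c q r wq wr; rewrite /outs h.
Qed.

Lemma exitL_agree i k d d' : agree_on (in_box i k) d d' -> dexitL i k d -> dexitL i k d'.
Proof.
move=> /agree_box_eq[vv xx oo] [ik vk h]; split => //; first by rewrite -vv.
move=> q Bq; have [wq wk] := occ_within Bq.
have := h q; rewrite /res (vel_within vv wq) (vel_within vv wk).
move=> /(_ ltac:(apply/(box_eq q (Initial k) vv xx oo); exact: Bq)).
by case: (reaction_of _ _) => // c; rewrite oo.
Qed.

Lemma exitR_agree i k d d' : agree_on (in_box i k) d d' -> dexitR i k d -> dexitR i k d'.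
Proof.
move=> /agree_box_eq[vv xx oo] [ik vk h]; split => //; first by rewrite -vv.
move=> q Bq; have [wk wq] := occ_within Bq.
have := h q; rewrite /res (vel_within vv wq) (vel_within vv wk).
move=> /(_ ltac:(apply/(box_eq (Initial i) q vv xx oo); exact: Bq)).
by case: (reaction_of _ _) => // c; rewrite oo.
Qed.

Lemma in_box_sub i j i' j' : i <= i' -> j' <= j -> in_box i' j' `<=` in_box i j.
Proof.
move=> ii jj [k|k|c q r] /=; [by move=> [? ?]; split; lia|by move=> [? ?]; split; lia|].
by move=> [[? ? ?] [? ? ?]]; split; split=> //; lia.
Qed.

Lemma first_agree i k d d' : agree_on (in_box i k) d d' -> dfirst i k d -> dfirst i k d'.
Proof.
move=> h [h1 h2]; split; first exact: exitL_agree h h1.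
move=> m im mk em; apply: (h2 m) => //; apply: exitL_agree em; apply: agree_sym.
by apply: agree_sub h; apply: in_box_sub => //; exact: ltW.
Qed.

Definition meet_support i j : set source :=
  in_box i j `\` [set Outcome RightLeft (Initial i) (Initial j)].

Lemma meet_agree i j d d' : i <= j -> agree_on (meet_support i j) d d' ->
  dmeet i j d -> dmeet i j d'.
Proof.
move=> ij h [vi vj B].
have vv k : i <= k -> k <= j -> velo d k = velo d' k.
  by move=> ik kj; rewrite /velo h.
have xx k l : i <= k -> k <= j -> i <= l -> l <= j ->
    xpos d k - xpos d l = xpos d' k - xpos d' l.
  by apply: agree_xpos => s; case: s => // m hm; apply: h; split.
have [w1 w2] := occ_within B.
split; rewrite -?vv //.
apply/(@occ_eq _ i j (xpos d) _ (velo d) _ (outs d)) => //.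
move=> c q r wq wr m; rewrite /outs h //; split=> // -[_ eq er].
by move: m; rewrite eq er ltxx.
Qed.

Lemma block_agree b d d' : lo b <= hi b -> agree_on (in_box (lo b) (hi b)) d d' ->
  dblock b d -> dblock b d'.
Proof.
case: b => [k|i j] /= hb h; first by rewrite /dblock /= /velo h.
move=> [mij oij]; split.
  by apply: meet_agree mij => //; apply: agree_sub h; exact: subDsetl.
by rewrite -oij /outs h //=; split; split.
Qed.

Lemma reachL_agree b k d d' : agree_on (in_box (hi b + 1) k `|` outcomesL b k) d d' ->
  dreachL b k d -> dreachL b k d'.
Proof.
move=> h [h1 h2]; split.
  by apply: exitL_agree h1; apply: agree_sub h; exact: subsetUl.
move=> m bm mk em; rewrite -(h2 m) //.
  by rewrite /outs h //; right.
apply: exitL_agree em; apply: agree_sym; apply: agree_sub h.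
apply: subset_trans (@subsetUl _ _ _); apply: in_box_sub => //; exact: ltW.
Qed.

Lemma reachR_agree i b d d' : agree_on (in_box i (lo b - 1) `|` outcomesR i b) d d' ->
  dreachR i b d -> dreachR i b d'.
Proof.
move=> h [h1 h2]; split.
  by apply: exitR_agree h1; apply: agree_sub h; exact: subsetUl.
move=> m bm mk em; rewrite -(h2 m) //.
  by rewrite /outs h //; right.
apply: exitR_agree em; apply: agree_sym; apply: agree_sub h.
apply: subset_trans (@subsetUl _ _ _); apply: in_box_sub => //; exact: ltW.
Qed.

Lemma sooner_agree i b k d d' : i <= lo b -> lo b <= hi b -> hi b <= k ->
  agree_on (spacings i k) d d' -> dsooner i b k d -> dsooner i b k d'.
Proof.
move=> ib hb bk h; rewrite /dsooner /sooner.
by rewrite !(@agree_xpos i k d d') //; lia.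
Qed.

Lemma later_agree i b k d d' : i <= lo b -> lo b <= hi b -> hi b <= k ->
  agree_on (spacings i k) d d' -> dlater i b k d -> dlater i b k d'.
Proof.
move=> ib hb bk h; rewrite /dlater /later.
by rewrite !(@agree_xpos i k d d') //; lia.
Qed.

End Supports.

(** * Reflections and shifts of the sources *)

Section Reflect.
Variable R : realType.
Notation Omega := (Omega R).
Implicit Types d : Omega.

(** The image of the gap between k - 1 and k is the gap between c - k and c + 1 - k, whence the
    offset for spacings. *)
Definition source_flip (c : int) (s : source) : source :=
  match s with
  | Spacing k => Spacing (c + 1 - k)
  | Velocity k => Velocity (c - k)
  | Outcome rc q r => Outcome (rflip rc) (pflip c r) (pflip c q)
  end.
Definition source_sign (s : source) : R -> R :=
  match s with Spacing _ => id | Velocity _ => -%R | Outcome _ _ _ => @oneg R end.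

Lemma measurable_source_sign s :
  measurable_fun [set: measurableTypeR R] (source_sign s : measurableTypeR R -> measurableTypeR R).
Proof.
by case: s => *; [exact: measurable_id|exact: oppr_measurable|exact: measurable_oneg].
Qed.

Lemma source_flipK c : involutive (source_flip c).
Proof.
by case=> [k|k|rc q r] /=; rewrite ?rflipK ?pflipK //; congr (_ _); lia.
Qed.

Lemma source_sign_flip c s : source_sign (source_flip c s) = source_sign s.
Proof. by case: s. Qed.

Definition reflect c : Omega -> Omega := transform source_sign (source_flip c).

Lemma velo_reflect c d : velo (reflect c d) = velflip (velo d) c.
Proof. by apply/funext => k; rewrite /velo /reflect /transform /= vdecN. Qed.

Lemma outs_reflect c d : outs (reflect c d) = outflip (outs d) c.
Proof.
by apply/funext => rc; apply/funext => q; apply/funext => r;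
  rewrite /outs /reflect /transform /= odec_oneg.
Qed.

Lemma xpos_reflect c d : xpos (reflect c d) = xflip (xpos d) c (xpos d c).
Proof.
have st k : xpos (reflect c d) k = xpos (reflect c d) (k - 1) + (xpos d (c + 1 - k) - xpos d (c - k)).
  rewrite {1}xpos_step /reflect /transform /=.
  rewrite (xpos_step d (c + 1 - k)) (_ : c + 1 - k - 1 = c - k); last by lia.
  lra.
have P (n : nat) : xpos (reflect c d) n%:Z = xflip (xpos d) c (xpos d c) n%:Z.
  elim: n => [|n IH]; first by rewrite xpos0 /xflip subr0 subrr.
  rewrite st (_ : n.+1%:Z - 1 = n%:Z); last by lia.
  rewrite IH /xflip (_ : c + 1 - n.+1%:Z = c - n%:Z); last by lia.
  lra.
have N (n : nat) : xpos (reflect c d) (- n%:Z) = xflip (xpos d) c (xpos d c) (- n%:Z).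
  elim: n => [|n IH]; first by rewrite oppr0 xpos0 /xflip subr0 subrr.
  move: (st (- n%:Z)); rewrite IH /xflip (_ : - n%:Z - 1 = - n.+1%:Z); last by lia.
  rewrite (_ : c - - n.+1%:Z = c + 1 - - n%:Z); last by lia.
  lra.
apply/funext => k; case: k => n; first exact: P.
by rewrite NegzE; exact: N.
Qed.

Lemma meet_reflect c i j d : i <= j ->
  dmeet (c - j) (c - i) (reflect c d) <-> dmeet i j d.
Proof. by move=> ij; rewrite /dmeet velo_reflect outs_reflect xpos_reflect meetRL_flip. Qed.

Lemma block_reflect c b d : lo b <= hi b ->
  dblock (pflip c b) (reflect c d) <-> dblock b d.
Proof. by move=> ij; rewrite /dblock velo_reflect outs_reflect xpos_reflect blockade_flip. Qed.

Lemma exitL_reflect c i k d : dexitL (c - k) (c - i) (reflect c d) <-> dexitR i k d.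
Proof. by rewrite /dexitL velo_reflect outs_reflect xpos_reflect exitL_flip. Qed.

Lemma exitR_reflect c i k d : dexitR (c - k) (c - i) (reflect c d) <-> dexitL i k d.
Proof. by rewrite /dexitR velo_reflect outs_reflect xpos_reflect exitR_flip. Qed.

Lemma reachL_reflect c i b d : dreachL (pflip c b) (c - i) (reflect c d) <-> dreachR i b d.
Proof. by rewrite /dreachL velo_reflect outs_reflect xpos_reflect reachL_flip. Qed.

Lemma reachR_reflect c b k d : dreachR (c - k) (pflip c b) (reflect c d) <-> dreachL b k d.
Proof. by rewrite /dreachR velo_reflect outs_reflect xpos_reflect reachR_flip. Qed.

Lemma later_reflect c i b k d :
  dlater (c - k) (pflip c b) (c - i) (reflect c d) <-> dsooner i b k d.
Proof.
rewrite /dlater /later xpos_reflect /xflip lo_pflip hi_pflip !subKr /dsooner /sooner.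
by split; lra.
Qed.

(** A translation is a composite of two reflections, so invariance under reflections yields
    stationarity. *)
Definition shift (s : int) (d : Omega) : Omega := reflect s (reflect 0 d).

Lemma exitL_shift s i k d : dexitL (s + i) (s + k) (shift s d) <-> dexitL i k d.
Proof.
rewrite (_ : s + i = s - (0 - i)); last by lia.
rewrite (_ : s + k = s - (0 - k)); last by lia.
by rewrite exitL_reflect exitR_reflect.
Qed.

Lemma first_shift s i k d : dfirst (s + i) (s + k) (shift s d) <-> dfirst i k d.
Proof.
split=> -[h1 h2]; split.
- exact/exitL_shift/h1.
- move=> m im mk em; apply: (h2 (s + m)); try lia.
  exact/exitL_shift.
- exact/exitL_shift.
- move=> m im mk em; apply: (h2 (m - s)); try lia.
  by apply/(exitL_shift s); rewrite (_ : s + (m - s) = m) //; lia.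
Qed.

Lemma meet_shift s i j d : i <= j -> dmeet (s + i) (s + j) (shift s d) <-> dmeet i j d.
Proof.
move=> ij; rewrite (_ : s + i = s - (0 - i)); last by lia.
rewrite (_ : s + j = s - (0 - j)); last by lia.
by rewrite meet_reflect ?meet_reflect //; lia.
Qed.

End Reflect.

(** * Probability calculus for events on the sources *)

Section Pr.
Variable R : realType.
Notation Omega := (Omega R).
Variable Q : probability Omega R.
Implicit Types phi psi : Omega -> Prop.

Definition good (d : Omega) : Prop :=
  (forall i j, (xpos d i < xpos d j) = (i < j)) /\ generic (xpos d).

Definition dep (S : set source) phi : Prop :=
  forall d d' : Omega, agree_on S d d' -> phi d -> phi d'.

Definition Pr phi : R := fine (Q [set d | phi d]).

Lemma Pr_ge0 phi : 0 <= Pr phi. Proof. exact: fine_ge0. Qed.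

Lemma PrE phi : evt phi -> Q [set d | phi d] = (Pr phi)%:E.
Proof. by move=> h; rewrite /Pr fineK //; exact: fin_num_measure. Qed.

Lemma Pr_le1 phi : evt phi -> Pr phi <= 1.
Proof. by move=> h; rewrite -lee_fin -PrE //; exact: probability_le1. Qed.

Lemma Pr_true phi : (forall d, phi d) -> Pr phi = 1.
Proof.
move=> h; rewrite /Pr (_ : [set d | phi d] = setT) ?probability_setT //.
by apply/seteqP; split=> // d _; exact: h.
Qed.

Lemma Pr_false phi : (forall d, ~ phi d) -> Pr phi = 0.
Proof.
move=> h; rewrite /Pr (_ : [set d | phi d] = set0) ?measure0 //.
by apply/seteqP; split=> // d /h.
Qed.

Lemma Pr_ext phi psi : (forall d, phi d <-> psi d) -> Pr phi = Pr psi.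
Proof.
by move=> h; congr (fine (Q _)); apply/seteqP; split=> d /h.
Qed.

Lemma Pr_not phi : evt phi -> Pr (fun d => ~ phi d) = 1 - Pr phi.
Proof.
move=> h; apply/EFin_inj; rewrite EFinB -!PrE //; last exact: evt_not.
by rewrite -[LHS]/(Q (~` [set d | phi d])) probability_setC.
Qed.

Section Good.
Hypothesis Qgood : {ae Q, forall d, good d}.

Lemma Pr_ae phi psi : evt phi -> evt psi -> (forall d, good d -> phi d <-> psi d) ->
  Pr phi = Pr psi.
Proof.
move=> mp ms h; have [N [mN N0 GN]] := Qgood.
congr fine; rewrite -(measureU0 mp mN N0) -(measureU0 ms mN N0); congr (Q _).
have key d : ~ N d -> good d by move=> n; apply: contrapT => ng; apply: n; apply: GN.
apply/seteqP; split=> d /=; case: (pselect (N d)) => [|/key/h e]; try by right.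
  by case; [move/e; left|right].
by case; [move/e; left|right].
Qed.

Lemma Pr_or phi psi : evt phi -> evt psi -> (forall d, good d -> phi d -> psi d -> False) ->
  Pr (fun d => phi d \/ psi d) = Pr phi + Pr psi.
Proof.
move=> mp ms h.
transitivity (Pr (fun d => phi d \/ (psi d /\ ~ phi d))).
  apply: Pr_ext => d; split=> [[]|[|[]]]; try tauto.
  by case: (pselect (phi d)); tauto.
have ms' : evt (fun d => psi d /\ ~ phi d) by apply: evt_and => //; exact: evt_not.
have -> : Pr psi = Pr (fun d => psi d /\ ~ phi d).
  by apply: Pr_ae => // d gd; split=> [ps|[]] //; split=> // ph; exact: (h d).
apply/EFin_inj; rewrite EFinD -!PrE //; last exact: evt_or.
rewrite -measureU //; apply/seteqP; split=> // d /= [? []]; tauto.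
Qed.

Lemma Pr_split phi psi : evt phi -> evt psi ->
  Pr phi = Pr (fun d => phi d /\ psi d) + Pr (fun d => phi d /\ ~ psi d).
Proof.
move=> mp ms; rewrite -Pr_or.
- by apply: Pr_ext => d; case: (pselect (psi d)); tauto.
- exact: evt_and.
- by apply: evt_and => //; exact: evt_not.
- by move=> d _; tauto.
Qed.

Lemma evt_exists_in (I : eqType) (s : seq I) (E : I -> Omega -> Prop) :
  (forall i, evt (E i)) -> evt (fun d => exists2 i, i \in s & E i d).
Proof.
move=> mE; elim: s => [|i s IH].
  by apply: (@evt_ext _ (fun _ => False)) => [d|]; [split=> [|[]]|exact: evt_cst].
apply: (@evt_ext _ (fun d => E i d \/ exists2 j, j \in s & E j d)); last exact: evt_or.
move=> d; split=> [[h|[j js h]]|[j]].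
- by exists i => //; rewrite inE eqxx.
- by exists j => //; rewrite inE js orbT.
- by rewrite inE => /orP[/eqP ->|js h]; [left|right; exists j].
Qed.

Lemma Pr_partition (I : eqType) (s : seq I) (E : I -> Omega -> Prop) phi : uniq s ->
  evt phi -> (forall i, evt (E i)) ->
  (forall d, good d -> phi d <-> exists2 i, i \in s & E i d) ->
  (forall d i j, good d -> i \in s -> j \in s -> E i d -> E j d -> i = j) ->
  Pr phi = \sum_(i <- s) Pr (E i).
Proof.
move=> us mp mE h disj; rewrite (Pr_ae mp (evt_exists_in s mE) h) {mp h phi}.
elim: s us disj => [_ _|i s IH /= /andP[is_ us] disj].
  by rewrite big_nil Pr_false // => d [].
rewrite big_cons -IH //; last first.
  by move=> d j k gd js ks; apply: disj => //; rewrite inE ?js ?ks orbT.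
rewrite -Pr_or //; first last.
- move=> d gd ei [j js ej]; move: is_; rewrite (disj d i j gd _ _ ei ej) ?js //.
    by rewrite inE eqxx.
  by rewrite inE js orbT.
- exact: evt_exists_in.
apply: Pr_ext => d; split=> [[j]|[h|[j js h]]].
- by rewrite inE => /orP[/eqP ->|js h]; [left|right; exists j].
- by exists i => //; rewrite inE eqxx.
- by exists j => //; rewrite inE js orbT.
Qed.

End Good.

Section Indep.
Hypothesis Qind : forall J E, uniq J ->
  (forall s, measurable (E s : set (measurableTypeR R))) ->
  Q (cylinder J E) = (\prod_(s <- J) Q [set d : Omega | E s (d s)])%E.

Lemma Pr_indep S T phi psi : evt phi -> evt psi -> dep S phi -> dep T psi ->
  (forall s, S s -> T s -> False) ->
  Pr (fun d => phi d /\ psi d) = Pr phi * Pr psi.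
Proof.
move=> mp ms dp ds ST.
have dA : depends S [set d : Omega | phi d] by exact: dp.
have dB : depends (~` S) [set d : Omega | psi d].
  by move=> d d' h; apply: ds => s Ts; apply: h => Ss; exact: (ST s).
have e := independent Qind mp ms dA dB.
rewrite /Pr -fineM; [|exact: fin_num_measure|exact: fin_num_measure].
by rewrite -e; congr fine.
Qed.

End Indep.

Lemma dep_sub S T phi : S `<=` T -> dep S phi -> dep T phi.
Proof. by move=> ST h d d' e; apply: h; exact: agree_sub e. Qed.

Lemma dep_and S phi psi : dep S phi -> dep S psi -> dep S (fun d => phi d /\ psi d).
Proof. by move=> h1 h2 d d' e [p1 p2]; split; [exact: h1 e p1|exact: h2 e p2]. Qed.

Lemma dep_not S phi : dep S phi -> dep S (fun d => ~ phi d).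
Proof. by move=> h d d' e n p; apply: n; apply: h p; exact: agree_sym. Qed.

Lemma dep_outs c q r (P : outcome -> Prop) :
  dep [set Outcome c q r] (fun d => P (outs d c q r)).
Proof. by move=> d d' e; rewrite /outs e. Qed.

Section Refl.
Hypothesis Qrefl : forall c (A : set Omega), measurable A -> Q (reflect c @^-1` A) = Q A.

Lemma Pr_reflect c phi : evt phi -> Pr (fun d => phi (reflect c d)) = Pr phi.
Proof. by move=> mp; congr fine; exact: (Qrefl c mp). Qed.

Lemma evt_reflect c phi : evt phi -> evt (fun d => phi (reflect c d)).
Proof.
move=> mp; rewrite /evt.
have := @measurable_transform R (@source_sign R) (source_flip c) (@measurable_source_sign R).
by move=> /(_ measurableT _ mp); rewrite setTI.
Qed.

Lemma Pr_shift s phi : evt phi -> Pr (fun d => phi (shift s d)) = Pr phi.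
Proof.
move=> mp; rewrite -(Pr_reflect s mp).
exact: (@Pr_reflect 0 (fun d => phi (reflect s d)) (evt_reflect s mp)).
Qed.

Lemma Pr_exitL i k : Pr (dexitL (i + 1) (i + k)) = Pr (dexitL 1 k).
Proof.
rewrite -(Pr_shift i (evt_exitL _ _)).
by apply: Pr_ext => d; exact: exitL_shift.
Qed.

Lemma Pr_first i k : Pr (dfirst (i + 1) (i + k)) = Pr (dfirst 1 k).
Proof.
rewrite -(Pr_shift i (evt_first _ _)).
by apply: Pr_ext => d; exact: first_shift.
Qed.

Lemma Pr_exitR k : Pr (dexitR 1 k) = Pr (dexitL 1 k).
Proof.
rewrite -(Pr_reflect (k + 1) (evt_exitL 1 k)); apply: Pr_ext => d.
have := @exitL_reflect R (k + 1) 1 k d.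
have -> : k + 1 - k = 1 by lia.
have -> : k + 1 - 1 = k by lia.
by case=> h1 h2; split.
Qed.

End Refl.
End Pr.

Lemma ae_forall_count (R : realType) d (T : measurableType d) (mu : {measure set T -> \bar R})
    (I : countType) (phi : I -> T -> Prop) :
  (forall i, {ae mu, forall w, phi i w}) -> {ae mu, forall w, forall i, phi i w}.
Proof.
move=> h; have : {ae mu, forall w, forall n : nat, forall i, unpickle n = Some i -> phi i w}.
  apply: ae_foralln => n; case e: (unpickle n) => [i|]; last by apply: aeW => w j.
  by apply: filterS (h i) => w hw j [<-].
by apply: filterS => w hw i; apply: (hw (pickle i)); exact: pickleK.
Qed.

(** * Almost sure absence of ties *)

Section GoodSpacings.
Variable R : realType.
Notation Omega := (Omega R).
Variable Q : probability Omega R.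
Hypothesis Qind : forall J E, uniq J ->
  (forall s, measurable (E s : set (measurableTypeR R))) ->
  Q (cylinder J E) = (\prod_(s <- J) Q [set d : Omega | E s (d s)])%E.
Hypothesis Qatom : forall k y, Q [set d : Omega | d (Spacing k) = y] = 0%E.
Hypothesis Qpos : forall k, Q [set d : Omega | 0 < d (Spacing k)] = 1%E.

Lemma xpos_increasing (d : Omega) : (forall k, 0 < d (Spacing k)) ->
  forall i j, (xpos d i < xpos d j) = (i < j).
Proof.
move=> h; have inc i (n : nat) : xpos d i < xpos d (i + n.+1%:Z).
  elim: n => [|n IH].
    by rewrite (xpos_step d (i + 1)) addrK ltrDl.
  rewrite (xpos_step d (i + n.+2%:Z)) (_ : i + n.+2%:Z - 1 = i + n.+1%:Z); last by lia.
  by apply: lt_trans IH _; rewrite ltrDl.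
have lti i j : i < j -> xpos d i < xpos d j.
  by move=> ij; have := inc i (absz (j - i)).-1; rewrite (_ : i + _ = j) //; lia.
move=> i j; case: (ltgtP i j) => [/lti//|ji|->]; last exact: ltxx.
by apply/negbTE; rewrite -leNgt ltW // lti.
Qed.

Lemma evt_tie i s t k : evt (fun d : Omega => xpos d i + xpos d k = xpos d s + xpos d t).
Proof.
have m1 : rv (fun d : Omega => xpos d i + xpos d k) by apply: rv_add; exact: rv_xpos.
have m2 : rv (fun d : Omega => xpos d s + xpos d t) by apply: rv_add; exact: rv_xpos.
apply: (@evt_ext _ (fun d => ~ (xpos d i + xpos d k < xpos d s + xpos d t) /\
  ~ (xpos d s + xpos d t < xpos d i + xpos d k))).
  move=> d; split=> [[/negP h1 /negP h2]|->]; last by rewrite ltxx.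
  by apply/eqP; rewrite eq_le leNgt h2 leNgt h1.
by apply: evt_and; apply: evt_not; exact: evt_lt.
Qed.

(** Given the other sources, a tie prescribes the value of [Spacing k]: this gap is part of x k - x
    t but not of x s - x i, and its law has no atoms. *)
Lemma no_tie i s t k : i < s -> s <= t -> t < k ->
  Q [set d : Omega | xpos d i + xpos d k = xpos d s + xpos d t] = 0%E.
Proof.
move=> is_ st tk; have mA : measurable [set d : Omega | xpos d i + xpos d k = xpos d s + xpos d t] by exact: evt_tie.
apply: (@null_sections _ _ Qind (~` [set Spacing k])) => // d.
rewrite -[RHS](Qatom k (xpos d s - xpos d i - (xpos d (k - 1) - xpos d t))); congr (Q _).
apply/seteqP.
have e d' : (xpos (mix (~` [set Spacing k]) (d, d')) i + xpos (mix (~` [set Spacing k]) (d, d')) k =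
  xpos (mix (~` [set Spacing k]) (d, d')) s + xpos (mix (~` [set Spacing k]) (d, d')) t) <->
  d' (Spacing k) = xpos d s - xpos d i - (xpos d (k - 1) - xpos d t).
  set D := mix _ _.
  have Dk : D (Spacing k) = d' (Spacing k) by rewrite /D /mix; case: asboolP => // h; case: h.
  have Dm m : m <> k -> D (Spacing m) = d (Spacing m).
    by move=> mk; rewrite /D /mix; case: asboolP => // h; case: h => -[].
  have e1 := @xpos_agree _ D d i s (ltW is_) (fun m _ ms => Dm m ltac:(lia)).
  have e2 := @xpos_agree _ D d t (k - 1) ltac:(lia) (fun m _ ms => Dm m ltac:(lia)).
  have e3 := xpos_step D k; rewrite Dk in e3.
  by rewrite e3; split=> h; lra.
by split=> d' /= /e.
Qed.

Lemma ae_good : {ae Q, forall d, good d}.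
Proof.
have pos : {ae Q, forall d : Omega, forall k : int, 0 < d (Spacing k)}.
  apply: ae_forall_count => k; exists (~` [set d : Omega | 0 < d (Spacing k)]).
  have m0 : measurable [set d : Omega | 0 < d (Spacing k)].
    have := @measurable_coord R (Spacing k) measurableT [set y | 0 < y].
    rewrite setTI; apply; rewrite (_ : [set y | 0 < y] = `]0, +oo[%classic) //.
    by apply/seteqP; split=> y; rewrite /= in_itv /= andbT.
  split=> //; first exact: measurableC.
  by apply: etrans (probability_setC Q m0) _; rewrite Qpos subee.
have tie : {ae Q, forall d : Omega, forall c : int * int * int * int,
    c.1.1.1 < c.1.1.2 -> c.1.1.2 <= c.1.2 -> c.1.2 < c.2 ->
    xpos d c.1.1.1 + xpos d c.2 <> xpos d c.1.1.2 + xpos d c.1.2}.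
  apply: ae_forall_count => -[[[i s] t] k] /=.
  case: (boolP [&& i < s, s <= t & t < k]) => [/and3P[h1 h2 h3]|n]; last first.
    by apply: aeW => d h1 h2 h3; move: n; rewrite h1 h2 h3.
  exists [set d : Omega | xpos d i + xpos d k = xpos d s + xpos d t]; split.
  - exact: evt_tie.
  - exact: no_tie.
  by move=> d /= nn; apply: contrapT => h; apply: nn => _ _ _; exact: h.
apply: filterS2 pos tie => d hp ht; split; first exact: xpos_increasing.
by move=> i s t k is_ st tk; exact: (ht (i, s, t, k)).
Qed.

End GoodSpacings.

(** * Blockades by their hulls, and the fates of particle 1 *)

Definition bk (s t : int) : particle := if s == t then Initial s else Generated s t.

Lemma lo_bk s t : lo (bk s t) = s. Proof. by rewrite /bk; case: eqP. Qed.
Lemma hi_bk s t : hi (bk s t) = t. Proof. by rewrite /bk; case: eqP => //= ->. Qed.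

Lemma pflip_bk c s t : pflip c (bk s t) = bk (c - t) (c - s).
Proof.
rewrite /bk; case: eqP => [->|ne]; first by rewrite eqxx.
by case: eqP => // e; case: ne; lia.
Qed.

(** A blockade is determined by its hull, so that sums over blockades become sums over hulls. *)
Lemma blockade_lohi (R : realType) (x : int -> R) v out b : blockade x v out b ->
  lo b <= hi b /\ b = bk (lo b) (hi b).
Proof.
case: b => [k _|i j [[_ _ /occ_order /= ij] _]] /=; first by rewrite /bk eqxx.
by split; [exact: ltW|rewrite /bk lt_eqF].
Qed.

(* The blockade with hull [m + 1, m + w]. *)
Definition bw (m w : nat) : particle := bk (m%:Z + 1) (m%:Z + w%:Z).

Section Fate.
Variable R : realType.
Notation Omega := (Omega R).
Implicit Types d : Omega.

Definition dhits (n : int) b d : Prop :=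
  [/\ dblock b d, dreachR 1 b d &
     forall k, k <= n -> dreachL b k d -> dlater 1 b k d ->
       outs d BlockLeft b (Initial k) = Some vzero].

Lemma dhitsP n b d : dhits n b d <-> hits (xpos d) (velo d) (outs d) 1 n b.
Proof.
split=> [[h1 h2 h3]|[h1 h2 h3 h4]]; split=> //.
- by case: h2 => -[].
- by move=> k kn rk /laterE; exact: h3.
- by move=> k kn rk /laterE; exact: h4.
Qed.

Lemma evt_hits n b : evt (dhits n b).
Proof.
apply: (@evt_ext _ (fun d => dblock b d /\ (dreachR 1 b d /\
  forall k, k <= n -> dreachL b k d -> dlater 1 b k d ->
       outs d BlockLeft b (Initial k) = Some vzero))).
  by move=> d; split=> [[? []]|[]].
apply: evt_and; first exact: evt_block.
apply: evt_and; first exact: evt_reachR.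
apply: evt_forall => k; apply: evt_imp; first exact: evt_cst.
by do 2 (apply: evt_imp; first by [exact: evt_reachL|exact: evt_later]); exact: evt_outs.
Qed.

(** Removal of arrow 1 by the left arrow j with no blockade arising; if a blockade arises, the case
    belongs to [dblock (bk 1 j)]. *)
Definition fateC (j : int) d : Prop := dmeet 1 j d /\
  (outs d RightLeft (Initial 1) (Initial j) <> Some vright /\
   outs d RightLeft (Initial 1) (Initial j) <> Some vzero).

Definition fateD (n : int) (b : particle) d : Prop :=
  dhits n b d /\ outs d RightBlock (Initial 1) b <> Some vright.

Lemma evt_fateC j : evt (fateC j).
Proof.
apply: evt_and; first exact: evt_meet.
by apply: evt_and; apply: evt_not; exact: evt_outs.
Qed.

Lemma evt_fateD n b : evt (fateD n b).
Proof. by apply: evt_and; [exact: evt_hits|apply: evt_not; exact: evt_outs]. Qed.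

Lemma meet_range i j d : dmeet i j d -> i < j.
Proof. by case=> _ _ /occ_order. Qed.

Lemma reachR_range i b d : dreachR i b d -> i < lo b.
Proof. by case=> -[h _ _] _; lia. Qed.

Lemma reachL_range b k d : dreachL b k d -> hi b < k.
Proof. by case=> -[h _ _] _; lia. Qed.

Section Good.
Variables (d : Omega) (n : int).
Hypothesis gd : good d.
Hypothesis n1 : 1 <= n.
Let xlt := proj1 gd.
Let xgen := proj2 gd.
Notation O := (box (xpos d) (velo d) (outs d) 1 n).
Notation V := (boxed 1 n (velo d)).

(* The particle that destroys the right arrow 1 within the box [1, n]. *)
Definition killer r : Prop :=
  O (Initial 1) r /\ res V (outs d) (Initial 1) r <> Some vright.

Lemma killer_uniq r r' : velo d 1 = vright -> killer r -> killer r' -> r = r'.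
Proof. by move=> v1 [h1 h2] [h3 h4]; exact: (killer_unique xlt xgen v1 h1 h3). Qed.

Lemma killer_meet j : dmeet 1 j d -> j <= n ->
  outs d RightLeft (Initial 1) (Initial j) <> Some vright -> killer (Initial j).
Proof.
move=> m jn o; have ij := meet_range m.
have [vi vj Oij _ _] := meetRL_parents xlt m ij jn.
by split=> //; rewrite /res /= vi vj.
Qed.

Lemma killer_hit b : dhits n b d -> hi b <= n ->
  outs d RightBlock (Initial 1) b <> Some vright -> killer b /\ velocity_of V b = vzero.
Proof.
move=> h bn o; have [bb rb _] := h; have [hb _] := blockade_lohi bb.
have ib := reachR_range rb.
have /dhitsP := h; move=> /(hitsP (velo d) (outs d) xlt xgen hb ib bn)[Oib vb].
split=> //; split=> //; rewrite /res vb /= boxed_in //.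
by case: rb => -[_ -> _] _.
Qed.

Lemma killer_cases r : killer r -> velo d 1 = vright ->
  (exists j, [/\ 1 < j, j <= n, r = Initial j, dmeet 1 j d &
     outs d RightLeft (Initial 1) (Initial j) <> Some vright]) \/
  [/\ 1 < lo r, lo r <= hi r, hi r <= n & fateD n r d].
Proof.
move=> [Or nr] v1; have dO := box_dynamics (xpos d) (velo d) (outs d) 1 n.
have [rx lr pr1 pr] := (dO _ _).1 Or.
have [_ [w1 w2 w3]] := occ_within Or; rewrite /= in lr.
have V1 : V 1 = vright by rewrite boxed_in.
move: rx nr; rewrite /res /= V1; case er: (velocity_of V r) => //= _ nr.
  left; have e : r = Initial (lo r) by apply: (@arrowE V); rewrite er.
  exists (lo r); split=> //; first by lia.
    apply/(@meetRL_boxed _ _ _ _ 1 n) => //; try lia.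
    apply/(meetRL_local xlt dO); first exact: ltW.
    by rewrite -e; split=> //; rewrite e in er.
  by rewrite -e.
right; split=> //; split; last by [].
by apply/dhitsP; apply/(hitsP (velo d) (outs d) xlt xgen w2 lr w3).
Qed.

Lemma exitR_killer : velo d 1 = vright -> dexitR 1 n d <-> forall r, ~ killer r.
Proof.
move=> v1; rewrite /dexitR (propext (exitR_box (xpos d) (velo d) (outs d) n1)).
split=> [[_ h] r [/h e]|h] //; split=> // r Or.
by apply: contrapT => nr; apply: (h r).
Qed.

(** A right arrow that does not leave the box has a killer, which is a left arrow, possibly with a
    blockade as result, or a blockade. *)
Lemma fate_cover : velo d 1 = vleft \/ (dexitR 1 n d \/
  ((exists2 t : nat, t \in index_iota 0 (absz n).+1 & dblock (bk 1 t%:Z) d) \/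
  ((exists2 j : nat, j \in index_iota 0 (absz n).+1 & fateC j%:Z d) \/
   (exists2 mw : nat * nat, mw \in [seq (m, w) | m <- index_iota 0 (absz n).+1,
        w <- index_iota 0 (absz n).+1] &
        hi (bw mw.1 mw.2) <= n /\ fateD n (bw mw.1 mw.2) d)))).
Proof.
have mem (k : int) : 1 <= k -> k <= n -> absz k \in index_iota 0 (absz n).+1.
  by rewrite mem_index_iota; lia.
have absE (k : int) : 1 <= k -> (absz k)%:Z = k by lia.
case v1: (velo d 1); [by left| |].
  right; right; left; exists 1%N; first exact: (mem 1).
  by rewrite /bk eqxx.
right; case: (pselect (dexitR 1 n d)) => [|ne]; first by left.
have [r kr] : exists r, killer r.
  by apply: contrapT => h; apply: ne; apply/exitR_killer => // r kr; apply: h; exists r.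
right; case: (killer_cases kr v1) => [[j [j1 jn _ mj oj]]|[r1 r2 r3 fr]].
  case: (pselect (outs d RightLeft (Initial 1) (Initial j) = Some vzero)) => oz.
    left; exists (absz j); first by apply: mem => //; lia.
    rewrite absE; last by lia.
    by rewrite /bk lt_eqF.
  right; left; exists (absz j); first by apply: mem => //; lia.
  by rewrite absE; [split|lia].
right; right; exists (absz (lo r - 1), absz (hi r - lo r + 1)).
  by apply: allpairs_f; rewrite mem_index_iota; lia.
have [[br _ _] _] := fr; have [_ er] := blockade_lohi br.
rewrite /= /bw (_ : (absz (lo r - 1))%:Z + 1 = lo r); last by lia.
rewrite (_ : (absz (lo r - 1))%:Z + (absz (hi r - lo r + 1))%:Z = hi r); last by lia.
by rewrite -er.
Qed.

Lemma block1_killer t : dblock (bk 1 t) d -> t <= n -> velo d 1 = vright -> killer (Initial t).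
Proof.
rewrite /bk; case: eqP => [_ + _|_ [m o] tn _]; first by rewrite /dblock /= => ->.
by apply: killer_meet => //; rewrite o.
Qed.

Lemma block1_vel t : dblock (bk 1 t) d -> velo d 1 = vzero /\ t = 1 \/ velo d 1 = vright.
Proof. by rewrite /bk; case: eqP => [-> h|_ [[-> _ _] _]]; [left|right]. Qed.

End Good.
End Fate.

Section Supports.
Variable R : realType.
Notation Omega := (Omega R).

Lemma dep_first i k : dep (in_box i k) (@dfirst R i k).
Proof. by move=> d d'; exact: first_agree. Qed.
Lemma dep_exitL i k : dep (in_box i k) (@dexitL R i k).
Proof. by move=> d d'; exact: exitL_agree. Qed.
Lemma dep_meet i j : i <= j -> dep (meet_support i j) (@dmeet R i j).
Proof. by move=> ij d d'; exact: meet_agree. Qed.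
Lemma dep_block b : lo b <= hi b -> dep (in_box (lo b) (hi b)) (@dblock R b).
Proof. by move=> hb d d'; exact: block_agree. Qed.
Lemma dep_reachL b k : dep (in_box (hi b + 1) k `|` outcomesL b k) (@dreachL R b k).
Proof. by move=> d d'; exact: reachL_agree. Qed.
Lemma dep_reachR i b : dep (in_box i (lo b - 1) `|` outcomesR i b) (@dreachR R i b).
Proof. by move=> d d'; exact: reachR_agree. Qed.
Lemma dep_velo k (P : velocity -> Prop) : dep [set Velocity k] (fun d : Omega => P (velo d k)).
Proof. by move=> d d' e; rewrite /velo (e _ erefl). Qed.

(* What happens on the right of b, seen from b. *)
Definition right_of (b : particle) : set source := fun s =>
  match s with
  | Spacing k => hi b + 1 < k
  | Velocity k => hi b < k
  | Outcome BlockLeft q (Initial m) => q = b /\ hi b < m \/ hi b < lo q /\ hi b < m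
  | Outcome c q r => hi b < lo q /\ hi b < lo r
  end.

Lemma in_box_right_of b i k : hi b < i -> in_box i k `<=` right_of b.
Proof.
move=> bi [m|m|c q r] /=; [by move=> [? ?]; lia|by move=> [? ?]; lia|].
move=> [[q1 q2 q3] [r1 r2 r3]]; have : hi b < lo q /\ hi b < lo r by split; lia.
by case: c => //; case: r {r1 r2 r3} => //= m; right.
Qed.

Lemma outcomesL_right_of b k : outcomesL b k `<=` right_of b.
Proof. by case=> [m|m|[] q [m|? ?]] //= [-> [? ?]]; left. Qed.

Lemma reachL_right_of b k : dep (right_of b) (@dreachL R b k).
Proof.
apply: dep_sub (@dep_reachL b k); rewrite subUset; split; last exact: outcomesL_right_of.
by apply: in_box_right_of; lia.
Qed.

Lemma in_box_left_of b i k : k <= hi b -> in_box i k `<=` ~` right_of b.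
Proof.
move=> kb [m|m|c q r] /=; [by move=> [? ?]; lia|by move=> [? ?]; lia|].
move=> [[q1 q2 q3] [r1 r2 r3]]; have n : ~ (hi b < lo q /\ hi b < lo r) by lia.
by case: c => //; case: r r1 r2 r3 n => //= m *; lia.
Qed.

Lemma outcomesR_left_of b i : lo b <= hi b -> outcomesR i b `<=` ~` right_of b.
Proof. by move=> hb [m|m|[] [m|? ?] q] //= [-> [? ?]]; lia. Qed.

Lemma block_left_of b : lo b <= hi b -> dep (~` right_of b) (@dblock R b).
Proof. by move=> hb; apply: dep_sub (dep_block hb); exact: in_box_left_of. Qed.

Lemma reachR_left_of i b : lo b <= hi b -> dep (~` right_of b) (@dreachR R i b).
Proof.
move=> hb; apply: dep_sub (@dep_reachR i b); rewrite subUset; split.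
  by apply: in_box_left_of; lia.
exact: outcomesR_left_of.
Qed.

End Supports.

(** * Recursions for exits and arrivals *)

Section Model.
Variable R : realType.
Notation Omega := (Omega R).
Variable Q : probability Omega R.
Variables ra rb ral rbe p : R.
Hypothesis Qind : forall J E, uniq J ->
  (forall s, measurable (E s : set (measurableTypeR R))) ->
  Q (cylinder J E) = (\prod_(s <- J) Q [set d : Omega | E s (d s)])%E.
Hypothesis Qgood : {ae Q, forall d, good d}.
Hypothesis Qrefl : forall c (A : set Omega), measurable A -> Q (reflect c @^-1` A) = Q A.
Notation P := (Pr Q).
Hypothesis Qvel : forall k u, P (fun d => velo d k = u) = velocity_law p u.
Hypothesis Qout : forall c q r o, P (fun d => outs d c q r = o) =
  reaction_law ra rb ral rbe c o.

(** The five sequences whose generating functions enter the final computation: first exits, exits,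
    meetings of the two outer arrows, blockades by width of hull, arrivals at a blockade. *)
Definition Fs (n : nat) : R := P (dfirst 1 n%:Z).
Definition Gs (n : nat) : R := P (dexitL 1 n%:Z).
Definition Ls (n : nat) : R := P (dmeet 1 n%:Z).
Definition Bs (n : nat) : R := P (dblock (bk 1 n%:Z)).
Definition Ys (n : nat) : R := P (dreachL (Initial 0) n%:Z).

Lemma Pfirst (i : int) (m n : nat) : (m <= n)%N ->
  P (dfirst (i + m%:Z + 1) (i + n%:Z)) = Fs (n - m).
Proof.
move=> mn; rewrite /Fs -(Pr_first Qrefl (i + m%:Z) (n - m)%N%:Z).
by congr (P (dfirst _ _)); lia.
Qed.

Lemma PexitL (i : int) (m n : nat) : (m <= n)%N ->
  P (dexitL (i + m%:Z + 1) (i + n%:Z)) = Gs (n - m).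
Proof.
move=> mn; rewrite /Gs -(Pr_exitL Qrefl (i + m%:Z) (n - m)%N%:Z).
by congr (P (dexitL _ _)); lia.
Qed.

Lemma in_box_disjoint i j i' j' s : j < i' -> in_box i j s -> in_box i' j' s -> False.
Proof.
move=> ji; case: s => [k|k|c q r] /=; [by move=> [? ?] [? ?]; lia|by move=> [? ?] [? ?]; lia|].
by move=> [[? ? ?] _] [[? ? ?] _]; lia.
Qed.

Lemma renewal n : Gs n = Fs n + \sum_(0 <= m < n) Fs m * Gs (n - m).
Proof.
pose E (m : nat) (d : Omega) := dfirst 1 m%:Z d /\ dexitL (m%:Z + 1) n%:Z d.
have mE m : evt (@E m) by apply: evt_and; [exact: evt_first|exact: evt_exitL].
transitivity (P (fun d => dfirst 1 n%:Z d \/ exists2 m, m \in index_iota 0 n & E m d)).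
  apply: (Pr_ae Qgood); first exact: evt_exitL.
    by apply: evt_or; [exact: evt_first|exact: evt_exists_in].
  move=> d [xlt xgen]; rewrite /dexitL (exitL_renewal _ _ xlt xgen).
  split=> [[h|[m [m1 mn f e]]]|[h|[m mn [f e]]]]; try by left.
    right; exists (absz m); first by rewrite mem_index_iota; lia.
    by rewrite /E (_ : (absz m)%:Z = m) //; lia.
  right; exists m%:Z; split=> //; first exact: firstL_le f.
  by move: mn; rewrite mem_index_iota; lia.
rewrite (Pr_or Qgood); [|exact: evt_first|exact: evt_exists_in|]; last first.
  move=> d _ f [m mn [f' _]]; have := firstL_unique f f'.
  by move: mn; rewrite mem_index_iota; lia.
congr (_ + _).
rewrite (@Pr_partition _ _ Qgood _ (index_iota 0 n) E) ?iota_uniq //; first last.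
- by move=> d i j _ _ _ [f _] [f' _]; have := firstL_unique f f'; lia.
- exact: evt_exists_in.
rewrite !big_seq; apply: eq_bigr => m; rewrite mem_index_iota => /andP[_ mn].
rewrite (@Pr_indep _ _ Qind (in_box 1 m) (in_box (m%:Z + 1) n)); first last.
- by move=> s; apply: in_box_disjoint; lia.
- exact: dep_exitL.
- exact: dep_first.
- exact: evt_exitL.
- exact: evt_first.
by have := @PexitL 0 m n (ltnW mn); rewrite !add0r => ->.
Qed.

(** Split according to the last arrival m before n, using [reachL_renewal]. The event D lives on the
    left of b and is independent of its right side; the factor [rbe] is the outcome of the arrival
    m. *)
Lemma reach_recursion D b n : evt D -> dep (~` right_of b) D ->
  P (fun d => D d /\ dreachL b (hi b + n%:Z) d) = P D * Fs n +
    \sum_(0 <= m < n) P (fun d => D d /\ dreachL b (hi b + m%:Z) d) * rbe * Fs (n - m).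
Proof.
move=> mD dD.
pose E (m : nat) (d : Omega) := (D d /\ dreachL b (hi b + m%:Z) d) /\
  (outs d BlockLeft b (Initial (hi b + m%:Z)) = Some vzero /\
   dfirst (hi b + m%:Z + 1) (hi b + n%:Z) d).
have mE m : evt (@E m).
  apply: evt_and; first by apply: evt_and => //; exact: evt_reachL.
  by apply: evt_and; [exact: evt_outs|exact: evt_first].
have mF : evt (fun d => D d /\ dfirst (hi b + 1) (hi b + n%:Z) d).
  by apply: evt_and => //; exact: evt_first.
transitivity (P (fun d => (D d /\ dfirst (hi b + 1) (hi b + n%:Z) d) \/
    exists2 m, m \in index_iota 0 n & E m d)).
  apply: (Pr_ae Qgood); first by apply: evt_and => //; exact: evt_reachL.
    by apply: evt_or => //; exact: evt_exists_in.
  move=> d [xlt xgen]; rewrite /dreachL (reachL_renewal _ _ xlt xgen).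
  split=> [[Dd [h|[m [m1 mn r o f]]]]|[[Dd h]|[m mn [[Dd r] [oz f]]]]].
  - by left.
  - right; exists (absz (m - hi b)); first by rewrite mem_index_iota; lia.
    by rewrite /E (_ : hi b + (absz (m - hi b))%:Z = m) //; lia.
  - by split=> //; left.
  split=> //; right; exists (hi b + m%:Z); split=> //; first exact: reachL_range r.
  by move: mn; rewrite mem_index_iota; lia.
rewrite (Pr_or Qgood mF (evt_exists_in _ mE)); last first.
  move=> d [xlt xgen] [_ [_ nf]] [m mn] [[_ r] _].
  have mb := reachL_range r; case: r => e _; apply: (nf (hi b + m%:Z)) => //; first by lia.
  by move: mn; rewrite mem_index_iota; lia.
congr (_ + _).
  rewrite (@Pr_indep _ _ Qind (~` right_of b) (in_box (hi b + 1) (hi b + n%:Z))) //; first last.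
  - by move=> s ns bs; apply: ns; apply: in_box_right_of bs; lia.
  - exact: dep_first.
  - exact: evt_first.
  by have := @Pfirst (hi b) 0 n isT; rewrite subn0 addr0 => ->.
rewrite (@Pr_partition _ _ Qgood _ (index_iota 0 n) E) ?iota_uniq //; first last.
- move=> d i j [xlt xgen] iN jN [ [_ r] [_ f]] [ [_ r'] [_ f']].
  have ri := reachL_range r; have rj := reachL_range r'.
  move: iN jN; rewrite !mem_index_iota => iN jN.
  have := predecessor_unique xlt xgen ri _ rj _ r r' f f'.
  by move=> /(_ ltac:(lia) ltac:(lia)); lia.
- exact: evt_exists_in.
rewrite !big_seq; apply: eq_bigr => m; rewrite mem_index_iota => /andP[_ mn].
case: (posnP m) => [m0|m0].
  have Z (d : Omega) : ~ dreachL b (hi b + 0%:Z) d by move/reachL_range; lia.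
  by rewrite !Pr_false ?mul0r ?mul0r // => d h; apply: (Z d); move: h; rewrite /E m0; tauto.
rewrite [LHS](@Pr_indep _ _ Qind (~` right_of b `|` (in_box (hi b + 1) (hi b + m%:Z) `|`
    outcomesL b (hi b + m%:Z)))
  ([set Outcome BlockLeft b (Initial (hi b + m%:Z))] `|` in_box (hi b + m%:Z + 1) (hi b + n%:Z))).
- rewrite [X in _ * X](@Pr_indep _ _ Qind [set Outcome BlockLeft b (Initial (hi b + m%:Z))]
     (in_box (hi b + m%:Z + 1) (hi b + n%:Z))).
  + by rewrite Qout /= mulrA (Pfirst _ (ltnW mn)).
  + exact: evt_outs.
  + exact: evt_first.
  + exact: (@dep_outs _ _ _ _ (fun o => o = Some vzero)).
  + exact: dep_first.
  + by move=> s -> /= [[? ? ?] [? ? ?]]; lia.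
- by apply: evt_and => //; exact: evt_reachL.
- by apply: evt_and; [exact: evt_outs|exact: evt_first].
- apply: dep_and; first by apply: dep_sub dD; exact: subsetUl.
  by apply: dep_sub (@dep_reachL _ _ _); exact: subsetUr.
- apply: dep_and.
    apply: dep_sub (@dep_outs _ _ _ _ (fun o => o = Some vzero)); exact: subsetUl.
  by apply: dep_sub (@dep_first _ _ _); exact: subsetUr.
move=> s [ns|[bs|os]] [es|fs].
- by apply: ns; rewrite es /=; left; split=> //; lia.
- by apply: ns; apply: in_box_right_of fs; lia.
- by move: bs; rewrite es /= => -[[? ? ?] [? ? ?]]; lia.
- by apply: in_box_disjoint bs fs; lia.
- by move: os; rewrite es /=; lia.
- by case: s os fs => // -[] // q [] //= l [-> [? ?]] [[? ? ?] _]; lia.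
Qed.

End Model.

(** * A blockade reached from both sides *)

Section Model.
Variable R : realType.
Notation Omega := (Omega R).
Variable Q : probability Omega R.
Variables ra rb ral rbe p : R.
Hypothesis Qind : forall J E, uniq J ->
  (forall s, measurable (E s : set (measurableTypeR R))) ->
  Q (cylinder J E) = (\prod_(s <- J) Q [set d : Omega | E s (d s)])%E.
Hypothesis Qgood : {ae Q, forall d, good d}.
Hypothesis Qrefl : forall c (A : set Omega), measurable A -> Q (reflect c @^-1` A) = Q A.
Notation P := (Pr Q).
Hypothesis Qvel : forall k u, P (fun d => velo d k = u) = velocity_law p u.
Hypothesis Qout : forall c q r o, P (fun d => outs d c q r = o) =
  reaction_law ra rb ral rbe c o.
Notation Fs := (Fs Q).
Notation Gs := (Gs Q).
Notation Ls := (Ls Q).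
Notation Bs := (Bs Q).
Notation Ys := (Ys Q).

Lemma evt_outs_neq c q r o : evt (fun d : Omega => outs d c q r <> o).
Proof. by apply: evt_not; exact: evt_outs. Qed.

Lemma Pout_neq c q r o : P (fun d => outs d c q r <> o) = 1 - reaction_law ra rb ral rbe c o.
Proof. by rewrite Pr_not ?Qout //; exact: evt_outs. Qed.

Lemma Pout_neq2 c q r o o' : o <> o' ->
  P (fun d => outs d c q r <> o /\ outs d c q r <> o') =
  1 - reaction_law ra rb ral rbe c o - reaction_law ra rb ral rbe c o'.
Proof.
move=> oo'; have mo o1 : evt (fun d : Omega => outs d c q r = o1) by exact: evt_outs.
transitivity (P (fun d => ~ (outs d c q r = o \/ outs d c q r = o'))).
  by apply: Pr_ext => d; tauto.
rewrite Pr_not; last exact: evt_or.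
rewrite (Pr_or Qgood) // ?Qout; first by rewrite opprD addrA.
by move=> d _ -> /oo'.
Qed.

Lemma Pout_neq3 c q r o o' o2 : o <> o' -> o <> o2 -> o' <> o2 ->
  P (fun d => (outs d c q r <> o /\ outs d c q r <> o') /\ outs d c q r <> o2) =
  1 - reaction_law ra rb ral rbe c o - reaction_law ra rb ral rbe c o' -
  reaction_law ra rb ral rbe c o2.
Proof.
move=> oo' oo2 o'o2; have mo o1 : evt (fun d : Omega => outs d c q r = o1) by exact: evt_outs.
rewrite -(@Pout_neq2 c q r) //.
rewrite (@Pr_split _ Q Qgood (fun d => outs d c q r <> o /\ outs d c q r <> o')
  (fun d => outs d c q r = o2)) //; last by apply: evt_and; exact: evt_outs_neq.
have e : P (fun d => (outs d c q r <> o /\ outs d c q r <> o') /\ outs d c q r = o2) =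
    reaction_law ra rb ral rbe c o2.
  rewrite -(Qout c q r); apply: Pr_ext => d; split=> [[]|-> ] //.
  by do !split=> //; exact: nesym.
by rewrite e addrAC subrr add0r.
Qed.

Lemma Ys0 : Ys 0 = 0.
Proof. by apply: Pr_false => d /reachL_range /=; lia. Qed.
Lemma Fs0 : Fs 0 = 0.
Proof. by apply: Pr_false => d [[h _ _] _]; lia. Qed.
Lemma Gs0 : Gs 0 = 0.
Proof. by apply: Pr_false => d [h _ _]; lia. Qed.
Lemma Ls0 : Ls 0 = 0.
Proof. by apply: Pr_false => d /meet_range; lia. Qed.

Lemma bk_false (s t : int) (d : Omega) : t < s -> ~ dblock (bk s t) d.
Proof. by rewrite /bk => ts; rewrite gt_eqF // => -[/meet_range]; lia. Qed.

Lemma Bs0 : Bs 0 = 0.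
Proof. by apply: Pr_false => d; exact: bk_false. Qed.

Lemma Ys_rec n : Ys n = Fs n + \sum_(0 <= m < n) Ys m * rbe * Fs (n - m).
Proof.
have h := @reach_recursion _ _ ra rb ral rbe Qind Qgood Qrefl Qout (fun _ => True)
  (Initial 0) n (@evt_cst R True) (fun d d' _ h => h).
have e (m : nat) : P (fun d => True /\ dreachL (Initial 0) (hi (Initial 0) + m%:Z) d) = Ys m.
  by apply: Pr_ext => d; rewrite /= add0r; tauto.
move: h; rewrite e Pr_true // mul1r => ->; congr (_ + _).
by apply: eq_bigr => m _; rewrite e.
Qed.

(** The products [P D * Ys n] solve the recursion of [reach_recursion], since [Ys] solves the one
    for the sure event. *)
Lemma Pr_reachL D b n : evt D -> dep (~` right_of b) D ->
  P (fun d => D d /\ dreachL b (hi b + n%:Z) d) = P D * Ys n.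
Proof.
move=> mD dD; elim/ltn_ind: n => n IH.
rewrite (@reach_recursion _ _ ra rb ral rbe Qind Qgood Qrefl Qout D b n mD dD).
rewrite Ys_rec mulrDr mulr_sumr; congr (_ + _).
rewrite !big_seq; apply: eq_bigr => m; rewrite mem_index_iota => /andP[_ mn].
by rewrite IH // !mulrA.
Qed.

Lemma dep_outs_at c q r (p' : outcome -> Prop) S : S (Outcome c q r) ->
  dep S (fun d : Omega => p' (outs d c q r)).
Proof. by move=> h; apply: dep_sub (@dep_outs _ _ _ _ p'); move=> s ->. Qed.

Lemma Pmeet_out (i j : int) (phi : outcome -> Prop) : i <= j ->
  evt (fun d : Omega => phi (outs d RightLeft (Initial i) (Initial j))) ->
  P (fun d => dmeet i j d /\ phi (outs d RightLeft (Initial i) (Initial j))) =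
  P (dmeet i j) * P (fun d => phi (outs d RightLeft (Initial i) (Initial j))).
Proof.
move=> ij mphi; apply: (Pr_indep Qind (S := meet_support i j)
  (T := [set Outcome RightLeft (Initial i) (Initial j)])) => //.
- exact: evt_meet.
- exact: dep_meet.
- exact: dep_outs.
by move=> s [_ h] /h.
Qed.

Lemma Ls1 : Ls 1 = 0.
Proof. by apply: Pr_false => d /meet_range; lia. Qed.

Lemma Bs_eq n : Bs n = (n == 1%N)%:R * p + rb * Ls n.
Proof.
case: n => [|[|n]].
- by rewrite Bs0 Ls0 mulr0 mul0r addr0.
- rewrite Ls1 mulr0 addr0 mul1r.
  by rewrite -[RHS]/(velocity_law p vzero) -(Qvel 1).
rewrite mul0r add0r /Bs /bk lt_eqF; last by lia.
rewrite -[LHS]/(P (fun d => dmeet 1 n.+2%:Z d /\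
  outs d RightLeft (Initial 1) (Initial n.+2%:Z) = Some vzero)).
rewrite (@Pmeet_out 1 n.+2%:Z (fun o => o = Some vzero)) //; last exact: evt_outs.
by rewrite Qout mulrC.
Qed.

(** Mirror image of [Pr_reachL]: the reflection k to m + w + 1 - k carries the hull [1, w] to
    [m + 1, m + w]. *)
Lemma Pblock_reachR (m w : nat) :
  P (fun d => dblock (bw m w) d /\ dreachR 1 (bw m w) d) = Bs w * Ys m.
Proof.
case: w => [|w].
  rewrite Bs0 mul0r; apply: Pr_false => d [+ _].
  by apply: bk_false; lia.
have hb : lo (bk 1 w.+1%:Z) <= hi (bk 1 w.+1%:Z) by rewrite lo_bk hi_bk.
rewrite -(Pr_reachL m (evt_block _) (block_left_of hb)).
pose c := m%:Z + w.+1%:Z + 1.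
rewrite -(Pr_reflect Qrefl c); last by apply: evt_and; [exact: evt_block|exact: evt_reachR].
apply: Pr_ext => d; rewrite hi_bk.
have h1 := @block_reflect _ c (bk 1 w.+1%:Z) d hb.
have h2 := @reachR_reflect _ c (bk 1 w.+1%:Z) (w.+1%:Z + m%:Z) d.
move: h1 h2; rewrite pflip_bk (_ : bk _ _ = bw m w.+1); last by congr (bk _ _); lia.
by rewrite (_ : c - (w.+1%:Z + m%:Z) = 1); [tauto|lia].
Qed.

(** The blockade [bw m w] is reached from the left by arrow 1 and from the right by the arrow k
    places beyond it, each side seen alone. [Us] and [Ul] split this event by whether arrow 1
    arrives first or second. *)
Definition core (m w k : nat) (d : Omega) :=
  (dblock (bw m w) d /\ dreachR 1 (bw m w) d) /\
  dreachL (bw m w) (hi (bw m w) + k%:Z) d.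
Definition Us m w k := P (fun d => core m w k d /\
   dsooner 1 (bw m w) (hi (bw m w) + k%:Z) d).
Definition Ul m w k := P (fun d => core m w k d /\
   dlater 1 (bw m w) (hi (bw m w) + k%:Z) d).

Lemma evt_core m w k : evt (core m w k).
Proof.
apply: evt_and; last exact: evt_reachL.
by apply: evt_and; [exact: evt_block|exact: evt_reachR].
Qed.

Lemma core_w m k d : ~ core m 0 k d.
Proof. by case=> -[+ _] _; apply: bk_false; lia. Qed.

Lemma Pcore m w k : P (core m w k) = Ys m * (Bs w * Ys k).
Proof.
case: w => [|w].
  by rewrite Bs0 !(mul0r, mulr0) Pr_false // => d; exact: core_w.
have hb : lo (bw m w.+1) <= hi (bw m w.+1) by rewrite lo_bk hi_bk; lia.
rewrite Pr_reachL.
- by rewrite Pblock_reachR; ring.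
- by apply: evt_and; [exact: evt_block|exact: evt_reachR].
by apply: dep_and; [exact: block_left_of|exact: reachR_left_of].
Qed.

(** The blockade and its two sides are independent, and almost surely the two arrows do not arrive
    together. *)
Lemma Us_Ul m w k : Us m w k + Ul m w k = Ys m * (Bs w * Ys k).
Proof.
rewrite -Pcore (@Pr_split _ _ Qgood (core m w k)
  (dlater 1 (bw m w) (hi (bw m w) + k%:Z)) (evt_core _ _ _)); last exact: evt_later.
rewrite addrC; congr (_ + _); apply: (Pr_ae Qgood).
- by apply: evt_and; [exact: evt_core|exact: evt_sooner].
- by apply: evt_and; [exact: evt_core|apply: evt_not; exact: evt_later].
move=> d [xlt xgen]; case: w => [|w]; first by split=> -[/core_w].
split=> -[c h]; split=> //; move: h; case: (c) => -[_ /reachR_range h1] /reachL_range h2;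
  have [n1 n2] := @not_later _ _ xgen 1 (bw m w.+1) (hi (bw m w.+1) + k%:Z) h1
    ltac:(by rewrite lo_bk hi_bk; lia) h2; by [apply: n2|apply: n1].
Qed.

(** Reflection exchanges the two sides and the order of arrival. With [Us_Ul] this fixes the
    symmetric sums of [Us] whatever the law of the spacings. *)
Lemma Us_flip m w k : Us m w k = Ul k w m.
Proof.
case: w => [|w].
  by rewrite /Us /Ul !Pr_false // => d [/core_w].
pose c := m%:Z + w.+1%:Z + k%:Z + 1.
rewrite /Ul -(Pr_reflect Qrefl c); last by apply: evt_and; [exact: evt_core|exact: evt_later].
apply: Pr_ext => d; rewrite /core.
have eb : pflip c (bw m w.+1) = bw k w.+1.
  by rewrite /bw pflip_bk; congr (bk _ _); lia.
have ek : c - 1 = hi (bw k w.+1) + m%:Z by rewrite hi_bk; lia.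
have e1 : c - (hi (bw m w.+1) + k%:Z) = 1 by rewrite hi_bk; lia.
have h1 := @block_reflect _ c (bw m w.+1) d ltac:(by rewrite lo_bk hi_bk; lia).
have h2 := @reachR_reflect _ c (bw m w.+1) (hi (bw m w.+1) + k%:Z) d.
have h3 := @reachL_reflect _ c 1 (bw m w.+1) d.
have h4 := @later_reflect _ c 1 (bw m w.+1) (hi (bw m w.+1) + k%:Z) d.
by move: h1 h2 h3 h4; rewrite eb ek e1; tauto.
Qed.

End Model.

(** * Independence of what follows the arrivals at a blockade *)

Section Model.
Variable R : realType.
Notation Omega := (Omega R).
Variable Q : probability Omega R.
Variables ra rb ral rbe p : R.
Hypothesis Qind : forall J E, uniq J ->
  (forall s, measurable (E s : set (measurableTypeR R))) ->
  Q (cylinder J E) = (\prod_(s <- J) Q [set d : Omega | E s (d s)])%E.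
Hypothesis Qgood : {ae Q, forall d, good d}.
Hypothesis Qrefl : forall c (A : set Omega), measurable A -> Q (reflect c @^-1` A) = Q A.
Notation P := (Pr Q).
Hypothesis Qvel : forall k u, P (fun d => velo d k = u) = velocity_law p u.
Hypothesis Qout : forall c q r o, P (fun d => outs d c q r = o) =
  reaction_law ra rb ral rbe c o.
Notation Fs := (Fs Q).
Notation Gs := (Gs Q).
Notation Ls := (Ls Q).
Notation Bs := (Bs Q).
Notation Ys := (Ys Q).

Notation Us := (Us Q).
Notation Ul := (Ul Q).

Lemma evt_or_out (phi : outcome -> Prop) c q r : evt (fun d : Omega => phi (outs d c q r)).
Proof.
apply: (@evt_ext _ (fun d => (phi None /\ outs d c q r = None) \/
  ((phi (Some vleft) /\ outs d c q r = Some vleft) \/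
  ((phi (Some vzero) /\ outs d c q r = Some vzero) \/
   (phi (Some vright) /\ outs d c q r = Some vright))))).
  move=> d; split=> [[[]|[[]|[[]|[]]]]|]; try by move=> h ->.
  by case: (outs d c q r) => [[]|] h; tauto.
by do !(apply: evt_or); apply: evt_and; (exact: evt_cst || exact: evt_outs).
Qed.

(* Sources independent of the arrivals at [bw m w] of the right arrow 1 and of
   the left arrow k places to its right. *)
Definition after (m w k n : nat) : set source :=
  in_box (hi (bw m w) + k%:Z + 1) n%:Z `|`
  ([set Outcome BlockLeft (bw m w) (Initial (hi (bw m w) + k%:Z))] `|`
   [set Outcome RightBlock (Initial 1) (bw m w)]).

Lemma core_m w k d : ~ core (R := R) 0 w k d.
Proof. by case=> -[_ /reachR_range +] _; rewrite lo_bk. Qed.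

Lemma core_k m w d : ~ core (R := R) m w 0 d.
Proof. by case=> _ /reachL_range; lia. Qed.

Lemma base_dep m w k n : dep (~` after m.+1 w.+1 k.+1 n) 
  (fun d : Omega => dblock (bw m.+1 w.+1) d /\ dreachR 1 (bw m.+1 w.+1) d).
Proof.
have hb : lo (bw m.+1 w.+1) <= hi (bw m.+1 w.+1) by rewrite lo_bk hi_bk; lia.
have l1 : 1 < lo (bw m.+1 w.+1) by rewrite lo_bk; lia.
apply: dep_and.
- apply: dep_sub (dep_block hb) => s bs [as_|[e|e]].
  + by apply: in_box_disjoint bs as_; lia.
  + by move: bs; rewrite e /= /within /= => -[_ [? ? ?]]; lia.
  + by move: bs; rewrite e /= /within /= => -[[? ? ?] _]; lia.
- apply: dep_sub (@dep_reachR _ _ _) => s [bs|os] [as_|[e|e]].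
  + by apply: in_box_disjoint bs as_; lia.
  + by move: bs; rewrite e /= /within /= => -[_ [? ? ?]]; lia.
  + by move: bs; rewrite e /= /within /= => -[_ [? ? ?]]; lia.
  + by case: s os as_ => // -[] // [l|? ?] q //= [-> [? ?]] [_ [? ? ?]]; lia.
  + by move: os; rewrite e.
  + by move: os; rewrite e /=; lia.
Qed.

Lemma core_dep m w k n : dep (~` after m.+1 w.+1 k.+1 n) (@core R m.+1 w.+1 k.+1).
Proof.
have hb : lo (bw m.+1 w.+1) <= hi (bw m.+1 w.+1) by rewrite lo_bk hi_bk; lia.
have l1 : 1 < lo (bw m.+1 w.+1) by rewrite lo_bk; lia.
apply: dep_and; first exact: base_dep.
apply: dep_sub (@dep_reachL _ _ _) => s [bs|os] [as_|[e|e]].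
- by apply: in_box_disjoint bs as_; lia.
- by move: bs; rewrite e /= /within /= => -[[? ? ?] _]; lia.
- by move: bs; rewrite e /= /within /= => -[_ [? ? ?]]; lia.
- by case: s os as_ => // -[] // q [l|? ?] //= [-> [? ?]] [[? ? ?] _]; lia.
- by move: os; rewrite e /=; lia.
- by move: os; rewrite e.
Qed.

Lemma sooner_dep m w k n :
  dep (~` after m.+1 w.+1 k.+1 n) (@dsooner R 1 (bw m.+1 w.+1) (hi (bw m.+1 w.+1) + k.+1%:Z)).
Proof.
move=> d d' e; apply: sooner_agree; rewrite ?lo_bk ?hi_bk; try lia.
apply: agree_sub e => -[l|l|c q r] //= [? ?] [[+ _]|[|]] //.
by rewrite hi_bk; lia.
Qed.

Lemma later_dep m w k n :
  dep (~` after m.+1 w.+1 k.+1 n) (@dlater R 1 (bw m.+1 w.+1) (hi (bw m.+1 w.+1) + k.+1%:Z)).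
Proof.
move=> d d' e; apply: later_agree; rewrite ?lo_bk ?hi_bk; try lia.
apply: agree_sub e => -[l|l|c q r] //= [? ?] [[+ _]|[|]] //.
by rewrite hi_bk; lia.
Qed.

Definition cores m w k (d : Omega) := core m w k d /\ dsooner 1 (bw m w) (hi (bw m w) + k%:Z) d.
Definition corel m w k (d : Omega) := core m w k d /\ dlater 1 (bw m w) (hi (bw m w) + k%:Z) d.

Lemma evt_cores m w k : evt (cores m w k).
Proof. by apply: evt_and; [exact: evt_core|exact: evt_sooner]. Qed.
Lemma evt_corel m w k : evt (corel m w k).
Proof. by apply: evt_and; [exact: evt_core|exact: evt_later]. Qed.

Lemma Pcores_after m w k n psi : evt psi -> dep (after m w k n) psi ->
  P (fun d => cores m w k d /\ psi d) = Us m w k * P psi.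
Proof.
move=> mpsi dpsi.
(* An empty hull or an empty side makes both members vanish; in the remaining case all sizes are
   positive. *)
have F : (w == 0)%N || (m == 0)%N || (k == 0)%N ->
    P (fun d => cores m w k d /\ psi d) = Us m w k * P psi.
  move=> z; have nc (d : Omega) : ~ core m w k d.
    by move: z => /orP[/orP[]|] /eqP ->; [exact: core_w|exact: core_m|exact: core_k].
  rewrite /Us Pr_false; last by move=> d [[/nc]].
  by rewrite Pr_false ?mul0r // => d [/nc].
case: w m k mpsi dpsi F => [|w] [|m] [|k] mpsi dpsi F; try exact: F.
apply: (Pr_indep Qind (S := ~` after m.+1 w.+1 k.+1 n) (T := after m.+1 w.+1 k.+1 n)) => //.
- exact: evt_cores.
- by apply: dep_and; [exact: core_dep|exact: sooner_dep].
Qed.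

Lemma Pcorel_after m w k n psi : evt psi -> dep (after m w k n) psi ->
  P (fun d => corel m w k d /\ psi d) = Ul m w k * P psi.
Proof.
move=> mpsi dpsi.
have F : (w == 0)%N || (m == 0)%N || (k == 0)%N ->
    P (fun d => corel m w k d /\ psi d) = Ul m w k * P psi.
  move=> z; have nc (d : Omega) : ~ core m w k d.
    by move: z => /orP[/orP[]|] /eqP ->; [exact: core_w|exact: core_m|exact: core_k].
  rewrite /Ul Pr_false; last by move=> d [[/nc]].
  by rewrite Pr_false ?mul0r // => d [/nc].
case: w m k mpsi dpsi F => [|w] [|m] [|k] mpsi dpsi F; try exact: F.
apply: (Pr_indep Qind (S := ~` after m.+1 w.+1 k.+1 n) (T := after m.+1 w.+1 k.+1 n)) => //.
- exact: evt_corel.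
- by apply: dep_and; [exact: core_dep|exact: later_dep].
Qed.

Section After.
Variables (m w k n : nat) (phi psi : outcome -> Prop).
Notation b := (bw m w).
Notation a := (Initial (hi b + k%:Z)).

Lemma Pouts2 : P (fun d => phi (outs d BlockLeft b a) /\ psi (outs d RightBlock (Initial 1) b)) =
  P (fun d => phi (outs d BlockLeft b a)) * P (fun d => psi (outs d RightBlock (Initial 1) b)).
Proof.
apply: (Pr_indep Qind (S := [set Outcome BlockLeft b a]) (T := [set Outcome RightBlock (Initial 1) b])).
- exact: evt_or_out.
- exact: evt_or_out.
- exact: dep_outs.
- exact: dep_outs.
- by move=> s ->.
Qed.

Lemma Pouts2_first : (m + w + k <= n)%N ->
  P (fun d => (phi (outs d BlockLeft b a) /\ psi (outs d RightBlock (Initial 1) b)) /\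
     dfirst (hi b + k%:Z + 1) n%:Z d) =
  P (fun d => phi (outs d BlockLeft b a)) * P (fun d => psi (outs d RightBlock (Initial 1) b)) *
  Fs (n - (m + w + k)).
Proof.
move=> kn; rewrite -Pouts2.
have <- : P (dfirst (hi b + k%:Z + 1) n%:Z) = Fs (n - (m + w + k)).
  by rewrite -(Pfirst Qrefl 0 kn) hi_bk; congr (P (dfirst _ _)); lia.
apply: (Pr_indep Qind (S := [set Outcome BlockLeft b a] `|` [set Outcome RightBlock (Initial 1) b])
  (T := in_box (hi b + k%:Z + 1) n%:Z)).
- by apply: evt_and; exact: evt_or_out.
- exact: evt_first.
- by apply: dep_and; apply: dep_outs_at; [left|right].
- exact: dep_first.
move=> s [->|->] /= [[? ? ?] [? ? ?]]; lia.
Qed.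

Lemma dep_outs2 : dep (after m w k n) (fun d : Omega =>
  phi (outs d BlockLeft b a) /\ psi (outs d RightBlock (Initial 1) b)).
Proof. by apply: dep_and; apply: dep_outs_at; [right; left|right; right]. Qed.

Lemma dep_outs2_first : dep (after m w k n) (fun d : Omega =>
  (phi (outs d BlockLeft b a) /\ psi (outs d RightBlock (Initial 1) b)) /\
     dfirst (hi b + k%:Z + 1) n%:Z d).
Proof.
apply: dep_and; first exact: dep_outs2.
by apply: dep_sub (@dep_first _ _ _); exact: subsetUl.
Qed.

End After.

End Model.

(** * Probability that arrow 1 is removed at a given blockade *)

Section Model.
Variable R : realType.
Notation Omega := (Omega R).
Variable Q : probability Omega R.
Variables ra rb ral rbe p : R.
Hypothesis Qind : forall J E, uniq J ->
  (forall s, measurable (E s : set (measurableTypeR R))) ->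
  Q (cylinder J E) = (\prod_(s <- J) Q [set d : Omega | E s (d s)])%E.
Hypothesis Qgood : {ae Q, forall d, good d}.
Hypothesis Qrefl : forall c (A : set Omega), measurable A -> Q (reflect c @^-1` A) = Q A.
Notation P := (Pr Q).
Hypothesis Qvel : forall k u, P (fun d => velo d k = u) = velocity_law p u.
Hypothesis Qout : forall c q r o, P (fun d => outs d c q r = o) =
  reaction_law ra rb ral rbe c o.
Notation Fs := (Fs Q).
Notation Gs := (Gs Q).
Notation Ls := (Ls Q).
Notation Bs := (Bs Q).
Notation Ys := (Ys Q).

Notation Us := (Us Q).
Notation Ul := (Ul Q).


Lemma Pbase_out m w (psi : outcome -> Prop) :
  P (fun d => (dblock (bw m w) d /\ dreachR 1 (bw m w) d) /\
     psi (outs d RightBlock (Initial 1) (bw m w))) =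
  Ys m * Bs w * P (fun d => psi (outs d RightBlock (Initial 1) (bw m w))).
Proof.
have F : (w == 0)%N || (m == 0)%N -> forall d : Omega,
    ~ (dblock (bw m w) d /\ dreachR 1 (bw m w) d).
  move=> /orP[] /eqP -> d [h1 h2]; first by move: h1; apply: bk_false; lia.
  by move: h2 => /reachR_range; rewrite lo_bk.
rewrite [Ys m * _]mulrC -(Pblock_reachR Qind Qgood Qrefl Qout m w).
case: w m F => [|w] [|m] F; try by
  rewrite Pr_false; [rewrite Pr_false ?mul0r // => d /(F isT)|move=> d [/(F isT)]].
apply: (Pr_indep Qind (S := ~` after m.+1 w.+1 1 0) (T := after m.+1 w.+1 1 0)) => //.
- by apply: evt_and; [exact: evt_block|exact: evt_reachR].
- exact: evt_or_out.
- exact: base_dep.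
by apply: dep_outs_at; right; right.
Qed.

(** Start from the event that arrow 1 reaches b from the left with an outcome it does not survive,
    and subtract the cases where a left arrow comes first and does not leave b standing. At most one
    k does so, which makes the cases disjoint. *)
Lemma Phits_out m w n : (m + w <= n)%N ->
  P (fateD n%:Z (bw m w)) = (1 - ral) * (Ys m * Bs w -
    (1 - rbe) * \sum_(0 <= k < (n - (m + w)).+1) Ul m w k).
Proof.
move=> mwn; set b := bw m w.
pose A (d : Omega) := (dblock b d /\ dreachR 1 b d) /\
  outs d RightBlock (Initial 1) b <> Some vright.
pose E (k : nat) (d : Omega) := corel m w k d /\
  (outs d BlockLeft b (Initial (hi b + k%:Z)) <> Some vzero /\
   outs d RightBlock (Initial 1) b <> Some vright).
have mbR : evt (fun d : Omega => dblock b d /\ dreachR 1 b d).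
  by apply: evt_and; [exact: evt_block|exact: evt_reachR].
have mA : evt A by apply: evt_and => //; exact: evt_outs_neq.
have mE k : evt (E k).
  by apply: evt_and; [exact: evt_corel|apply: evt_and; exact: evt_outs_neq].
have eE k : P (E k) = Ul m w k * ((1 - rbe) * (1 - ral)).
  rewrite (@Pcorel_after _ _ Qind m w k n).
  - rewrite (Pouts2 Qind m w k (fun o => o <> Some vzero) (fun o => o <> Some vright)).
    by rewrite !(Pout_neq Qout).
  - by apply: evt_and; exact: evt_outs_neq.
  - exact: (@dep_outs2 _ m w k n (fun o => o <> Some vzero) (fun o => o <> Some vright)).
have eA : P A = Ys m * Bs w * (1 - ral).
  by rewrite /A (Pbase_out m w (fun o => o <> Some vright)) (Pout_neq Qout).
have Ub : uniq (index_iota 0 (n - (m + w)).+1) by exact: iota_uniq.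
have mX : evt (fun d => exists2 k, k \in index_iota 0 (n - (m + w)).+1 & E k d).
  exact: evt_exists_in.
have split : P A = P (fateD n%:Z b) + P (fun d => exists2 k,
    k \in index_iota 0 (n - (m + w)).+1 & E k d).
  have mD : evt (fateD (R := R) n%:Z b) by exact: evt_fateD.
  rewrite -(Pr_or Qgood) //; last first.
    move=> d gd [[_ _ h] _] [k kn [[[[_ _] rk] lk] [nz _]]]; apply: nz; apply: h => //.
    by move: kn; rewrite mem_index_iota hi_bk; lia.
  apply: (Pr_ae Qgood) => //; first by apply: evt_or => //; exact: evt_fateD.
  move=> d gd; split=> [[[bb rb'] ob]|[[[bb rb' _] ob]|[k _ [[[[bb rb'] _] _] [_ ob]]]]] //.
  case: (pselect (exists2 k, k \in index_iota 0 (n - (m + w)).+1 & E k d)) => [|ne]; first by right.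
  left; split=> //; split=> // k kn rk lk; apply: contrapT => nz; apply: ne.
  have hk := reachL_range rk; rewrite hi_bk in hk.
  have ek : k = hi b + (absz (k - hi b))%:Z by rewrite hi_bk; lia.
  exists (absz (k - hi b)); first by rewrite mem_index_iota hi_bk; lia.
  by rewrite /E /corel /core -/b -ek; exact: (conj (conj (conj (conj bb rb') rk) lk) (conj nz ob)).
have eX : P (fun d => exists2 k, k \in index_iota 0 (n - (m + w)).+1 & E k d) =
    \sum_(0 <= k < (n - (m + w)).+1) P (E k).
  apply: (Pr_partition Qgood) => // d i j [xlt xgen] _ _
    [[[[_ _] r1] _] [z1 _]] [[[[_ _] r2] _] [z2 _]].
  have h1 := reachL_range r1; have h2 := reachL_range r2.
  by have := killer_unique_right h1 h2 r1 r2 z1 z2; lia.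
have -> : P (fateD n%:Z b) = P A - P (fun d => exists2 k,
    k \in index_iota 0 (n - (m + w)).+1 & E k d) by rewrite split addrK.
rewrite eA eX; under eq_bigr do rewrite eE.
by rewrite -mulr_suml; ring.
Qed.

End Model.

(** * First exits, according to the fate of particle 1 *)

Section Model.
Variable R : realType.
Notation Omega := (Omega R).
Variable Q : probability Omega R.
Variables ra rb ral rbe p : R.
Hypothesis Qind : forall J E, uniq J ->
  (forall s, measurable (E s : set (measurableTypeR R))) ->
  Q (cylinder J E) = (\prod_(s <- J) Q [set d : Omega | E s (d s)])%E.
Hypothesis Qgood : {ae Q, forall d, good d}.
Hypothesis Qrefl : forall c (A : set Omega), measurable A -> Q (reflect c @^-1` A) = Q A.
Notation P := (Pr Q).
Hypothesis Qvel : forall k u, P (fun d => velo d k = u) = velocity_law p u.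
Hypothesis Qout : forall c q r o, P (fun d => outs d c q r = o) =
  reaction_law ra rb ral rbe c o.
Notation Fs := (Fs Q).
Notation Gs := (Gs Q).
Notation Ls := (Ls Q).
Notation Bs := (Bs Q).
Notation Ys := (Ys Q).

Notation Us := (Us Q).
Notation Ul := (Ul Q).



(* An outcome that either ends the box, or is followed by a first exit. *)
Definition dend c q r (o : outcome) (phi : outcome -> Prop) (j n : int) (d : Omega) :=
  (outs d c q r = o /\ j = n) \/ (phi (outs d c q r) /\ dfirst (j + 1) n d).

Lemma evt_dend c q r o phi j n : evt (dend c q r o phi j n).
Proof.
apply: evt_or; apply: evt_and; [exact: evt_outs|exact: evt_cst|exact: evt_or_out|].
exact: evt_first.
Qed.

Lemma dep_dend c q r o phi j n : dep ([set Outcome c q r] `|` in_box (j + 1) n)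
  (dend c q r o phi j n).
Proof.
move=> d d' e.
have eo : outs d c q r = outs d' c q r by rewrite /outs e //; left.
case=> -[h1 h2]; [left|right]; rewrite -eo; split=> //.
by apply: dep_first h2; apply: agree_sub e => s; right.
Qed.

Lemma first_over (d : Omega) (i k : int) : k < i -> ~ dfirst i k d.
Proof. by move=> ki [[h _ _] _]; lia. Qed.

Lemma Pdend c q r o phi (j n : nat) : (j <= n)%N ->
  ~ in_box (j%:Z + 1) n%:Z (Outcome c q r) ->
  P (dend c q r o phi j%:Z n%:Z) = (n - j == 0)%N%:R * reaction_law ra rb ral rbe c o +
    P (fun d => phi (outs d c q r)) * Fs (n - j).
Proof.
move=> jn nin; case: (eqVneq j n) => [->|jn'].
  rewrite subnn eqxx mul1r (Fs0 Q) mulr0 addr0 -(Qout c q r).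
  by apply: Pr_ext => d; split=> [[[]|[_ /first_over]]//|h]; [case; lia|left].
rewrite subn_eq0 leqNgt ltn_neqAle jn' jn /= mul0r add0r.
rewrite -(Pfirst Qrefl 0 jn) !add0r.
rewrite -(@Pr_indep _ _ Qind [set Outcome c q r] (in_box (j%:Z + 1) n%:Z)).
- apply: Pr_ext => d; split=> [[[_ e]|]|] //; last by right.
  by move/eqP: jn'; lia.
- exact: evt_or_out.
- exact: evt_first.
- exact: dep_outs.
- exact: dep_first.
- by move=> s ->.
Qed.

Lemma first_of_left (n : nat) : (0 < n)%N ->
  P (fun d => dfirst 1 n%:Z d /\ velo d 1 = vleft) = (n == 1)%N%:R * ((1 - p) / 2).
Proof.
move=> n0; have E (d : Omega) : dfirst 1 n%:Z d /\ velo d 1 = vleft <->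
    n = 1%N /\ velo d 1 = vleft.
  split=> -[h1 h2]; split=> //.
    have [h _] := @firstL_left _ (xpos d) (velo d) (outs d) 1 n%:Z ltac:(lia) h2.
    by have := h h1; lia.
  by apply/(@firstL_left _ (xpos d) (velo d) (outs d) 1 n%:Z ltac:(lia) h2); lia.
rewrite (Pr_ext Q E); case: eqP => [->|n1].
  by rewrite mul1r -[RHS]/(velocity_law p vleft) -(Qvel 1); apply: Pr_ext => d; tauto.
by rewrite mul0r Pr_false // => d [].
Qed.

Lemma first_of_exitR (n : nat) : (0 < n)%N ->
  P (fun d => dfirst 1 n%:Z d /\ dexitR 1 n%:Z d) = 0.
Proof.
move=> n0; transitivity (P (fun _ => False)); last by apply: Pr_false => d.
apply: (Pr_ae Qgood).
- by apply: evt_and; [exact: evt_first|exact: evt_exitR].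
- exact: evt_cst.
move=> d [xlt xgen]; split=> // -[[f _] e].
by apply: (exitR_exitL xlt _ e _ _ f); lia.
Qed.

(** The first exit is j if j survives the meeting; if both arrows disappear, which has probability 1
    - ra - rb, it is the first exit after j. *)
Lemma first_of_meet (j n : nat) : (0 < n)%N -> (j <= n)%N ->
  P (fun d => dfirst 1 n%:Z d /\ fateC j%:Z d) =
  Ls j * ((n - j == 0)%N%:R * (ra / 2) + (1 - ra - rb) * Fs (n - j)).
Proof.
move=> n0 jn; case: (posnP j) => [->|j0].
  by rewrite (Ls0 Q) mul0r Pr_false // => d [_ [/meet_range]].
pose phi (o : outcome) := (o <> Some vleft /\ o <> Some vright) /\ o <> Some vzero.
have eo : P (fun d => phi (outs d RightLeft (Initial 1) (Initial j%:Z))) = 1 - ra - rb.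
  by rewrite (Pout_neq3 Qgood Qout) //=; field.
rewrite -eo -[ra / 2]/(reaction_law ra rb ral rbe RightLeft (Some vleft)).
have nin : ~ in_box (j%:Z + 1) n%:Z (Outcome RightLeft (Initial 1) (Initial j%:Z)).
  by rewrite /= /within /= => -[[? ? ?] [? ? ?]]; lia.
rewrite -(Pdend (Some vleft) phi jn nin).
rewrite -(@Pr_indep _ _ Qind (meet_support 1 j%:Z)
  ([set Outcome RightLeft (Initial 1) (Initial j%:Z)] `|` in_box (j%:Z + 1) n%:Z)) //.
- apply: (Pr_ae Qgood).
  + by apply: evt_and; [exact: evt_first|exact: evt_fateC].
  + by apply: evt_and; [exact: evt_meet|exact: evt_dend].
  move=> d [xlt xgen]; rewrite /fateC /dend.
  have key : dmeet 1 j%:Z d ->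
      outs d RightLeft (Initial 1) (Initial j%:Z) <> Some vright ->
      outs d RightLeft (Initial 1) (Initial j%:Z) <> Some vzero ->
      dfirst 1 n%:Z d <-> (outs d RightLeft (Initial 1) (Initial j%:Z) = Some vleft /\ j%:Z = n%:Z) \/
      (outs d RightLeft (Initial 1) (Initial j%:Z) <> Some vleft /\ dfirst (j%:Z + 1) n%:Z d).
    move=> mj nr nz; have j1 := meet_range mj.
    case: (pselect (outs d RightLeft (Initial 1) (Initial j%:Z) = Some vleft)) => ol.
      have fj : dfirst 1 j%:Z d.
        split; first by apply: (exit_met xlt xgen (n := n%:Z) mj j1 _ ol); lia.
        by move=> m m1 mj'; apply: (no_exit_meet xlt (n := n%:Z) mj j1 _ m1 mj'); lia.
      split=> [f|[[_ e]|[]]] //; last by rewrite -e.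
      by left; split=> //; exact: firstL_unique fj f.
    have fc : dfirst 1 n%:Z d <-> j%:Z < n%:Z /\ dfirst (j%:Z + 1) n%:Z d.
      apply: firstL_cleared; first by lia.
        by move=> k jk kn; apply: (exit_annihilated xlt xgen mj j1 jk kn).
      move=> k k1 kj kn; case: (eqVneq k j%:Z) => [->|ne].
        by apply: (no_exit_met xlt (n := n%:Z) mj j1 _ ol); lia.
      by apply: (no_exit_meet xlt (n := n%:Z) mj j1 _ k1); lia.
    split=> [/fc[_ f]|[[/ol]|[_ f]]] //; first by right.
    by apply/fc; split=> //; move: f => [[h _ _] _]; lia.
  rewrite /phi; split=> [[f [mj [nr nz]]]|[mj h]].
    by move: f => /(key mj nr nz); split=> //; tauto.
  have [nr nz] : outs d RightLeft (Initial 1) (Initial j%:Z) <> Some vright /\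
      outs d RightLeft (Initial 1) (Initial j%:Z) <> Some vzero.
    by case: h => [[-> _]|[]] //; tauto.
  by split=> //; apply/(key mj nr nz); tauto.
- exact: evt_meet.
- exact: evt_dend.
- by apply: dep_meet; lia.
- exact: dep_dend.
move=> s [is_ ne] [e|h]; first exact: ne.
by apply: in_box_disjoint is_ h; lia.
Qed.

End Model.

Section Model.
Variable R : realType.
Notation Omega := (Omega R).
Variable Q : probability Omega R.
Variables ra rb ral rbe p : R.
Hypothesis Qind : forall J E, uniq J ->
  (forall s, measurable (E s : set (measurableTypeR R))) ->
  Q (cylinder J E) = (\prod_(s <- J) Q [set d : Omega | E s (d s)])%E.
Hypothesis Qgood : {ae Q, forall d, good d}.
Hypothesis Qrefl : forall c (A : set Omega), measurable A -> Q (reflect c @^-1` A) = Q A.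
Notation P := (Pr Q).
Hypothesis Qvel : forall k u, P (fun d => velo d k = u) = velocity_law p u.
Hypothesis Qout : forall c q r o, P (fun d => outs d c q r = o) =
  reaction_law ra rb ral rbe c o.
Notation Fs := (Fs Q).
Notation Gs := (Gs Q).
Notation Ls := (Ls Q).
Notation Bs := (Bs Q).
Notation Ys := (Ys Q).

Notation Us := (Us Q).
Notation Ul := (Ul Q).




(** Sum over the arrow, k places beyond the blockade, that does not leave it standing;
    [firstL_blocked] gives the two continuations. *)
Lemma first_of_block (t n : nat) : (t <= n)%N ->
  P (fun d => dfirst 1 n%:Z d /\ dblock (bk 1 t%:Z) d) = Bs t *
    \sum_(0 <= k < (n - t).+1) Ys k *
      ((n - t - k == 0)%N%:R * ral + (1 - ral - rbe) * Fs (n - t - k)).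
Proof.
move=> tn; case: (posnP t) => [->|t0].
  by rewrite (Bs0 Q) mul0r Pr_false // => d [_]; exact: bk_false.
set b := bk 1 t%:Z; have lb : lo b = 1 by rewrite lo_bk.
have hb : hi b = t%:Z by rewrite hi_bk.
have lh : lo b <= hi b by lia.
pose phi (o : outcome) := o <> Some vleft /\ o <> Some vzero.
pose E (k : nat) (d : Omega) := (dblock b d /\ dreachL b (hi b + k%:Z) d) /\
  dend BlockLeft b (Initial (hi b + k%:Z)) (Some vleft) phi (hi b + k%:Z) n%:Z d.
have mX : evt (fun d : Omega => dfirst 1 n%:Z d /\ dblock b d).
  by apply: evt_and; [exact: evt_first|exact: evt_block].
have mE k : evt (E k).
  apply: evt_and; last exact: evt_dend.
  by apply: evt_and; [exact: evt_block|exact: evt_reachL].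
have Eout k d : E k d -> outs d BlockLeft b (Initial (hi b + k%:Z)) <> Some vzero.
  by case=> _ [[-> _]|[[_ h] _]].
rewrite (@Pr_partition _ _ Qgood _ (index_iota 0 (n - t).+1) E) ?iota_uniq //; first last.
- move=> d i j [xlt xgen] _ _ ei ej; have zi := Eout _ _ ei; have zj := Eout _ _ ej.
  case: ei => -[_ ri] _; case: ej => -[_ rj] _.
  have h1 := reachL_range ri; have h2 := reachL_range rj.
  by have := killer_unique_right h1 h2 ri rj zi zj; lia.
- move=> d [xlt xgen].
  have key : dblock b d -> dfirst 1 n%:Z d <-> exists k : int, [/\ hi b < k, k <= n%:Z, dreachL b k d &
    outs d BlockLeft b (Initial k) = Some vleft /\ k = n%:Z \/
    [/\ outs d BlockLeft b (Initial k) <> Some vleft,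
        outs d BlockLeft b (Initial k) <> Some vzero, k < n%:Z & dfirst (k + 1) n%:Z d]].
    move=> bb; apply: (firstL_blocked xlt xgen); first by lia.
      by move=> k tk kn; apply: (exit_edge xlt xgen bb lh lb tk kn).
    by move=> k k1 kt kn; apply: (no_exit_edge xlt (n := n%:Z) bb lh lb _ k1 kt); lia.
  split=> [[f bb]|[k kin [[bb rk] h]]].
    have [k [k1 k2 rk h]] := (key bb).1 f.
    have ek : k = hi b + (absz (k - hi b))%:Z by lia.
    exists (absz (k - hi b)); first by rewrite mem_index_iota; lia.
    rewrite /E /dend -ek; split=> //; case: h => [|[h1 h2 _ h3]]; by [left|right].
  split=> //; apply/(key bb); exists (hi b + k%:Z); split=> //.
  + exact: reachL_range rk.
  + by move: kin; rewrite mem_index_iota; lia.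
  case: h => [h|[[h1 h2] h3]]; [by left|right; split=> //].
  by case: h3 => -[h _ _] _; lia.
rewrite mulr_sumr !big_seq; apply: eq_bigr => k; rewrite mem_index_iota => /andP[_ kn].
case: k kn => [|k] kn.
  rewrite (Ys0 Q) mul0r mulr0; apply: Pr_false => d [[_ /reachL_range]].
  lia.
have tk : hi b + k.+1%:Z = (t + k.+1)%N%:Z by lia.
rewrite (@Pr_indep _ _ Qind (in_box (lo b) (hi b) `|` (in_box (hi b + 1) (hi b + k.+1%:Z) `|`
   outcomesL b (hi b + k.+1%:Z)))
  ([set Outcome BlockLeft b (Initial (hi b + k.+1%:Z))] `|` in_box (hi b + k.+1%:Z + 1) n%:Z)).
- rewrite (Pr_reachL Qind Qgood Qrefl Qout k.+1 (evt_block b) (block_left_of lh)).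
  rewrite -mulrA; congr (_ * (_ * _)); rewrite tk (@Pdend _ _ _ _ _ _ Qind Qrefl Qout).
  + by rewrite (Pout_neq2 Qgood Qout) // subnDA.
  + by lia.
  by rewrite /= /within /= => -[[? ? ?] [? ? ?]]; lia.
- by apply: evt_and; [exact: evt_block|exact: evt_reachL].
- exact: evt_dend.
- apply: dep_and; first by apply: dep_sub (dep_block lh); exact: subsetUl.
  by apply: dep_sub (@dep_reachL _ _ _); exact: subsetUr.
- exact: dep_dend.
move=> s [ns|[bs|os]] [es|fs].
- by move: ns; rewrite es /= /within /= => -[_ [? ? ?]]; lia.
- by apply: in_box_disjoint ns fs; lia.
- by move: bs; rewrite es /= /within /= => -[[? ? ?] _]; lia.
- by apply: in_box_disjoint bs fs; lia.
- by move: os; rewrite es /=; lia.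
- by case: s os fs => // -[] // q [] //= l [-> [? ?]] [[? ? ?] _]; lia.
Qed.

End Model.

Section Model.
Variable R : realType.
Notation Omega := (Omega R).
Variable Q : probability Omega R.
Variables ra rb ral rbe p : R.
Hypothesis Qind : forall J E, uniq J ->
  (forall s, measurable (E s : set (measurableTypeR R))) ->
  Q (cylinder J E) = (\prod_(s <- J) Q [set d : Omega | E s (d s)])%E.
Hypothesis Qgood : {ae Q, forall d, good d}.
Hypothesis Qrefl : forall c (A : set Omega), measurable A -> Q (reflect c @^-1` A) = Q A.
Notation P := (Pr Q).
Hypothesis Qvel : forall k u, P (fun d => velo d k = u) = velocity_law p u.
Hypothesis Qout : forall c q r o, P (fun d => outs d c q r = o) =
  reaction_law ra rb ral rbe c o.
Notation Fs := (Fs Q).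
Notation Gs := (Gs Q).
Notation Ls := (Ls Q).
Notation Bs := (Bs Q).
Notation Ys := (Ys Q).

Notation Us := (Us Q).
Notation Ul := (Ul Q).





(** A left arrow arriving before arrow 1 also arrives before k, and [dreachL] for k records that b
    withstood it. *)
Lemma sooner_hits (d : Omega) (n : int) b k : good d -> dblock b d -> dreachR 1 b d ->
  dreachL b k d -> dsooner 1 b k d -> dhits n b d.
Proof.
move=> [xlt xgen] bb rb' rk sk; split=> // l _ [el _] ll; have [_ h] := rk.
apply: h => //; first by case: el; lia.
by rewrite -xlt; move: sk ll; rewrite /dsooner /dlater /sooner /later; lra.
Qed.

Lemma hits_sooner (d : Omega) (n : int) b k : good d -> dhits n b d -> k <= n ->
  dreachL b k d -> outs d BlockLeft b (Initial k) <> Some vzero -> dsooner 1 b k d.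
Proof.
move=> [xlt xgen] [bb rb' h] kn rk nz.
have [lh _] := blockade_lohi bb; have h1 := reachR_range rb'; have h2 := reachL_range rk.
have [h3 _] := @not_later _ _ xgen 1 b k h1 lh h2.
by apply: h3 => lk; apply: nz; exact: h.
Qed.

Section Hit.
Variables m w n : nat.
Hypothesis mwn : (m + w <= n)%N.
Let N := (n - (m + w))%N.
Notation b := (bw m w).
Let hb : hi b = m%:Z + w%:Z. Proof. by rewrite hi_bk. Qed.

Let sound (d : Omega) : dhits n%:Z b d -> lo b <= hi b /\ 1 < lo b.
Proof. by case=> bb rr _; have [] := blockade_lohi bb; have := reachR_range rr. Qed.

Let phi (o : outcome) := o <> Some vleft /\ o <> Some vzero.

(** Arrow 1 disappears and b stays, so b acts as in [first_of_block], restricted to arrow 1 arriving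
    before the arrow that ends b. *)
Lemma first_of_hit_blocked :
  P (fun d => (dfirst 1 n%:Z d /\ fateD n%:Z b d) /\
     outs d RightBlock (Initial 1) b = Some vzero) =
  \sum_(0 <= k < N.+1) Us m w k *
    (((N - k == 0)%N%:R * ral + (1 - ral - rbe) * Fs (N - k)) * rbe).
Proof.
pose E (k : nat) (d : Omega) := cores m w k d /\
  (dend BlockLeft b (Initial (hi b + k%:Z)) (Some vleft) phi (hi b + k%:Z) n%:Z d /\
   outs d RightBlock (Initial 1) b = Some vzero).
have mX : evt (fun d : Omega => (dfirst 1 n%:Z d /\ fateD n%:Z b d) /\
     outs d RightBlock (Initial 1) b = Some vzero).
  by apply: evt_and; [apply: evt_and; [exact: evt_first|exact: evt_fateD]|exact: evt_outs].
have mD k : evt (fun d : Omega => dend BlockLeft b (Initial (hi b + k%:Z)) (Some vleft) phi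
     (hi b + k%:Z) n%:Z d /\ outs d RightBlock (Initial 1) b = Some vzero).
  by apply: evt_and; [exact: evt_dend|exact: evt_outs].
have mE k : evt (E k) by apply: evt_and; first exact: evt_cores.
have Eout k d : E k d -> outs d BlockLeft b (Initial (hi b + k%:Z)) <> Some vzero.
  by case=> _ [[[-> _]|[[_ h] _]] _].
rewrite (@Pr_partition _ _ Qgood _ (index_iota 0 N.+1) E) ?iota_uniq //; first last.
- move=> d i j [xlt xgen] _ _ ei ej; have zi := Eout _ _ ei; have zj := Eout _ _ ej.
  case: ei => -[[_ ri] _] _; case: ej => -[[_ rj] _] _.
  have h1 := reachL_range ri; have h2 := reachL_range rj.
  by have := killer_unique_right h1 h2 ri rj zi zj; lia.
- move=> d gd; have [xlt xgen] := gd.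
  have key : dhits n%:Z b d -> outs d RightBlock (Initial 1) b = Some vzero ->
    dfirst 1 n%:Z d <-> exists k : int, [/\ hi b < k, k <= n%:Z, dreachL b k d &
    outs d BlockLeft b (Initial k) = Some vleft /\ k = n%:Z \/
    [/\ outs d BlockLeft b (Initial k) <> Some vleft,
        outs d BlockLeft b (Initial k) <> Some vzero, k < n%:Z & dfirst (k + 1) n%:Z d]].
    move=> hd oz; have [lh l1] := sound hd; have /dhitsP hh := hd.
    apply: (firstL_blocked xlt xgen); first by lia.
      by move=> k tk kn; apply: (exit_hit_blocked xlt xgen hh lh l1 tk kn oz).
    move=> k k1 kt kn; apply: (no_exit_hit xlt xgen hh lh l1 _ k1 kt); lia.
  split=> [[[f [hd _]] oz]|[k kin [[[[bb rr] rk] sk] [h oz]]]].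
    have [k [k1 k2 rk h]] := (key hd oz).1 f.
    have ek : k = hi b + (absz (k - hi b))%:Z by lia.
    exists (absz (k - hi b)); first by rewrite mem_index_iota; lia.
    have nz : outs d BlockLeft b (Initial k) <> Some vzero by case: h => [[-> _]|[]].
    have sk := hits_sooner gd hd k2 rk nz.
    rewrite /E /dend /cores /core -ek; have [bb rr _] := hd.
    split; first exact: (conj (conj (conj bb rr) rk) sk).
    split=> //; case: h => [|[h1 h2 _ h3]]; by [left|right].
  have hd := sooner_hits n%:Z gd bb rr rk sk.
  split=> //; split; last by split=> //; rewrite oz.
  apply/(key hd oz); exists (hi b + k%:Z); split=> //.
  + exact: reachL_range rk.
  + by move: kin; rewrite mem_index_iota; lia.
  case: h => [h|[[h1 h2] h3]]; [by left|right; split=> //].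
  by case: h3 => -[h _ _] _; lia.
rewrite !big_seq; apply: eq_bigr => k; rewrite mem_index_iota => /andP[_ kn].
have tk : hi b + k%:Z = (m + w + k)%N%:Z by lia.
have dD : dep ([set Outcome BlockLeft b (Initial (hi b + k%:Z))] `|` in_box (hi b + k%:Z + 1) n%:Z)
  (dend (R := R) BlockLeft b (Initial (hi b + k%:Z)) (Some vleft) phi (hi b + k%:Z) n%:Z).
  exact: dep_dend.
rewrite (@Pcores_after _ _ Qind m w k n) //; last first.
  apply: dep_and; last by apply: dep_outs_at (fun o => o = Some vzero) _ _; right; right.
  by apply: dep_sub dD => s [h|h]; [right; left|left].
case: (boolP ((m == 0)%N || (w == 0)%N)) => [z|].
  rewrite [Us m w k]Pr_false ?mul0r // => d [c _].
  by move: z c => /orP[] /eqP ->; [exact: core_m|exact: core_w].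
rewrite negb_or => /andP[m0 w0]; congr (_ * _).
rewrite (@Pr_indep _ _ Qind _ [set Outcome RightBlock (Initial 1) b] _ _ _ _ dD).
- rewrite Qout; congr (_ * _); rewrite tk (@Pdend _ _ _ _ _ _ Qind Qrefl Qout).
  + by rewrite (Pout_neq2 Qgood Qout) // /N subnDA.
  + by rewrite -/N in kn *; lia.
  by rewrite /= /within /= lo_bk hi_bk => -[[? ? ?] [? ? ?]]; lia.
- exact: evt_dend.
- exact: evt_outs.
- exact: (@dep_outs _ _ _ _ (fun o => o = Some vzero)).
move=> s [->|h] // e; move: h; rewrite e /= /within /= => -[[? ? ?] _]; lia.
Qed.


Let psi (o : outcome) := o <> Some vright /\ o <> Some vzero.

(** Arrow 1 and b disappear together. The first exit is counted by all arrows arriving after arrow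
    1, minus those whose predecessor also arrives after it. *)
Lemma first_of_hit_cleared :
  P (fun d => (dfirst 1 n%:Z d /\ fateD n%:Z b d) /\
     outs d RightBlock (Initial 1) b <> Some vzero) =
  (1 - ral - rbe) * (Us m w N - rbe * \sum_(0 <= k < N.+1) Us m w k * Fs (N - k)).
Proof.
pose A (d : Omega) := cores m w N d /\ psi (outs d RightBlock (Initial 1) b).
pose E (k : nat) (d : Omega) := cores m w k d /\
  ((outs d BlockLeft b (Initial (hi b + k%:Z)) = Some vzero /\
   psi (outs d RightBlock (Initial 1) b)) /\ dfirst (hi b + k%:Z + 1) n%:Z d).
pose X (d : Omega) := (dfirst 1 n%:Z d /\ fateD n%:Z b d) /\
     outs d RightBlock (Initial 1) b <> Some vzero.
have mX : evt X.
  by apply: evt_and; [apply: evt_and; [exact: evt_first|exact: evt_fateD]|exact: evt_outs_neq].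
have mA : evt A by apply: evt_and; [exact: evt_cores|exact: evt_or_out].
have mK k : evt (fun d : Omega => (outs d BlockLeft b (Initial (hi b + k%:Z)) = Some vzero /\
   psi (outs d RightBlock (Initial 1) b)) /\ dfirst (hi b + k%:Z + 1) n%:Z d).
  apply: evt_and; last exact: evt_first.
  by apply: evt_and; [exact: evt_outs|exact: evt_or_out].
have mE k : evt (E k) by apply: evt_and; first exact: evt_cores.
have mB : evt (fun d => exists2 k, k \in index_iota 0 N.+1 & E k d) by exact: evt_exists_in.
have hN : hi b + N%:Z = n%:Z by rewrite hb /N; lia.
have EA d k : good d -> E k d -> A d.
  move=> [xlt xgen] [[[[bb rr] rk] sk] [[oz pz] f]].
  have kn : hi b + k%:Z < n%:Z by case: f => -[h _ _] _; lia.
  rewrite /A /cores /core hN; split=> //; split.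
    split=> //; apply/(reachL_renewal _ _ xlt xgen); right; exists (hi b + k%:Z); split=> //.
    exact: reachL_range rk.
  by move: sk kn; rewrite /dsooner /sooner -xlt; lra.
have key (d : Omega) : good d -> dhits n%:Z b d -> psi (outs d RightBlock (Initial 1) b) ->
    dfirst 1 n%:Z d <-> [/\ hi b < n%:Z, dreachL b n%:Z d, dsooner 1 b n%:Z d &
    ~ exists k, [/\ hi b < k, k < n%:Z, dreachL b k d &
        [/\ dsooner 1 b k d, outs d BlockLeft b (Initial k) = Some vzero & dfirst (k + 1) n%:Z d]]].
  move=> [xlt xgen] hd [nr nz]; have [lh l1] := sound hd; have /dhitsP hh := hd.
  by apply: (firstL_hit_cleared xlt xgen hh lh l1 _ nz nr); lia.
have eA : P A = P X + P (fun d => exists2 k, k \in index_iota 0 N.+1 & E k d).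
  rewrite -(Pr_or Qgood) //; last first.
    move=> d gd [[f [hd nr]] nz] [k kin [[[[bb rr] rk] sk] [[oz pz] fk]]].
    have [_ _ _] := (key d gd hd (conj nr nz)).1 f; apply; exists (hi b + k%:Z); split=> //.
      exact: reachL_range rk.
    by case: fk => -[h _ _] _; lia.
  apply: (Pr_ae Qgood) => //; first exact: evt_or.
  move=> d gd; split=> [a|[[[f [hd nr]] nz]|[k kin /(EA d k gd)]]] //; last first.
    have [h1 h2 h3 _] := (key d gd hd (conj nr nz)).1 f; have [bb rr _] := hd.
    by rewrite /A /cores /core hN; exact: (conj (conj (conj (conj bb rr) h2) h3) (conj nr nz)).
  case: (pselect (exists2 k, k \in index_iota 0 N.+1 & E k d)) => [|ne]; [by right|left].
  move: a; rewrite /A /cores /core hN => -[[[[bb rr] rn] sn] [nr nz]].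
  have hd := sooner_hits n%:Z gd bb rr rn sn.
  split=> //; split=> //; apply/(key d gd hd (conj nr nz)); split=> //.
    exact: reachL_range rn.
  move=> [k [k1 k2 rk [sk oz fk]]]; apply: ne.
  have ek : k = hi b + (absz (k - hi b))%:Z by lia.
  exists (absz (k - hi b)); first by rewrite mem_index_iota /N; lia.
  rewrite /E /cores /core -ek.
  exact: (conj (conj (conj (conj bb rr) rk) sk) (conj (conj oz (conj nr nz)) fk)).
have eB : P (fun d => exists2 k, k \in index_iota 0 N.+1 & E k d) =
    \sum_(0 <= k < N.+1) P (E k).
  apply: (Pr_partition Qgood); rewrite ?iota_uniq // => d i j [xlt xgen] _ _
    [[[_ r1] _] [_ f1]] [[[_ r2] _] [_ f2]].
  have h1 := reachL_range r1; have h2 := reachL_range r2.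
  have g1 : hi b + i%:Z < n%:Z by case: f1 => -[h _ _] _; lia.
  have g2 : hi b + j%:Z < n%:Z by case: f2 => -[h _ _] _; lia.
  by have := predecessor_unique xlt xgen h1 g1 h2 g2 r1 r2 f1 f2; lia.
have -> : P X = P A - P (fun d => exists2 k, k \in index_iota 0 N.+1 & E k d) by rewrite eA addrK.
rewrite eB /A (@Pcores_after _ _ Qind m w N n); first last.
- by apply: dep_outs_at; right; right.
- exact: evt_or_out.
rewrite (Pout_neq2 Qgood Qout) //= [RHS]mulrBr [in RHS]mulrA mulr_sumr [Us m w N * _]mulrC.
congr (_ - _); rewrite !big_seq; apply: eq_bigr => k; rewrite mem_index_iota => /andP[_ kn].
rewrite (@Pcores_after _ _ Qind m w k n) //; last first.
  exact: (@dep_outs2_first _ m w k n (fun o => o = Some vzero) psi).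
rewrite (Pouts2_first Qind Qrefl (fun o => o = Some vzero) psi); last by rewrite /N in kn *; lia.
rewrite Qout (Pout_neq2 Qgood Qout) //= /N subnDA; ring.
Qed.

End Hit.
End Model.

(** * Total probability over the fates of particle 1 *)

Section Model.
Variable R : realType.
Notation Omega := (Omega R).
Variable Q : probability Omega R.
Variables ra rb ral rbe p : R.
Hypothesis Qind : forall J E, uniq J ->
  (forall s, measurable (E s : set (measurableTypeR R))) ->
  Q (cylinder J E) = (\prod_(s <- J) Q [set d : Omega | E s (d s)])%E.
Hypothesis Qgood : {ae Q, forall d, good d}.
Hypothesis Qrefl : forall c (A : set Omega), measurable A -> Q (reflect c @^-1` A) = Q A.
Notation P := (Pr Q).
Hypothesis Qvel : forall k u, P (fun d => velo d k = u) = velocity_law p u.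
Hypothesis Qout : forall c q r o, P (fun d => outs d c q r = o) =
  reaction_law ra rb ral rbe c o.
Notation Fs := (Fs Q).
Notation Gs := (Gs Q).
Notation Ls := (Ls Q).
Notation Bs := (Bs Q).
Notation Ys := (Ys Q).

Notation Us := (Us Q).
Notation Ul := (Ul Q).






(** Labels of three kinds of fate: a blockade with hull [1, t], removal by the left arrow j, removal
    at the blockade [bw m w]. *)
Definition fate_index : Type := nat + (nat + nat * nat).
HB.instance Definition _ := Equality.on fate_index.

Definition fate_event (n : nat) (i : fate_index) (d : Omega) : Prop :=
  match i with
  | inl t => dblock (bk 1 t%:Z) d
  | inr (inl j) => fateC j%:Z d
  | inr (inr (m, w)) => fateD n%:Z (bw m w) d
  end.

Definition fate_ok (n : nat) (i : fate_index) : bool :=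
  match i with
  | inl t => (t <= n)%N
  | inr (inl j) => (j <= n)%N
  | inr (inr (m, w)) => (m + w <= n)%N
  end.

Definition fate_killer (i : fate_index) : particle :=
  match i with
  | inl t => Initial t%:Z
  | inr (inl j) => Initial j%:Z
  | inr (inr (m, w)) => bw m w
  end.

Lemma evt_fate n i : evt (fate_event n i).
Proof. by case: i => [t|[j|[m w]]]; [exact: evt_block|exact: evt_fateC|exact: evt_fateD]. Qed.

Lemma fate_vel n i d : fate_event n i d -> velo d 1 = vright \/ (velo d 1 = vzero /\ i = inl 1%N).
Proof.
case: i => [t|[j|[m w]]] /=.
- by move/block1_vel => [[-> e]|]; [right; split=> //; congr inl; lia|left].
- by move=> [[-> _ _] _]; left.
- by move=> [[_ [[_ -> _] _] _] _]; left.
Qed.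

Lemma fate_killerP (n : nat) i d : good d -> (0 < n)%N -> fate_ok n i -> velo d 1 = vright ->
  fate_event n i d -> killer d n%:Z (fate_killer i) /\
  velocity_of (boxed 1 n%:Z (velo d)) (fate_killer i) =
    if i is inr (inr _) then vzero else vleft.
Proof.
move=> gd n0 ok v1; have [xlt xgen] := gd.
have mv (j : nat) : (j <= n)%N -> dmeet 1 j%:Z d ->
    velocity_of (boxed 1 n%:Z (velo d)) (Initial j%:Z) = vleft.
  move=> jn mj; have j1 := meet_range mj; rewrite /= boxed_in; [|lia|lia].
  by case: mj.
case: i ok => [t|[j|[m w]]] /= ok.
- move=> h; have k := @block1_killer _ d n%:Z gd t%:Z h ltac:(lia) v1.
  split=> //; apply: mv => //; move: h; rewrite /bk; case: eqP => [_|_ []] //.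
  by rewrite /dblock /= v1.
- move=> [mj [nr nz]]; split; last exact: mv.
  by apply: (killer_meet gd mj) => //; lia.
- move=> [hh nr]; apply: (killer_hit gd _ hh _ nr); first by lia.
  by rewrite hi_bk; lia.
Qed.

(** A right arrow has a single killer, and when this is a left arrow the outcome tells whether a
    blockade arises. *)
Lemma fate_uniq (n : nat) i j d : good d -> (0 < n)%N -> fate_ok n i -> fate_ok n j ->
  fate_event n i d -> fate_event n j d -> i = j.
Proof.
move=> gd n0 oi oj ei ej; have [xlt xgen] := gd.
case: (fate_vel ei) => [v1|[v1 ->]]; last first.
  by case: (fate_vel ej) => [|[_ ->]] //; rewrite v1.
have [ki vi] := fate_killerP gd n0 oi v1 ei.
have [kj vj] := fate_killerP gd n0 oj v1 ej.
have e := killer_uniq gd v1 ki kj.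
have {vi vj} : (if i is inr (inr _) then vzero else vleft) =
    (if j is inr (inr _) then vzero else vleft) by rewrite -vi -vj e.
have tj (t k : nat) : dblock (bk 1 t%:Z) d -> fateC k%:Z d -> Initial t%:Z = Initial k%:Z -> False.
  move=> + [mk [_ nz]] [tk]; have := meet_range mk; rewrite /bk; case: eqP => [|_ k1 []]; first by lia.
  by rewrite tk => _ /nz.
move: i j oi oj ei ej ki kj e => [t|[k|[m w]]] [t'|[k'|[m' w']]] //= oi oj ei ej ki kj e _.
- by case: e => e; congr inl; lia.
- by case: (tj _ _ ei ej e).
- by case: (tj _ _ ej ei (esym e)).
- by case: e => e; congr (inr (inl _)); lia.
have el := congr1 lo e; have eh := congr1 hi e; move: el eh; rewrite !lo_bk !hi_bk => el eh.
by congr (inr (inr (_, _))); lia.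
Qed.

Definition pairs (n : nat) : seq (nat * nat) :=
  [seq (m, w) | m <- index_iota 0 n.+1, w <- index_iota 0 (n - m).+1].

Lemma mem_pairs n m w : ((m, w) \in pairs n) = (m + w <= n)%N.
Proof.
apply/flatten_mapP/idP => [[m' mn /mapP[w' wn [-> ->]]]|mw].
  by move: mn wn; rewrite !mem_index_iota; lia.
exists m; first by rewrite mem_index_iota; lia.
by apply: map_f; rewrite mem_index_iota; lia.
Qed.

Lemma uniq_pairs n : uniq (pairs n).
Proof.
apply: allpairs_uniq_dep; first exact: iota_uniq.
  by move=> m _; exact: iota_uniq.
by move=> [m w] [m' w'] _ _ /= [-> ->].
Qed.

Definition fate_seq (n : nat) : seq fate_index :=
  map inl (index_iota 0 n.+1) ++ map inr (map inl (index_iota 0 n.+1) ++ map inr (pairs n)).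

Lemma mem_inl (A B : eqType) (a : A) (s : seq A) (t : seq B) :
  ((inl a : A + B) \in map inl s ++ map inr t) = (a \in s).
Proof.
rewrite mem_cat mem_map; last by move=> ? ? [].
by rewrite orbC; case: mapP => // -[].
Qed.

Lemma mem_inr (A B : eqType) (b : B) (s : seq A) (t : seq B) :
  ((inr b : A + B) \in map inl s ++ map inr t) = (b \in t).
Proof.
rewrite mem_cat [X in _ || X]mem_map; last by move=> ? ? [].
by case: mapP => // -[].
Qed.

Lemma uniq_sum (A B : eqType) (s : seq A) (t : seq B) :
  uniq (map inl s ++ map inr t : seq (A + B)) = uniq s && uniq t.
Proof.
rewrite cat_uniq !map_inj_uniq; [|by move=> ? ? []|by move=> ? ? []].
by rewrite (_ : has _ _ = false) //; apply/negbTE/hasPn => ? /mapP[? _ ->]; apply/mapP => -[].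
Qed.

Lemma mem_fate_seq n i : i \in fate_seq n = fate_ok n i.
Proof.
rewrite /fate_seq; case: i => [t|[j|[m w]]].
- by rewrite mem_inl mem_index_iota ltnS.
- by rewrite mem_inr mem_inl mem_index_iota ltnS.
by rewrite mem_inr mem_inr mem_pairs.
Qed.

Lemma uniq_fate_seq n : uniq (fate_seq n).
Proof. by rewrite !uniq_sum !iota_uniq uniq_pairs. Qed.

(** Used for the sure event in [fate_total] and for the first exit at n in [first_total]. *)
Lemma fate_split (n : nat) (phi : Omega -> Prop) : evt phi -> (0 < n)%N ->
  P phi = P (fun d => phi d /\ velo d 1 = vleft) + (P (fun d => phi d /\ dexitR 1 n%:Z d) +
    (\sum_(0 <= t < n.+1) P (fun d => phi d /\ dblock (bk 1 t%:Z) d) +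
    (\sum_(0 <= j < n.+1) P (fun d => phi d /\ fateC j%:Z d) +
     \sum_(0 <= m < n.+1) \sum_(0 <= w < (n - m).+1)
       P (fun d => phi d /\ fateD n%:Z (bw m w) d)))).
Proof.
move=> mphi n0.
pose E i (d : Omega) := phi d /\ fate_event n i d.
have mE i : evt (E i) by apply: evt_and => //; exact: evt_fate.
have mX : evt (fun d => exists2 i, i \in fate_seq n & E i d) by exact: evt_exists_in.
have mL : evt (fun d => phi d /\ velo d 1 = vleft) by apply: evt_and => //; exact: evt_velo.
have mR : evt (fun d => phi d /\ dexitR 1 n%:Z d) by apply: evt_and => //; exact: evt_exitR.
transitivity (P (fun d => (phi d /\ velo d 1 = vleft) \/ ((phi d /\ dexitR 1 n%:Z d) \/
    exists2 i, i \in fate_seq n & E i d))).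
  apply: (Pr_ae Qgood) => //; first by apply: evt_or => //; exact: evt_or.
  move=> d gd; split; last by case=> [[]|[[]|[i _ []]]].
  move=> pd; have n1 : 1 <= n%:Z by lia.
  have [|[|[[t tn h]|[[j jn h]|[[m w] mwn [hn h]]]]]] := fate_cover gd n1.
  - by left.
  - by right; left.
  - right; right; exists (inl t) => //; rewrite mem_fate_seq /=.
    by move: tn; rewrite mem_index_iota; lia.
  - right; right; exists (inr (inl j)) => //; rewrite mem_fate_seq /=.
    by move: jn; rewrite mem_index_iota; lia.
  right; right; exists (inr (inr (m, w))) => //; rewrite mem_fate_seq /=.
  by move: hn; rewrite /= hi_bk; lia.
have exR (d : Omega) : dexitR 1 n%:Z d -> velo d 1 = vright by case.
rewrite (Pr_or Qgood) //; [|exact: evt_or|]; last first.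
  move=> d gd [_ v1] [[_ /exR]|[i _ [_ /fate_vel]]]; rewrite v1 //.
  by case=> // -[].
rewrite (Pr_or Qgood) //; last first.
  move=> d gd [_ e] [i]; rewrite mem_fate_seq => oi [_ ei]; have v1 := exR d e.
  have [k _] := fate_killerP gd n0 oi v1 ei.
  by move: e => /(exitR_killer (n := n%:Z) ltac:(lia) v1) h; exact: h k.
congr (_ + (_ + _)).
rewrite (@Pr_partition _ _ Qgood _ (fate_seq n) E) ?uniq_fate_seq //; last first.
  move=> d i j gd; rewrite !mem_fate_seq => oi oj [_ ei] [_ ej].
  exact: fate_uniq gd n0 oi oj ei ej.
rewrite /fate_seq [LHS]big_cat; congr (_ + _); first by rewrite [LHS]big_map.
rewrite [LHS]big_map [LHS]big_cat; congr (_ + _); first by rewrite [LHS]big_map.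
by rewrite [LHS]big_map [LHS]big_allpairs_dep.
Qed.

End Model.

(** * Convolutions and the two balance equations *)

Section Convolution.
Variable R : comPzRingType.
Implicit Types u v : nat -> R.

Definition conv u v (n : nat) : R := \sum_(0 <= k < n.+1) u k * v (n - k)%N.

(** In the application w is the width of the hull of a blockade, m and k are the numbers of
    particles on its two sides, and v receives the rest of the box. *)
Definition conv3 (h : nat -> nat -> nat -> R) v (n : nat) : R :=
  \sum_(0 <= m < n.+1) \sum_(0 <= w < (n - m).+1) \sum_(0 <= k < (n - (m + w)).+1)
    h m w k * v (n - (m + w) - k)%N.

Lemma sum_triangle (f : nat -> R) m n : (m <= n)%N ->
  \sum_(0 <= w < (n - m).+1) f w = \sum_(0 <= w < n.+1) if (m + w <= n)%N then f w else 0.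
Proof.
move=> mn; rewrite (big_nat_widen _ _ n.+1) ?ltnS ?leq_subr // big_mkcond /=.
by apply: eq_bigr => w _; rewrite ltnS leq_subRL.
Qed.

Lemma conv3E h v n : conv3 h v n = \sum_(0 <= m < n.+1) \sum_(0 <= w < n.+1)
  \sum_(0 <= k < n.+1) if (m + w + k <= n)%N then h m w k * v (n - (m + w + k))%N else 0.
Proof.
rewrite /conv3 big_nat [RHS]big_nat; apply: eq_bigr => m; rewrite ltnS => /andP[_ mn].
rewrite sum_triangle //; apply: eq_bigr => w _; case: ifP => mw; last first.
  rewrite big1 // => k _; case: ifP => // mwk.
  by move/negP: mw; case; apply: leq_trans mwk; exact: leq_addr.
rewrite sum_triangle //; apply: eq_bigr => k _.
by rewrite -subnDA.
Qed.

Lemma conv3_flip h v n : conv3 h v n = conv3 (fun m w k => h k w m) v n.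
Proof.
rewrite !conv3E exchange_big /=.
under eq_bigr => w _ do rewrite exchange_big /=.
rewrite [LHS]exchange_big /=; apply: eq_bigr => k _; apply: eq_bigr => w _.
by apply: eq_bigr => m _; rewrite (_ : m + w + k = k + w + m)%N //; lia.
Qed.

Lemma conv3_prod u1 u2 u3 v n :
  conv3 (fun m w k => u1 m * (u2 w * u3 k)) v n = conv u1 (conv u2 (conv u3 v)) n.
Proof.
rewrite /conv3 /conv; apply: eq_bigr => m _; rewrite mulr_sumr; apply: eq_bigr => w _.
rewrite mulr_sumr mulr_sumr subnDA; apply: eq_bigr => k _; ring.
Qed.

Lemma conv3_add h h' v n :
  conv3 (fun m w k => h m w k + h' m w k) v n = conv3 h v n + conv3 h' v n.
Proof.
rewrite /conv3 -big_split; apply: eq_bigr => m _; rewrite -big_split; apply: eq_bigr => w _.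
by rewrite -big_split; apply: eq_bigr => k _; rewrite mulrDl.
Qed.

Lemma eq_conv3 h h' v n : (forall m w k, h m w k = h' m w k) -> conv3 h v n = conv3 h' v n.
Proof. by move=> e; do 3 (apply: eq_bigr => ? _); rewrite e. Qed.

Definition delta (n : nat) : R := (n == 0)%N%:R.

Lemma sum_delta (f : nat -> R) n : \sum_(0 <= k < n.+1) f k * delta (n - k) = f n.
Proof.
rewrite big_nat_recr //= subnn mulr1 big_nat big1 ?add0r // => k /andP[_ kn].
by rewrite /delta subn_eq0 leqNgt kn mulr0.
Qed.

End Convolution.

Section Model.
Variable R : realType.
Notation Omega := (Omega R).
Variable Q : probability Omega R.
Variables ra rb ral rbe p : R.
Hypothesis Qind : forall J E, uniq J ->
  (forall s, measurable (E s : set (measurableTypeR R))) ->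
  Q (cylinder J E) = (\prod_(s <- J) Q [set d : Omega | E s (d s)])%E.
Hypothesis Qgood : {ae Q, forall d, good d}.
Hypothesis Qrefl : forall c (A : set Omega), measurable A -> Q (reflect c @^-1` A) = Q A.
Notation P := (Pr Q).
Hypothesis Qvel : forall k u, P (fun d => velo d k = u) = velocity_law p u.
Hypothesis Qout : forall c q r o, P (fun d => outs d c q r = o) =
  reaction_law ra rb ral rbe c o.
Notation Fs := (Fs Q).
Notation Gs := (Gs Q).
Notation Ls := (Ls Q).
Notation Bs := (Bs Q).
Notation Ys := (Ys Q).

Notation Us := (Us Q).
Notation Ul := (Ul Q).







(** Summation over all sizes symmetrises in m and k, so by reflection each order of arrival carries
    half of the product. *)
Lemma conv3_half (v : nat -> R) n : conv3 Us v n + conv3 Us v n = conv Ys (conv Bs (conv Ys v)) n.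
Proof.
rewrite {2}conv3_flip -conv3_prod -conv3_add; apply: eq_conv3 => m w k.
by rewrite (@Us_flip _ Q Qrefl k) (Us_Ul Qind Qgood Qrefl Qout).
Qed.

Lemma conv3_Ul (v : nat -> R) n : conv3 Ul v n = conv3 Us v n.
Proof.
rewrite [RHS]conv3_flip; apply: eq_conv3 => m w k.
by rewrite (@Us_flip _ Q Qrefl k).
Qed.

(** Leaving on the right has probability [Gs n] by reflection. Removal at a blockade is [Phits_out],
    whose sums over [Ul] are evaluated by [conv3_half]. *)
Lemma fate_total n : (0 < n)%N -> 1 = (1 - p) / 2 + (Gs n + (conv Bs (fun _ => 1) n +
  ((1 - ra / 2 - rb) * conv Ls (fun _ => 1) n +
  (1 - ral) * (conv Ys (conv Bs (fun _ => 1)) n -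
     (1 - rbe) / 2 * conv Ys (conv Bs (conv Ys (fun _ => 1))) n)))).
Proof.
move=> n0; rewrite -conv3_half -[LHS](@Pr_true _ Q (fun _ => True)) //.
have T phi : P (fun d : Omega => True /\ phi d) = P phi by apply: Pr_ext => d; tauto.
rewrite (fate_split Qgood (@evt_cst R True) n0) !T; congr (_ + (_ + (_ + (_ + _)))).
- by rewrite Qvel.
- exact: Pr_exitR.
- by apply: eq_bigr => t _; rewrite T mulr1.
- rewrite /conv mulr_sumr; apply: eq_bigr => j _; rewrite T mulr1 mulrC.
  case: j => [|j]; first by rewrite (Ls0 Q) mul0r; apply: Pr_false => d [/meet_range].
  rewrite (@Pmeet_out _ _ Qind 1 j.+1%:Z (fun o => o <> Some vright /\ o <> Some vzero)) //.
    by rewrite (Pout_neq2 Qgood Qout).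
  by apply: evt_and; exact: evt_outs_neq.
transitivity ((1 - ral) * (conv Ys (conv Bs (fun _ => 1)) n - (1 - rbe) * conv3 Ul (fun _ => 1) n)).
  rewrite /conv /conv3 [X in _ * (_ - X)]mulr_sumr -sumrB mulr_sumr.
  rewrite !big_nat; apply: eq_bigr => m; rewrite ltnS => /andP[_ mn].
  rewrite mulr_sumr [X in _ * (_ - X)]mulr_sumr -sumrB mulr_sumr.
  rewrite !big_nat; apply: eq_bigr => w; rewrite ltnS => /andP[_ wn].
  rewrite T (Phits_out Qind Qgood Qrefl Qout) ?mulr1; last by lia.
  by congr (_ * (_ - _ * _)); apply: eq_bigr => k _; rewrite mulr1.
by rewrite conv3_Ul; congr (_ * (_ - _)); field.
Qed.

Lemma first_total n : Fs n = (n == 1)%N%:R * ((1 - p) / 2) +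
  (conv Bs (conv Ys (fun i => delta R i * ral + (1 - ral - rbe) * Fs i)) n +
  (conv Ls (fun i => delta R i * (ra / 2) + (1 - ra - rb) * Fs i) n +
  (1 - ral) * (1 - rbe) / 2 * conv Ys (conv Bs Ys) n)).
Proof.
case: (posnP n) => [->|n0].
  rewrite /conv !big_nat1 (Fs0 Q) (Bs0 Q) (Ls0 Q) (Ys0 Q) !mul0r; ring.
rewrite [LHS](fate_split Qgood (@evt_first _ _ _) n0) (first_of_exitR Qgood n0) add0r.
congr (_ + (_ + (_ + _))).
- exact: first_of_left.
- rewrite /conv !big_nat; apply: eq_bigr => t; rewrite ltnS => /andP[_ tn].
  exact: (first_of_block Qind Qgood Qrefl Qout tn).
- rewrite /conv !big_nat; apply: eq_bigr => j; rewrite ltnS => /andP[_ jn].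
  exact: (first_of_meet Qind Qgood Qrefl Qout n0 jn).
transitivity ((1 - ral) * (1 - rbe) * conv3 Us (delta R) n); last first.
  have <- : conv3 Us (delta R) n + conv3 Us (delta R) n = conv Ys (conv Bs Ys) n.
    rewrite conv3_half; apply: eq_bigr => m _; congr (_ * _); apply: eq_bigr => w _.
    by congr (_ * _); exact: sum_delta.
  by field.
rewrite /conv3 mulr_sumr !big_nat; apply: eq_bigr => m; rewrite ltnS => /andP[_ mn].
rewrite mulr_sumr !big_nat; apply: eq_bigr => w; rewrite ltnS => /andP[_ wn].
have mwn : (m + w <= n)%N by lia.
have mF : evt (fun d : Omega => dfirst 1 n%:Z d /\ fateD n%:Z (bw m w) d).
  by apply: evt_and; [exact: evt_first|exact: evt_fateD].
rewrite (Pr_split Qgood mF (evt_outs RightBlock (Initial 1) (bw m w) (Some vzero))).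
rewrite (first_of_hit_blocked Qind Qgood Qrefl Qout mwn).
rewrite (first_of_hit_cleared Qind Qgood Qrefl Qout mwn).
(* In the sum of the two hit cases the terms in [Fs] cancel, and ral rbe + (1 - ral - rbe) = (1 -
   ral) (1 - rbe) remains in front of [Us m w N]. *)
set N := (n - (m + w))%N; rewrite -(sum_delta (Us m w) N).
rewrite mulr_sumr -sumrB mulr_sumr -big_split mulr_sumr; apply: eq_bigr => k _ /=.
rewrite /delta; ring.
Qed.

End Model.

(** * Generating functions of nonnegative sequences *)

Section GeneratingFunctions.
Variable R : realType.
Implicit Types (u v : nat -> R) (z s : R).

Definition gfun u z s : Prop := series (fun k => u k * z ^+ k) @ \oo --> s.

Lemma gfun_uniq u z s s' : gfun u z s -> gfun u z s' -> s = s'.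
Proof. exact: cvg_unique. Qed.

Lemma gfun_ext u v z s : (forall n, u n = v n) -> gfun u z s -> gfun v z s.
Proof. by move=> e; rewrite (_ : u = v) //; exact/funext. Qed.

Lemma gfun_add u v z s s' : gfun u z s -> gfun v z s' -> gfun (fun n => u n + v n) z (s + s').
Proof.
move=> h h'; rewrite /gfun (_ : series _ = series (fun k => u k * z ^+ k) \+ series (fun k => v k * z ^+ k)).
  exact: cvgD.
apply/funext => n; rewrite /series /= -[RHS]big_split.
by apply: eq_bigr => k _; rewrite mulrDl.
Qed.

Lemma gfun_scale c u z s : gfun u z s -> gfun (fun n => c * u n) z (c * s).
Proof.
move=> h; rewrite /gfun (_ : series _ = (fun n => c * series (fun k => u k * z ^+ k) n)).
  by apply: cvgM h; exact: cvg_cst.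
by apply/funext => n; rewrite /series /= mulr_sumr; apply: eq_bigr => k _; rewrite mulrA.
Qed.

Lemma gfun_finite u z N : (forall n, (N <= n)%N -> u n = 0) ->
  gfun u z (\sum_(0 <= k < N) u k * z ^+ k).
Proof.
move=> h; apply: cvg_near_cst; near=> n.
have Nn : (N <= n)%N by near: n; exact: nbhs_infty_ge.
rewrite /series /= (@big_cat_nat _ _ _ N 0 n) //= -[RHS]addr0; congr (_ + _); rewrite big_nat big1 // => k /andP[Nk _].
by rewrite h // mul0r.
Unshelve. all: by end_near. Qed.

Lemma gfun_ex u z : 0 <= z < 1 -> (forall n, 0 <= u n <= 1) -> exists s, gfun u z s.
Proof.
move=> /andP[z0 z1] hu; apply/cvg_ex.
apply: (@series_le_cvg _ _ (geometric 1 z)).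
- by move=> n; rewrite mulr_ge0 ?exprn_ge0 //; have /andP[] := hu n.
- by move=> n; rewrite mulr_ge0 ?exprn_ge0.
- by move=> n; rewrite ler_wpM2r ?exprn_ge0 //; have /andP[] := hu n.
by apply: is_cvg_geometric_series; rewrite ger0_norm.
Qed.

Lemma gfun_one z : 0 <= z < 1 -> gfun (fun _ => 1) z (1 - z)^-1.
Proof.
move=> /andP[z0 z1]; rewrite -[(1 - z)^-1]mul1r.
have h : `|z| < 1 by rewrite ger0_norm.
exact: (@cvg_geometric_series R 1 z h).
Qed.

Lemma partial_ge0 u z n : 0 <= z -> (forall n, 0 <= u n) ->
  0 <= series (fun k => u k * z ^+ k) n.
Proof. by move=> z0 hu; apply: sumr_ge0 => k _; rewrite mulr_ge0 ?exprn_ge0. Qed.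

Lemma partial_le u z s n : 0 <= z -> (forall n, 0 <= u n) -> gfun u z s ->
  series (fun k => u k * z ^+ k) n <= s.
Proof.
move=> z0 hu h; rewrite -(cvg_lim _ h) //.
apply: nondecreasing_cvgn_le; last by apply: cvgP h.
move=> i j ij; apply: nondecreasing_series => // k _ _.
by rewrite mulr_ge0 ?exprn_ge0.
Qed.

Lemma sum_conv u v N : \sum_(0 <= n < N) conv u v n =
  \sum_(0 <= k < N) u k * \sum_(0 <= j < N - k) v j.
Proof.
elim: N => [|N IH]; first by rewrite !big_geq.
rewrite big_nat_recr //= IH /conv !big_nat_recr //= !subnn subSnn !big_nat1.
rewrite addrA; congr (_ + _); rewrite -big_split /= !big_nat; apply: eq_bigr => k /andP[_ kN].
by rewrite subSn 1?ltnW // big_nat_recr //= mulrDr.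
Qed.

(** Cauchy product by squeezing: for nonnegative terms the partial sums satisfy S_n(u * v) <= S_n(u)
    S_n(v) <= S_2n(u * v). *)
Lemma gfun_conv u v z s s' : 0 <= z -> (forall n, 0 <= u n) -> (forall n, 0 <= v n) ->
  gfun u z s -> gfun v z s' -> gfun (conv u v) z (s * s').
Proof.
move=> z0 hu hv gu gv.
set a := fun k => u k * z ^+ k; set b := fun k => v k * z ^+ k.
have a0 n : 0 <= a n by rewrite mulr_ge0 ?exprn_ge0.
have b0 n : 0 <= b n by rewrite mulr_ge0 ?exprn_ge0.
have e : (fun k => conv u v k * z ^+ k) = conv a b.
  apply/funext => n; rewrite /conv mulr_suml !big_nat; apply: eq_bigr => k.
  rewrite ltnS => /andP[_ kn]; have -> : z ^+ n = z ^+ k * z ^+ (n - k) by rewrite -exprD subnKC.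
  by rewrite /a /b; ring.
have c0 n : 0 <= conv a b n by apply: sumr_ge0 => k _; exact: mulr_ge0.
have sa n : series a n <= s by exact: partial_le.
have sb n : series b n <= s' by exact: partial_le.
have pa n : 0 <= series a n by exact: partial_ge0.
have pb n : 0 <= series b n by exact: partial_ge0.
have ub n : series (conv a b) n <= series a n * series b n.
  rewrite /series /= sum_conv mulr_suml; apply: ler_sum => k _; apply: ler_wpM2l => //.
  rewrite [leRHS](@big_cat_nat _ _ _ (n - k)%N) //=; last exact: leq_subr.
  by rewrite lerDl sumr_ge0.
have lb n : series a n * series b n <= series (conv a b) (n + n)%N.
  rewrite /series /= sum_conv mulr_suml (@big_cat_nat _ _ _ n 0 (n + n)) //=; last exact: leq_addr.
  rewrite -[leLHS]addr0; apply: lerD; last first.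
    by apply: sumr_ge0 => k _; apply: mulr_ge0 => //; exact: sumr_ge0.
  rewrite [leLHS]big_nat [leRHS]big_nat; apply: ler_sum => k /andP[_ kn]; apply: ler_wpM2l => //.
  rewrite [leRHS](@big_cat_nat _ _ _ n 0 (n + n - k)) /=; [|by []|by lia].
  by rewrite lerDl sumr_ge0.
have mono : nondecreasing_seq (series (conv a b)).
  by move=> i j ij; apply: nondecreasing_series.
have cv : cvgn (series (conv a b)).
  apply: nondecreasing_is_cvgn => //; exists (s * s') => _ [n _ <-].
  by apply: le_trans (ub n) _; apply: ler_pM.
have AB : (fun n => series a n * series b n) @ \oo --> s * s' by exact: cvgM gu gv.
rewrite /gfun e; have [l hl] := (@cvg_ex _ _).1 cv.
rewrite (_ : s * s' = l) //; apply/eqP; rewrite eq_le; apply/andP; split.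
  apply: (ler_cvg_to AB (cvg_cst l)); near=> n; apply: le_trans (lb n) _.
  by rewrite -(cvg_lim _ hl) //; exact: nondecreasing_cvgn_le.
by apply: (ler_cvg_to hl AB); near=> n; exact: ub.
Unshelve. all: by end_near. Qed.

End GeneratingFunctions.

(** * Elimination between the generating functions *)

Section Algebra.
Variables (R : realType) (a b al be p z f g l B y : R).
Hypothesis z1 : z < 1.
Hypothesis f1 : f < 1.
Hypothesis bf : 0 < 1 - be * f.
Hypothesis eg : g = f + f * g.
Hypothesis ey : y = f + be * (y * f).
Hypothesis eB : B = p * z + b * l.
Hypothesis efate : (1 + p) / 2 * (z / (1 - z)) = g + (B / (1 - z) +
  ((1 - a / 2 - b) * (l / (1 - z)) + (1 - al) * (y * (B / (1 - z)) -
    (1 - be) / 2 * (y * (B * (y / (1 - z))))))).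
Hypothesis efirst : f = z * ((1 - p) / 2) + (B * (y * (al + (1 - al - be) * f)) +
  (l * (a / 2 + (1 - a - b) * f) + (1 - al) * (1 - be) / 2 * (y * (B * y)))).

Let k0 := 1 - a - b.
Let M := 1 + (1 - al) * (2 * y + be * y ^+ 2).
Let c := a / 2 + k0 * f + b * (y * (al + (1 - al - be) * f) + (1 - al) * (1 - be) / 2 * y ^+ 2).

Let yE : y = f / (1 - be * f).
Proof. by apply: (mulIf (lt0r_neq0 bf)); rewrite divfK ?lt0r_neq0 // mulrBr mulr1 {1}ey; ring. Qed.

Let gE : g = (1 - f)^-1 - 1.
Proof.
have nf : 1 - f != 0 by rewrite lt0r_neq0 // subr_gt0.
by apply: (mulIf nf); rewrite mulrBl mulVf // mul1r mulrBr mulr1 {1}eg; ring.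
Qed.

Let fate_cleared : (1 + p) / 2 * z = (1 - z) * g + (B + ((1 - a / 2 - b) * l +
   (1 - al) * (y * B - (1 - be) / 2 * (y * (B * y))))).
Proof.
have nz : 1 - z != 0 by rewrite lt0r_neq0 // subr_gt0.
have -> : (1 + p) / 2 * z = (1 - z) * ((1 + p) / 2 * (z / (1 - z))) by field.
by rewrite efate; field.
Qed.

(** Eliminates g. Twice [fate_cleared] and twice [efirst] combine into an identity with the common
    factor 2 (1 - f), thanks to g = 1 / (1 - f) - 1 and y = f / (1 - be f). *)
Lemma excess : (1 - z) / (1 - f) ^+ 2 = 1 - l * k0 - B * M.
Proof.
have nf : 1 - f != 0 by rewrite lt0r_neq0 // subr_gt0.
have X : (1 - z) * 2 / (1 - f) = 2 * (1 - f) * (1 - l * k0) -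
   B * (2 - 2 * (y * (al + (1 - al - be) * f)) - (1 - al) * (1 - be) * y ^+ 2 * 2 + 2 * (1 - al) * y).
  have e1 := fate_cleared; have e2 := efirst; rewrite gE eB in e1 e2 *; rewrite /k0.
  set i := (1 - f)^-1 in e1 *.
  have -> : (1 - z) * 2 * i = 2 * ((1 - z) * (i - 1)) + 2 * (1 - z) by ring.
  have -> : (1 - z) * (i - 1) = (1 + p) / 2 * z - (p * z + b * l +
       ((1 - a / 2 - b) * l +
        (1 - al) * (y * (p * z + b * l) - (1 - be) / 2 * (y * ((p * z + b * l) * y))))).
    by rewrite e1; ring.
  have := congr1 (fun t => 2 * t) e2.
  move=> e; apply/eqP; rewrite -subr_eq0; apply/eqP.
  transitivity (2 * f - 2 * (z * ((1 - p) / 2) +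
      ((p * z + b * l) * (y * (al + (1 - al - be) * f)) +
       (l * (a / 2 + (1 - a - b) * f) +
        (1 - al) * (1 - be) / 2 * (y * ((p * z + b * l) * y)))))); last by rewrite e subrr.
  by field.
have Y : 2 - 2 * (y * (al + (1 - al - be) * f)) - (1 - al) * (1 - be) * y ^+ 2 * 2 + 2 * (1 - al) * y =
    2 * (1 - f) * M.
  by rewrite /M yE; field; exact: lt0r_neq0.
apply: (mulfI (x := 2 * (1 - f))); first by rewrite mulf_neq0 // pnatr_eq0.
have -> : 2 * (1 - f) * ((1 - z) / (1 - f) ^+ 2) = (1 - z) * 2 / (1 - f) by field.
by rewrite X Y; ring.
Qed.

(** Eliminates l. The equation [efirst] is linear in l with coefficient c, so [excess] multiplied by
    2 c can be freed of l. All terms in p end up on the left, and the right-hand side keeps the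
    factor 1 - z. *)
Lemma critical_identity : 1 - b * (1 - al) * y ^+ 2 -
    z * p * (1 + (1 - al) * (2 * y + (be + k0) * y ^+ 2)) =
  (1 - z) * (k0 + b * M + 2 * c / (1 - f) ^+ 2).
Proof.
have nf : 1 - f != 0 by rewrite lt0r_neq0 // subr_gt0.
have h := excess; have e2 := efirst.
have ld : l * c = f - z * ((1 - p) / 2) - p * z * (y * (al + (1 - al - be) * f) +
    (1 - al) * (1 - be) / 2 * y ^+ 2).
  move: e2 => /eqP; rewrite -subr_eq0 eB => /eqP e0.
  by apply: subr0_eq; rewrite -[RHS]oppr0 -e0 /c /k0; field.
have -> : (1 - z) * (k0 + b * M + 2 * c / (1 - f) ^+ 2) =
  (1 - z) * (k0 + b * M) + 2 * c * ((1 - z) / (1 - f) ^+ 2) by field.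
rewrite h eB.
have -> : 2 * c * (1 - l * k0 - (p * z + b * l) * M) =
  2 * c * (1 - p * z * M) - 2 * (l * c) * (k0 + b * M) by ring.
rewrite ld /c /M /k0 yE; field; exact: lt0r_neq0.
Qed.

End Algebra.

Lemma conv_ge0 (R : realType) (u v : nat -> R) n : (forall n, 0 <= u n) -> (forall n, 0 <= v n) ->
  0 <= conv u v n.
Proof. by move=> hu hv; apply: sumr_ge0 => k _; exact: mulr_ge0. Qed.

Lemma gfun_delta (R : realType) (z : R) : gfun (delta R) z 1.
Proof.
have := @gfun_finite R (delta R) z 1; rewrite big_nat1 expr0 mulr1; apply.
by case.
Qed.

Lemma gfun_delta1 (R : realType) (z : R) : gfun (fun n => (n == 1)%N%:R) z z.
Proof.
have := @gfun_finite R (fun n => (n == 1)%N%:R) z 2.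
by rewrite big_nat_recr //= big_nat1 mul0r add0r mul1r expr1; apply; case=> [|[]].
Qed.

(** * The limit z to 1 and the sign of the threshold polynomial *)

Section Threshold.
Variable R : realType.
Variables (F G L B Y : nat -> R) (a b al be p q : R).
Hypothesis a0 : 0 <= a.
Hypothesis b0 : 0 <= b.
Hypothesis al01 : 0 <= al < 1.
Hypothesis be01 : 0 <= be < 1.
Hypothesis ab1 : a + b <= 1.
Hypothesis albe1 : al + be <= 1.
Hypothesis p01 : 0 <= p <= 1.
Hypothesis F01 : forall n, 0 <= F n <= 1.
Hypothesis G01 : forall n, 0 <= G n <= 1.
Hypothesis L01 : forall n, 0 <= L n <= 1.
Hypothesis B01 : forall n, 0 <= B n <= 1.
Hypothesis Y01 : forall n, 0 <= Y n <= 1.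
Hypothesis F0 : F 0 = 0.
Hypothesis G0 : G 0 = 0.
Hypothesis L0 : L 0 = 0.
Hypothesis sumF : forall n, \sum_(0 <= k < n) F k <= 1.
Hypothesis Grec : forall n, G n = F n + \sum_(0 <= m < n) F m * G (n - m)%N.
Hypothesis Yrec : forall n, Y n = F n + \sum_(0 <= m < n) Y m * be * F (n - m)%N.
Hypothesis Beq : forall n, B n = (n == 1)%N%:R * p + b * L n.
Hypothesis fate : forall n, (0 < n)%N -> 1 = (1 - p) / 2 + (G n + (conv B (fun _ => 1) n +
  ((1 - a / 2 - b) * conv L (fun _ => 1) n +
  (1 - al) * (conv Y (conv B (fun _ => 1)) n -
     (1 - be) / 2 * conv Y (conv B (conv Y (fun _ => 1))) n)))).
Hypothesis firsteq : forall n, F n = (n == 1)%N%:R * ((1 - p) / 2) +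
  (conv B (conv Y (fun i => delta R i * al + (1 - al - be) * F i)) n +
  (conv L (fun i => delta R i * (a / 2) + (1 - a - b) * F i) n +
  (1 - al) * (1 - be) / 2 * conv Y (conv B Y) n)).
Hypothesis Fq : series F @ \oo --> q.

Let ge0 (u : nat -> R) : (forall n, 0 <= u n <= 1) -> forall n, 0 <= u n.
Proof. by move=> h n; have /andP[] := h n. Qed.

Let F_ge0 := ge0 F01. Let G_ge0 := ge0 G01. Let L_ge0 := ge0 L01.
Let B_ge0 := ge0 B01. Let Y_ge0 := ge0 Y01.

Let GE n : G n = F n + conv F G n.
Proof. by rewrite Grec /conv big_nat_recr //= subnn G0 mulr0 addr0. Qed.

Let YE n : Y n = F n + be * conv Y F n.
Proof.
rewrite Yrec /conv big_nat_recr //= subnn F0 mulr0 addr0 mulr_sumr.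
by congr (_ + _); apply: eq_bigr => k _; ring.
Qed.

Lemma at_one y : gfun Y 1 y -> y = q + be * (y * q).
Proof.
move=> hy; have hq : gfun F 1 q.
  by rewrite /gfun (_ : (fun k => _) = F) //; apply/funext => k; rewrite expr1n mulr1.
apply: (gfun_uniq hy); apply: (gfun_ext (fun n => esym (YE n))).
by apply: gfun_add => //; apply: gfun_scale; apply: gfun_conv.
Qed.

Lemma f_le_z (z f : R) : 0 < z < 1 -> gfun F z f -> f <= z.
Proof.
move=> /andP[/ltW z0 /ltW z1] hf; apply: (ler_cvg_to hf (cvg_cst z)); near=> n.
apply: le_trans (_ : \sum_(0 <= k < n) z * F k <= _).
  apply: ler_sum => -[|k] _; first by rewrite F0 mul0r mulr0.
  by rewrite mulrC ler_wpM2r // exprS ler_piMr // exprn_ile1.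
by rewrite -mulr_sumr ler_piMr.
Unshelve. all: by end_near. Qed.

Lemma f_le_q (z f : R) : 0 < z < 1 -> gfun F z f -> f <= q.
Proof.
move=> /andP[/ltW z0 /ltW z1] hf; apply: (ler_cvg_to hf Fq); near=> n.
by apply: ler_sum => k _; rewrite ler_piMr // exprn_ile1.
Unshelve. all: by end_near. Qed.

(** Bernoulli: z^k >= 1 - k (1 - z). Together with [f_le_q] this gives the Abel limit of f at 1,
    with z tending to 1 while N is fixed. *)
Lemma f_ge (z f : R) N : 0 < z < 1 -> gfun F z f -> series F N - N%:R * (1 - z) <= f.
Proof.
move=> /andP[z0 z1] hf; apply: le_trans (partial_le N (ltW z0) F_ge0 hf).
have bern k : 1 - k%:R * (1 - z) <= z ^+ k.
  elim: k => [|k IH]; first by rewrite mul0r subr0 expr0.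
  rewrite exprS; apply: le_trans (_ : z * (1 - k%:R * (1 - z)) <= _); last by rewrite ler_pM2l.
  have h : 0 <= k%:R * (1 - z) ^+ 2 by rewrite mulr_ge0 ?sqr_ge0.
  by rewrite -natr1; nra.
apply: le_trans (_ : series F N * (1 - N%:R * (1 - z)) <= _).
  rewrite [leRHS]mulrBr mulr1 lerD2l lerN2 ler_piMl //; last exact: sumF.
  by rewrite mulr_ge0 // subr_ge0 ltW.
rewrite /series /= mulr_suml !big_nat; apply: ler_sum => k /andP[_ kN].
apply: ler_wpM2l => //; apply: le_trans (bern k); rewrite lerD2l lerN2.
apply: ler_wpM2r; first by rewrite subr_ge0 ltW.
by rewrite ler_nat ltnW.
Qed.

(** Sums the sequence relations against z^n, where all series converge, and feeds the result to
    [critical_identity]. *)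
Lemma at_z (z : R) : 0 < z < 1 -> exists f y, [/\ gfun F z f, y = f / (1 - be * f) &
  let k0 := 1 - a - b in
  let M := 1 + (1 - al) * (2 * y + be * y ^+ 2) in
  let c := a / 2 + k0 * f +
    b * (y * (al + (1 - al - be) * f) + (1 - al) * (1 - be) / 2 * y ^+ 2) in
  1 - b * (1 - al) * y ^+ 2 - z * p * (1 + (1 - al) * (2 * y + (be + k0) * y ^+ 2)) =
  (1 - z) * (k0 + b * M + 2 * c / (1 - f) ^+ 2)].
Proof.
move=> z01; have /andP[z0 z1] := z01; have z01' : 0 <= z < 1 by rewrite ltW.
have [f hf] := gfun_ex z01' F01; have [g hg] := gfun_ex z01' G01.
have [l hl] := gfun_ex z01' L01; have [B' hB] := gfun_ex z01' B01.
have [y hy] := gfun_ex z01' Y01; have h1 := gfun_one z01'; have hd := gfun_delta z.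
have z0' := ltW z0.
have f1 : f < 1 by exact: le_lt_trans (f_le_z z01 hf) z1.
have f0 : 0 <= f by have := partial_le 0 z0' F_ge0 hf; rewrite /series /= big_geq.
have /andP[be0 be1] := be01; have /andP[al0 al1] := al01; have /andP[p0 p1] := p01.
have bf : 0 < 1 - be * f by nra.
have eg : g = f + f * g.
  apply: (gfun_uniq hg); apply: (gfun_ext (fun n => esym (GE n))).
  by apply: gfun_add => //; exact: gfun_conv.
have ey : y = f + be * (y * f).
  apply: (gfun_uniq hy); apply: (gfun_ext (fun n => esym (YE n))).
  by apply: gfun_add => //; apply: gfun_scale; exact: gfun_conv.
have eB : B' = p * z + b * l.
  apply: (gfun_uniq hB); apply: (@gfun_ext _ (fun n => p * (n == 1)%N%:R + b * L n)).
    by move=> n; rewrite Beq mulrC.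
  by apply: gfun_add; apply: gfun_scale => //; exact: gfun_delta1.
have cB1 : gfun (conv B (fun _ => 1)) z (B' / (1 - z)) by exact: gfun_conv.
have cL1 : gfun (conv L (fun _ => 1)) z (l / (1 - z)) by exact: gfun_conv.
have cY1 : gfun (conv Y (fun _ => 1)) z (y / (1 - z)) by exact: gfun_conv.
have cBY1 : gfun (conv B (conv Y (fun _ => 1))) z (B' * (y / (1 - z))).
  by apply: gfun_conv => // n; exact: conv_ge0.
have efate : (1 + p) / 2 * (z / (1 - z)) = g + (B' / (1 - z) +
  ((1 - a / 2 - b) * (l / (1 - z)) + (1 - al) * (y * (B' / (1 - z)) -
    (1 - be) / 2 * (y * (B' * (y / (1 - z))))))).
  (* The fate equation holds for n > 0 only; at n = 0 all terms after (1 - p) / 2 vanish. So the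
     constant (1 + p) / 2 comes with the factor 1 - delta. *)
  apply: (@gfun_uniq R (fun n => (1 + p) / 2 * (1 + -1 * delta R n)) z).
    apply: gfun_scale; rewrite (_ : z / (1 - z) = (1 - z)^-1 + -1 * 1).
      by apply: gfun_add => //; exact: gfun_scale.
    by field; rewrite subr_eq0 eq_sym lt_eqF.
  apply: (@gfun_ext _ (fun n => G n + (conv B (fun _ => 1) n +
  ((1 - a / 2 - b) * conv L (fun _ => 1) n +
  (1 - al) * (conv Y (conv B (fun _ => 1)) n +
     -1 * ((1 - be) / 2 * conv Y (conv B (conv Y (fun _ => 1))) n)))))).
    move=> n; case: (posnP n) => [->|n0].
      rewrite /conv !big_nat1 G0 L0 Beq L0 /delta /=; ring.
    rewrite (_ : delta R n = 0); last by rewrite /delta gtn_eqF.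
    transitivity (1 - (1 - p) / 2); last by field.
    apply: (addrI ((1 - p) / 2)); rewrite [RHS]addrC subrK [RHS](fate n0); ring.
  apply: gfun_add => //; apply: gfun_add => //; apply: gfun_add; first exact: gfun_scale.
  apply: gfun_scale; rewrite -[X in y * (B' / (1 - z)) + X]mulN1r; apply: gfun_add.
    by apply: gfun_conv => // n; exact: conv_ge0.
  apply: gfun_scale; apply: gfun_scale; apply: gfun_conv => // n.
  by apply: conv_ge0 => // m; exact: conv_ge0.
have efirst : f = z * ((1 - p) / 2) + (B' * (y * (al + (1 - al - be) * f)) +
  (l * (a / 2 + (1 - a - b) * f) + (1 - al) * (1 - be) / 2 * (y * (B' * y)))).
  apply: (gfun_uniq hf); apply: (gfun_ext (fun n => esym (firsteq n))).
  have H (s t : R) : gfun (fun i => delta R i * s + t * F i) z (s + t * f).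
    apply: gfun_add; last exact: gfun_scale.
    by have := gfun_scale (c := s) hd; rewrite mulr1; apply: gfun_ext => n; exact: mulrC.
  have H0 (s t : R) : 0 <= s -> 0 <= t -> forall i, 0 <= delta R i * s + t * F i.
    by move=> s0 t0 i; apply: addr_ge0; apply: mulr_ge0 => //; rewrite /delta ler0n.
  have H1 : forall i, 0 <= delta R i * al + (1 - al - be) * F i by apply: H0 => //; rewrite -addrA -opprD subr_ge0.
  apply: gfun_add.
    by have := gfun_scale (c := (1 - p) / 2) (@gfun_delta1 R z); rewrite [z * _]mulrC; apply: gfun_ext => n; exact: mulrC.
  apply: gfun_add.
    apply: gfun_conv => //; first by move=> n; exact: conv_ge0.
    by apply: gfun_conv => //; exact: H.
  apply: gfun_add.
    by apply: gfun_conv => //; apply: H0; rewrite ?divr_ge0 // -addrA -opprD subr_ge0.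
  apply: gfun_scale; apply: gfun_conv => //; first by move=> n; exact: conv_ge0.
  by apply: gfun_conv.
exists f, y; split=> //; last exact: (critical_identity z1 f1 bf eg ey eB efate efirst).
apply: (mulIf (lt0r_neq0 bf)); rewrite divfK ?lt0r_neq0 // mulrBr mulr1 {1}ey; ring.
Qed.

Let zs (n : nat) : R := 1 - n.+2%:R^-1.
Let fs n := limn (series (fun k => F k * zs n ^+ k)).

Let zs01 n : 0 < zs n < 1.
Proof.
have h : 0 < (n.+2%:R : R)^-1 < 1 by rewrite invr_gt0 ltr0n /= invf_lt1 ?ltr0n // ltr1n.
by move: h; rewrite /zs => /andP[h1 h2]; rewrite subr_gt0 h2 gtrBl h1.
Qed.

Let cvg_inv : (fun n => n.+2%:R^-1 : R) @ \oo --> (0 : R).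
Proof. by have := @cvg_harmonic R; rewrite -cvg_shiftS. Qed.

Let cvg_zs : zs @ \oo --> (1 : R).
Proof.
rewrite -[1 in X in _ --> X]subr0; apply: cvgB; [exact: cvg_cst|exact: cvg_inv].
Qed.

Let gfun_fs n : gfun F (zs n) (fs n).
Proof.
have [f [y [hf _ _]]] := at_z (zs01 n).
by rewrite /fs (cvg_lim _ hf).
Qed.

Let cvg_fs : fs @ \oo --> q.
Proof.
apply/cvgrPdist_le => e e0; have e2 : 0 < e / 2 by rewrite divr_gt0.
have [N _ hN] := (cvgrPdist_le _ _).1 Fq (e / 2) e2.
have := hN N (leqnn N) => {}hN.
have cN : (fun n => N%:R * n.+2%:R^-1 : R) @ \oo --> (0 : R).
  by rewrite -[0 in X in _ --> X](mulr0 (N%:R : R)); apply: cvgM; [exact: cvg_cst|exact: cvg_inv].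
have cN' := (cvgrPdist_le _ _).1 cN (e / 2) e2.
near=> n.
have hn : `|0 - N%:R * n.+2%:R^-1| <= e / 2 by near: n; exact: cN'.
have h1 := f_le_q (zs01 n) (@gfun_fs n).
have h2 := f_ge N (zs01 n) (@gfun_fs n).
have h3 := ler_norm (q - series F N).
have h4 : N%:R * (1 - zs n) <= e / 2.
  by apply: le_trans hn; rewrite sub0r normrN /zs opprB addrC subrK ler_norm.
rewrite ger0_norm ?subr_ge0 //.
have -> : e = e / 2 + e / 2 by field.
apply: le_trans (lerD (le_trans h3 hN) h4); rewrite lerBlDr -addrA.
apply: le_trans (_ : q - series F N + series F N <= _); first by rewrite subrK.
by rewrite lerD2l -lerBlDl.
Unshelve. all: by end_near. Qed.

Let q1 : q <= 1.
Proof. by apply: (ler_cvg_to Fq (cvg_cst (1 : R))); near=> n; exact: sumF. Unshelve. all: by end_near. Qed.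
Let q0 : 0 <= q.
Proof. by apply: (ler_cvg_to (cvg_cst (0 : R)) Fq); near=> n; exact: sumr_ge0. Unshelve. all: by end_near. Qed.

Let ys n := fs n / (1 - be * fs n).
Let yq := q / (1 - be * q).

Let bq : 0 < 1 - be * q.
Proof. by have /andP[h1 h2] := be01; rewrite subr_gt0; apply: le_lt_trans h2; rewrite ler_piMr. Qed.

Let cvg_ys : ys @ \oo --> yq.
Proof.
apply: cvgM; first exact: cvg_fs.
apply: cvgV; first exact: lt0r_neq0.
apply: cvgB; first exact: cvg_cst.
by apply: cvgM; [exact: cvg_cst|exact: cvg_fs].
Qed.

Let k0 := 1 - a - b.
(** The two sides of [critical_identity]: W = (1 - z) K. By [threshold_algebra], W at z = 1 and y =
    1 / (1 - be) has the sign of the numerator of the critical density minus p times its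
    denominator. *)
Let W z y := 1 - b * (1 - al) * y ^+ 2 - z * p * (1 + (1 - al) * (2 * y + (be + k0) * y ^+ 2)).
Let K f y := k0 + b * (1 + (1 - al) * (2 * y + be * y ^+ 2)) + 2 * (a / 2 + k0 * f +
    b * (y * (al + (1 - al - be) * f) + (1 - al) * (1 - be) / 2 * y ^+ 2)) / (1 - f) ^+ 2.

Let WK n : W (zs n) (ys n) = (1 - zs n) * K (fs n) (ys n).
Proof.
have [f [y [hf ey e]]] := at_z (zs01 n).
have ef : f = fs n by exact: (gfun_uniq hf (@gfun_fs n)).
by rewrite -/(ys n) in e *; rewrite /W /K /ys -ef -ey.
Qed.

Ltac cvgs := repeat first [exact: cvg_cst | exact: cvg_fs | exact: cvg_ys | exact: cvg_zs |
  apply: cvgD | apply: cvgN | apply: cvgM].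

Let cvg_W : (fun n => W (zs n) (ys n)) @ \oo --> W 1 yq.
Proof. by rewrite /W; under eq_fun do rewrite expr2; rewrite expr2; cvgs. Qed.

Let threshold_algebra : 0 < 1 - be -> W 1 (1 - be)^-1 * (1 - be) ^+ 2 =
  ((1 - be) ^+ 2 - b * (1 - al)) -
  p * (4 - (a + b) * (1 - al) - be * (3 - al - be) - 3 * al).
Proof. by move=> u0; rewrite /W /k0; field; exact: lt0r_neq0. Qed.

(** For q = 1 the values of y tend to 1 / (1 - be), and W is there a limit of products of
    nonnegative factors. *)
Lemma subcritical : q = 1 ->
  p * (4 - (a + b) * (1 - al) - be * (3 - al - be) - 3 * al) <= (1 - be) ^+ 2 - b * (1 - al).
Proof.
move=> eq1; have /andP[be0 be1] := be01; have u0 : 0 < 1 - be by rewrite subr_gt0.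
have /andP[al0 al1] := al01; have k00 : 0 <= k0 by rewrite /k0 -addrA -opprD subr_ge0.
rewrite -subr_ge0 -threshold_algebra //; apply: mulr_ge0; last exact: sqr_ge0.
have -> : (1 - be)^-1 = yq by rewrite /yq eq1 mulr1 mul1r.
apply: (ler_cvg_to (cvg_cst (0 : R)) cvg_W); near=> n; rewrite WK.
have /andP[z0 z1] := zs01 n.
have f0 : 0 <= fs n.
  by have := partial_le 0 (ltW z0) F_ge0 (@gfun_fs n); rewrite /series /= big_geq.
have f1 : fs n <= 1 by apply: le_trans (f_le_q (zs01 n) (@gfun_fs n)) q1.
have y0 : 0 <= ys n by rewrite /ys divr_ge0 // subr_ge0 mulr_ile1 // ltW.
have al10 : 0 <= 1 - al by rewrite subr_ge0 ltW.
have ab10 : 0 <= 1 - al - be by rewrite -addrA -opprD subr_ge0.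
have y2 := sqr_ge0 (ys n).
apply: mulr_ge0; first by rewrite subr_ge0 ltW.
have i2 : 0 <= ((1 - fs n) ^+ 2)^-1 by rewrite invr_ge0 sqr_ge0.
have be10 := ltW u0; have a2 : 0 <= a / 2 by rewrite divr_ge0.
rewrite /K; repeat first [assumption | exact: ler01 | exact: ler0n | apply: addr_ge0 |
  apply: mulr_ge0 | rewrite invr_ge0].
Unshelve. all: by end_near. Qed.

(** For q < 1 the factor K stays bounded, so W at z = 1 vanishes at y = q / (1 - be q). This y is at
    most 1 / (1 - be) and W decreases in y. *)
Lemma supercritical : q < 1 ->
  (1 - be) ^+ 2 - b * (1 - al) <= p * (4 - (a + b) * (1 - al) - be * (3 - al - be) - 3 * al).
Proof.
move=> q_lt; have /andP[be0 be1] := be01; have u0 : 0 < 1 - be by rewrite subr_gt0.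
have /andP[al0 al1] := al01; have k00 : 0 <= k0 by rewrite /k0 -addrA -opprD subr_ge0.
have /andP[p0 p1] := p01.
have al10 : 0 <= 1 - al by rewrite subr_ge0 ltW.
have W0 : W 1 yq = 0.
  apply: (cvg_unique _ cvg_W) => //.
  have -> : (fun n => W (zs n) (ys n)) = (fun n => (1 - zs n) * K (fs n) (ys n)).
    by apply/funext => n; exact: WK.
  rewrite -(mul0r (K q yq)); apply: cvgM.
    by rewrite -[0 in X in _ --> X](subrr (1 : R)); cvgs.
  rewrite /K; under eq_fun do rewrite !expr2; rewrite !expr2; cvgs.
  have nz : 1 - q != 0 by rewrite subr_eq0 gt_eqF.
  by apply: cvgV; [rewrite mulf_neq0|cvgs].
have yq0 : 0 <= yq by rewrite /yq divr_ge0 // ltW.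
have yu : yq <= (1 - be)^-1.
  rewrite /yq ler_pdivrMr // mulrC ler_pdivlMr //; nra.
rewrite -subr_le0 -threshold_algebra //; apply: mulr_le0_ge0; last exact: sqr_ge0.
rewrite -W0 /W; have ai : 0 <= (1 - be)^-1 by rewrite invr_ge0 ltW.
have y2 : yq ^+ 2 <= (1 - be)^-1 ^+ 2 by rewrite lerXn2r.
apply: lerB.
  by rewrite lerD2l lerN2; apply: ler_wpM2l => //; exact: mulr_ge0.
rewrite !mul1r; apply: ler_wpM2l => //; rewrite lerD2l; apply: ler_wpM2l => //.
by apply: lerD; apply: ler_wpM2l => //; exact: addr_ge0.
Qed.

End Threshold.

(** * The exit probability q and the survival of blockades *)

Section Model.
Variable R : realType.
Notation Omega := (Omega R).
Variable Q : probability Omega R.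
Variables ra rb ral rbe p : R.
Hypothesis Qind : forall J E, uniq J ->
  (forall s, measurable (E s : set (measurableTypeR R))) ->
  Q (cylinder J E) = (\prod_(s <- J) Q [set d : Omega | E s (d s)])%E.
Hypothesis Qgood : {ae Q, forall d, good d}.
Hypothesis Qrefl : forall c (A : set Omega), measurable A -> Q (reflect c @^-1` A) = Q A.
Notation P := (Pr Q).
Hypothesis Qvel : forall k u, P (fun d => velo d k = u) = velocity_law p u.
Hypothesis Qout : forall c q r o, P (fun d => outs d c q r = o) =
  reaction_law ra rb ral rbe c o.
Notation Fs := (Fs Q).
Notation Gs := (Gs Q).
Notation Ls := (Ls Q).
Notation Bs := (Bs Q).
Notation Ys := (Ys Q).



Hypothesis ra01 : 0 <= ra < 1.
Hypothesis rb01 : 0 <= rb < 1.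
Hypothesis ral01 : 0 <= ral < 1.
Hypothesis rbe01 : 0 <= rbe < 1.
Hypothesis rab1 : ra + rb <= 1.
Hypothesis ralbe1 : ral + rbe <= 1.
Hypothesis p01 : 0 <= p <= 1.

Lemma Pr_le (phi psi : Omega -> Prop) : evt phi -> evt psi -> (forall d, phi d -> psi d) ->
  P phi <= P psi.
Proof.
move=> mp ms h; rewrite -lee_fin -!PrE //; by apply: le_measure => //; rewrite ?inE.
Qed.

Lemma sum_Fs n : \sum_(0 <= k < n) Fs k <= 1.
Proof.
pose E (k : nat) := @dfirst R 1 k%:Z.
have mE k : evt (E k) by exact: evt_first.
have mX : evt (fun d => exists2 k, k \in index_iota 0 n & E k d) by exact: evt_exists_in.
have <- : P (fun d => exists2 k, k \in index_iota 0 n & E k d) = \sum_(0 <= k < n) P (E k).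
  apply: (Pr_partition Qgood); rewrite ?iota_uniq // => d i j _ _ _ f f'.
  by have := firstL_unique f f'; clear; lia.
exact: Pr_le1.
Qed.

Definition survival : R := limn (series Fs).
Notation q := survival.

Lemma cvg_Fs : series Fs @ \oo --> q.
Proof.
have : cvgn (series Fs); last by [].
apply: nondecreasing_is_cvgn.
  by move=> i j ij; apply: nondecreasing_series => // k _ _; exact: Pr_ge0.
by exists 1 => _ [n _ <-]; exact: sum_Fs.
Qed.

Lemma survival_le1 : q <= 1.
Proof.
apply: (ler_cvg_to cvg_Fs (cvg_cst (1 : R))); near=> n; exact: sum_Fs.
Unshelve. all: by end_near. Qed.

Let P01 phi : evt phi -> 0 <= P phi <= 1.
Proof. by move=> h; rewrite Pr_ge0 Pr_le1. Qed.
Let Fs01 n : 0 <= Fs n <= 1. Proof. by apply: P01; exact: evt_first. Qed.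
Let Gs01 n : 0 <= Gs n <= 1. Proof. by apply: P01; exact: evt_exitL. Qed.
Let Ls01 n : 0 <= Ls n <= 1. Proof. by apply: P01; exact: evt_meet. Qed.
Let Bs01 n : 0 <= Bs n <= 1. Proof. by apply: P01; exact: evt_block. Qed.
Let Ys01 n : 0 <= Ys n <= 1. Proof. by apply: P01; exact: evt_reachL. Qed.
Let ra0 : 0 <= ra. Proof. by case/andP: ra01. Qed.
Let rb0 : 0 <= rb. Proof. by case/andP: rb01. Qed.

Lemma survival_subcritical : q = 1 ->
  p * (4 - (ra + rb) * (1 - ral) - rbe * (3 - ral - rbe) - 3 * ral) <=
    (1 - rbe) ^+ 2 - rb * (1 - ral).
Proof.
exact: (subcritical ra0 rb0 ral01 rbe01 rab1 ralbe1 p01 Fs01 Gs01 Ls01 Bs01 Ys01 (Fs0 Q) (Gs0 Q)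
  (Ls0 Q) sum_Fs (renewal Qind Qgood Qrefl) (Ys_rec Qind Qgood Qrefl Qout)
  (Bs_eq Qind Qvel Qout) (fate_total Qind Qgood Qrefl Qvel Qout)
  (first_total Qind Qgood Qrefl Qvel Qout) cvg_Fs).
Qed.

Lemma survival_supercritical : q < 1 ->
  (1 - rbe) ^+ 2 - rb * (1 - ral) <=
  p * (4 - (ra + rb) * (1 - ral) - rbe * (3 - ral - rbe) - 3 * ral).
Proof.
exact: (supercritical ra0 rb0 ral01 rbe01 rab1 ralbe1 p01 Fs01 Gs01 Ls01 Bs01 Ys01 (Fs0 Q) (Gs0 Q)
  (Ls0 Q) sum_Fs (renewal Qind Qgood Qrefl) (Ys_rec Qind Qgood Qrefl Qout)
  (Bs_eq Qind Qvel Qout) (fate_total Qind Qgood Qrefl Qvel Qout)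
  (first_total Qind Qgood Qrefl Qvel Qout) cvg_Fs).
Qed.

Definition cleared (j : int) (d : Omega) : Prop := exists n : nat,
  dreachL (Initial j) (j + n%:Z) d /\
  outs d BlockLeft (Initial j) (Initial (j + n%:Z)) <> Some vzero.

Lemma evt_cleared j : evt (cleared j).
Proof.
by apply: evt_exists => n; apply: evt_and; [exact: evt_reachL|exact: evt_outs_neq].
Qed.

(** At most one arrow reaches the blockade and does not leave it standing, so the probabilities (1 -
    rbe) Ys n add up. *)
Let Pcleared_n j N : (1 - rbe) * \sum_(0 <= n < N) Ys n <= P (cleared j).
Proof.
pose E (n : nat) (d : Omega) := dreachL (Initial j) (j + n%:Z) d /\
  outs d BlockLeft (Initial j) (Initial (j + n%:Z)) <> Some vzero.
have mE n : evt (E n) by apply: evt_and; [exact: evt_reachL|exact: evt_outs_neq].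
have mX : evt (fun d => exists2 n, n \in index_iota 0 N & E n d) by exact: evt_exists_in.
apply: le_trans (_ : P (fun d => exists2 n, n \in index_iota 0 N & E n d) <= _); last first.
  by apply: Pr_le => // [|d [n _ En]]; [exact: evt_cleared|exists n].
rewrite (@Pr_partition _ _ Qgood _ (index_iota 0 N) E) ?iota_uniq //; last first.
  move=> d n m [xlt xgen] _ _ [r1 z1] [r2 z2].
  have h1 := reachL_range r1; have h2 := reachL_range r2.
  by have := killer_unique_right h1 h2 r1 r2 z1 z2; clear; lia.
rewrite mulr_sumr; apply: ler_sum => n _; rewrite /E.
rewrite (@Pr_indep _ _ Qind (in_box (j + 1) (j + n%:Z) `|` outcomesL (Initial j) (j + n%:Z))
  [set Outcome BlockLeft (Initial j) (Initial (j + n%:Z))]).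
- rewrite (Pout_neq Qout) mulrC.
  have h := Pr_reachL Qind Qgood Qrefl Qout (b := Initial j) n (@evt_cst R True) (fun d d' _ h => h).
  rewrite (@Pr_true _ Q (fun _ => True)) // mul1r in h.
  by rewrite -h (@Pr_ext _ Q (dreachL (Initial j) (j + n%:Z)) (fun d => True /\
    dreachL (Initial j) (hi (Initial j) + n%:Z) d)) // => d; split=> [|[]].
- exact: evt_reachL.
- exact: evt_outs_neq.
- exact: (@dep_reachL _ (Initial j)).
- exact: (@dep_outs _ _ _ _ (fun o => o <> Some vzero)).
move=> s [bs|os] e; [move: bs|move: os]; rewrite e /= /within /=; first by move=> [[h1 h2 h3] _]; clear -h1 h2 h3; lia.
by move=> [_ [_]]; rewrite ltxx.
Qed.

(** At z = 1 the relation for Y reads y = 1 + rbe y, hence (1 - rbe) y = 1. *)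
Lemma cleared_subcritical j : q = 1 -> P (cleared j) = 1.
Proof.
move=> q1; have /andP[be0 be1] := rbe01; have u0 : 0 < 1 - rbe by rewrite subr_gt0.
have Ys_ge0 n : 0 <= Ys n by exact: Pr_ge0.
have cY : cvgn (series Ys).
  apply: nondecreasing_is_cvgn.
    by move=> m n mn; apply: nondecreasing_series.
  exists (1 - rbe)^-1 => _ [n _ <-]; rewrite -[leRHS]mul1r ler_pdivlMr // mulrC.
  by apply: le_trans (Pcleared_n j n) _; apply: Pr_le1; exact: evt_cleared.
have [yy hy] := (@cvg_ex _ _).1 cY.
have gY : gfun Ys 1 yy.
  by rewrite /gfun (_ : (fun k => _) = Ys) //; apply/funext => k; rewrite expr1n mulr1.
have ey : yy = q + rbe * (yy * q).
  exact: (at_one Fs01 Ys01 (Fs0 Q) (Ys_rec Qind Qgood Qrefl Qout) cvg_Fs gY).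
apply/eqP; rewrite eq_le Pr_le1 /=; last exact: evt_cleared.
have <- : (1 - rbe) * yy = 1 by rewrite q1 in ey; rewrite mulrBl mul1r {1}ey; ring.
have hc : (fun n => (1 - rbe) * series Ys n) @ \oo --> (1 - rbe) * yy.
  by apply: cvgM hy; exact: cvg_cst.
apply: (ler_cvg_to hc (cvg_cst (P (cleared j)))); near=> n; exact: Pcleared_n.
Unshelve. all: by end_near. Qed.


Definition sheltered (d : Omega) : Prop := forall n : nat, ~ dfirst 1 n%:Z d.

Lemma evt_sheltered : evt sheltered.
Proof. by apply: evt_forall => n; apply: evt_not; exact: evt_first. Qed.

Lemma Psheltered : P sheltered = 1 - q.
Proof.
have mF n : measurable ([set d : Omega | dfirst 1 n%:Z d] : set Omega) by exact: evt_first.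
have mX : evt (fun d : Omega => exists n : nat, dfirst 1 n%:Z d).
  by apply: evt_exists => n; exact: evt_first.
transitivity (P (fun d : Omega => ~ exists n : nat, dfirst 1 n%:Z d)).
  by apply: Pr_ext => d; split=> [h [n /h]|h n f] //; apply: h; exists n.
rewrite Pr_not //; congr (_ - _); apply/EFin_inj; rewrite -PrE //.
have -> : [set d : Omega | exists n : nat, dfirst 1 n%:Z d] =
    \bigcup_n [set d : Omega | dfirst 1 n%:Z d].
  by apply/seteqP; split=> d [n]; [exists n|move=> _ h; exists n].
rewrite measure_semi_bigcup //.
- transitivity (\sum_(0 <= n <oo) (Fs n)%:E)%E.
    by apply: eq_eseriesr => n _; exact: (PrE Q (evt_first 1 n%:Z)).
  rewrite /survival -EFin_lim; last by apply: cvgP cvg_Fs.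
  by congr (limn _); apply/funext => n; rewrite /= /series /= sumEFin.
- apply/trivIsetP => i j _ _ ij; apply/seteqP; split=> // d [f f'].
  by move: ij; rewrite (_ : i = j) ?eqxx //; have := firstL_unique f f'; clear; lia.
by apply: bigcupT_measurable.
Qed.

Definition right_sources : set source := fun s => exists n : nat, in_box 1 n%:Z s.
Definition left_sources : set source := fun s => right_sources (source_flip 0 s).

Lemma dep_sheltered : dep right_sources sheltered.
Proof.
move=> d d' e h n f; apply: (h n); apply: (@dep_first _ 1 n%:Z d' d) f.
by apply: agree_sym; apply: agree_sub e => s bs; exists n.
Qed.

Lemma dep_sheltered_left : dep left_sources (fun d => sheltered (reflect 0 d)).
Proof.
move=> d d' e; apply: dep_sheltered => s hs; rewrite /reflect /transform e //.
by rewrite /left_sources source_flipK.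
Qed.

Lemma right_left_sources s : right_sources s -> left_sources s -> False.
Proof.
case: s => [k|k|c q' r] [n +] [m]; rewrite /= ?add0r; try by (move=> [h1 h2] [h3 h4]; clear -h1 h2 h3 h4; lia).
by rewrite /within !lo_pflip !hi_pflip => -[[h1 h2 h3] _] [_ [h4 h5 h6]];
  clear -h1 h2 h3 h4 h5 h6; lia.
Qed.

(** The velocity of particle 0 and the two half-lines rest on disjoint sources, and the left
    half-line is the mirror image of the right one. *)
Lemma isolated_blockade : P (fun d => velo d 0 = vzero /\ (sheltered d /\ sheltered (reflect 0 d))) =
  p * (1 - q) ^+ 2.
Proof.
have mS := evt_sheltered; have mL := evt_reflect 0 mS.
rewrite (@Pr_indep _ _ Qind [set Velocity 0] (right_sources `|` left_sources)).
- rewrite Qvel /= expr2; congr (_ * _).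
  rewrite (Pr_indep Qind mS mL dep_sheltered dep_sheltered_left right_left_sources).
  by rewrite (Pr_reflect Qrefl 0 mS) Psheltered.
- exact: evt_velo.
- exact: evt_and.
- exact: (@dep_velo _ 0 (fun u => u = vzero)).
- apply: dep_and.
    by apply: dep_sub dep_sheltered; exact: subsetUl.
  by apply: dep_sub dep_sheltered_left; exact: subsetUr.
by move=> s -> [[n] /=|[n] /=]; clear; lia.
Qed.

Lemma sheltered_exitL d : sheltered d -> forall k, ~ dexitL 1 k d.
Proof.
move=> h k ek; have k1 : 1 <= k by case: ek.
have [|m [m1 mk f]] := @first_exit _ (xpos d) (velo d) (outs d) 1 (k + 1).
  by exists k => //; clear -k1; lia.
by apply: (h (absz m)); rewrite (_ : (absz m)%:Z = m) //; clear -m1; lia.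
Qed.

Lemma sheltered_exitR d : sheltered (reflect 0 d) -> forall i, ~ dexitR i (0 - 1) d.
Proof.
by move=> h i /(exitL_reflect 0) e; apply: (sheltered_exitL h (k := 0 - i)); move: e; rewrite subKr.
Qed.

End Model.

(** * Transfer from a given process to the canonical space *)

HB.instance Definition _ := gen_eqMixin velocity.

Lemma law_finite (R : realType) d (T : measurableType d) (mu : probability T R)
    (I : eqType) (l : seq I) (U : T -> I) (wt : I -> R) (B : set I) :
  uniq l -> (forall i, i \in l) -> (forall B : set I, measurable (U @^-1` B)) ->
  (forall i, mu (U @^-1` [set i]) = (wt i)%:E) ->
  mu (U @^-1` B) = (\sum_(i <- l) if `[<B i>] then wt i else 0)%:E.
Proof.
move=> ul al mU wtE.
have -> : U @^-1` B = U @^-1` [set i | B i /\ i \in l].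
  by apply/seteqP; split=> w /=; [move=> h; split|case].
elim: l ul {al} => [_|i l IH /= /andP[il ul]].
  by rewrite big_nil (_ : _ @^-1` _ = set0) ?measure0 //; apply/seteqP; split=> // w [].
rewrite big_cons EFinD -IH //.
case: asboolP => [Bi|nB].
  rewrite (_ : U @^-1` _ = U @^-1` [set i] `|` U @^-1` [set j | B j /\ j \in l]).
    rewrite [LHS]measureU //; first by congr (_ + _)%E; exact: wtE.
    by apply/seteqP; split=> // w [/= -> [_]]; move/negP: il.
  apply/seteqP; split=> w /=.
    by rewrite inE => -[h /orP[/eqP|hl]]; [left|right].
  by case=> [->|[h hl]]; rewrite inE ?eqxx //; split=> //; rewrite hl orbT.
rewrite add0e; congr (mu _); apply/seteqP; split=> w /=.
  by rewrite inE => -[h /orP[/eqP e|hl]]; [case: nB; rewrite -e|].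
by move=> [h hl]; split=> //; rewrite inE hl orbT.
Qed.

Section Data.
Variables (R : realType) (mu : probability (measurableTypeR R) R) (a b al be p : R).
Variable X : process R.
Hypothesis hmu : admissible_spacing mu.
Hypothesis hX : is_fcba mu a b al be p X.

Notation Omega := (Omega R).

(** The sources of the given process as a point of the canonical space; probabilities are computed
    under its image law, [canonical_law]. *)
Definition data (w : sample X) : Omega := fun s =>
  match s with
  | Spacing k => spacing X k w
  | Velocity k => vcode R (vel X k w)
  | Outcome c q r => ocode R (result X c q r w)
  end.

Lemma data_event s (E : set R) : measurable (E : set (measurableTypeR R)) ->
  source_events X s [set w | E (data w s)].
Proof.
case: s => [k|k|c q r] mE; first by exists E.
  by exists [set u | E (vcode R u)].
by exists [set o | E (ocode R o)].
Qed.

Lemma measurable_data : measurable_fun [set: sample X] data.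
Proof.
have [[mS _] _ _ _ _] := hX; apply: measurable_to_Omega => s _ E mE.
by rewrite setTI; apply: (mS s); exact: data_event.
Qed.

HB.instance Definition _ := isMeasurableFun.Build _ _ _ _ data measurable_data.

Definition canonical_law : probability Omega R := distribution (law X) data.
Notation Q := canonical_law.

Lemma canonical_ind J E : uniq J -> (forall s, measurable (E s : set (measurableTypeR R))) ->
  Q (cylinder J E) = (\prod_(s <- J) Q [set d : Omega | E s (d s)])%E.
Proof.
have [[_ ind] _ _ _ _] := hX => uJ mE.
have := ind J (fun s => [set w | E s (data w s)]) uJ.
move=> /(_ (fun s _ => data_event s (mE s))) <-.
by rewrite /Q /distribution /pushforward /=; congr (law X _); apply/seteqP; split=> w h s; exact: h.
Qed.

Lemma spacing_law k (B : set (measurableTypeR R)) : measurable B ->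
  Q [set d : Omega | B (d (Spacing k))] = mu B.
Proof. by have [_ [_ h] _ _ _] := hX; exact: h. Qed.

Lemma measurable_vel k B : measurable (vel X k @^-1` B).
Proof. by have [[mS _] _ _ _ _] := hX; apply: (mS (Velocity k)); exists B. Qed.

Lemma measurable_result c q r B : measurable (result X c q r @^-1` B).
Proof. by have [[mS _] _ _ _ _] := hX; apply: (mS (Outcome c q r)); exists B. Qed.

Lemma vel_lawE k B : law X (vel X k @^-1` B) =
  (\sum_(u <- [:: vleft; vzero; vright]) if `[<B u>] then velocity_law p u else 0)%:E.
Proof.
have [_ _ h _ _] := hX; apply: law_finite => //; last exact: measurable_vel.
  by rewrite /= !inE; do ?[case: eqP => //].
by case; rewrite !inE eqxx ?orbT.
Qed.

Lemma result_lawE c q r B : law X (result X c q r @^-1` B) =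
  (\sum_(o <- [:: Some vleft; Some vzero; Some vright; None])
     if `[<B o>] then reaction_law a b al be c o else 0)%:E.
Proof.
have [_ _ _ h _] := hX; apply: law_finite => //; last exact: measurable_result.
  by rewrite /= !inE; do ?[case: eqP => //].
by case=> [[]|]; rewrite !inE eqxx ?orbT.
Qed.

(** The spacings are identically distributed, the velocity law gives both directions equal weight,
    and the reaction laws are unchanged when a collision is mirrored. *)
Lemma canonical_sym c s (E : set R) : measurable (E : set (measurableTypeR R)) ->
  Q [set d : Omega | E (source_sign s (d (source_flip c s)))] = Q [set d : Omega | E (d s)].
Proof.
case: s => [k|k|rc q r] mE.
- by rewrite /= !spacing_law.
- rewrite [LHS](vel_lawE (c - k) (fun u => E (- vcode R u))).
  rewrite [RHS](vel_lawE k (fun u => E (vcode R u))).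
  rewrite !big_cons !big_nil /vcode /= oppr0 opprK; congr (_%:E).
  by do 3 case: asboolP => _; ring.
rewrite [LHS](result_lawE (rflip rc) (pflip c r) (pflip c q) (fun u => E (oneg (ocode R u)))).
rewrite [RHS](result_lawE rc q r (fun u => E (ocode R u))).
have [e1 e2 e3 e4 [e5 e6]] := code_neq R.
have n1 : (-1 == 2 :> R) = false by rewrite eq_sym.
have n2 : (0 == 2 :> R) = false by rewrite eq_sym.
have n3 : (1 == 2 :> R) = false by rewrite eq_sym.
rewrite !big_cons !big_nil /ocode /= /oneg n1 n2 n3 eqxx oppr0 opprK; congr (_%:E).
by case: rc => /=; do 4 case: asboolP => _; ring.
Qed.

Lemma canonical_refl c (A : set Omega) : measurable A -> Q (reflect c @^-1` A) = Q A.
Proof.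
move=> mA; apply: (@transform_invariant _ _ canonical_ind _ (source_flip c)) => //.
- exact: source_flipK.
- exact: source_sign_flip.
- exact: measurable_source_sign.
by move=> s E mE; exact: canonical_sym.
Qed.

Lemma canonical_good : {ae Q, forall d, good d}.
Proof.
have [at_ pos] := hmu; apply: (ae_good canonical_ind) => k => [y|].
  by rewrite -(at_ y); exact: (spacing_law k (measurable_set1 y)).
rewrite -pos; apply: (spacing_law k).
rewrite (_ : [set y | 0 < y] = `]0, +oo[%classic) //.
by apply/seteqP; split=> y; rewrite /= in_itv /= andbT.
Qed.

Lemma velo_data w k : velo (data w) k = vel X k w.
Proof. exact: vcodeK. Qed.

Lemma outs_data w c q r : outs (data w) c q r = result X c q r w.
Proof. exact: ocodeK. Qed.

Lemma xpos_data w k : xpos (data w) k = start X k w.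
Proof.
have [_ [h0 _] _ _ _] := hX.
have up (n : nat) : xpos (data w) n%:Z = start X n%:Z w.
  elim: n => [|n IH]; first by rewrite xpos0 h0.
  rewrite xpos_step (_ : n.+1%:Z - 1 = n%:Z); last by lia.
  by rewrite IH /= /spacing (_ : n.+1%:Z - 1 = n%:Z); [rewrite addrC subrK|lia].
have down (n : nat) : xpos (data w) (- n%:Z) = start X (- n%:Z) w.
  elim: n => [|n IH]; first by rewrite oppr0 xpos0 h0.
  have := xpos_step (data w) (- n%:Z); rewrite IH /= /spacing.
  rewrite (_ : - n%:Z - 1 = - n.+1%:Z); last by lia.
  by move=> e; apply: (addIr (start X (- n%:Z) w - start X (- n.+1%:Z) w)); rewrite -e addrC subrK.
by case: k => n; [exact: up|rewrite NegzE; exact: down].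
Qed.

Lemma canonical_vel k u : Pr Q (fun d => velo d k = u) = velocity_law p u.
Proof.
have [_ _ h _ _] := hX; apply/EFin_inj; rewrite -PrE; last exact: evt_velo.
rewrite -(h k u); apply: (congr1 (law X)); apply/seteqP.
by split=> w; rewrite /= velo_data.
Qed.

Lemma canonical_out c q r o : Pr Q (fun d => outs d c q r = o) = reaction_law a b al be c o.
Proof.
have [_ _ _ h _] := hX; apply/EFin_inj; rewrite -PrE; last exact: evt_outs.
rewrite -(h c q r o); apply: (congr1 (law X)); apply/seteqP.
by split=> w; rewrite /= outs_data.
Qed.

Lemma ae_data (phi : Omega -> Prop) : {ae Q, forall d, phi d} ->
  {ae law X, forall w, phi (data w)}.
Proof.
move=> [A [mA A0 hA]]; exists (data @^-1` A); split.
- by have := measurable_data measurableT mA; rewrite setTI.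
- exact: A0.
by move=> w n; exact: hA.
Qed.

End Data.

(** * The two phases and the critical density *)

Section Phases.
Variables (R : realType) (mu : probability (measurableTypeR R) R) (a b al be p : R).
Variable X : process R.
Hypothesis hmu : admissible_spacing mu.
Hypothesis hX : is_fcba mu a b al be p X.
Hypothesis a01 : 0 <= a < 1.
Hypothesis b01 : 0 <= b < 1.
Hypothesis al01 : 0 <= al < 1.
Hypothesis be01 : 0 <= be < 1.
Hypothesis ab1 : a + b <= 1.
Hypothesis albe1 : al + be <= 1.
Hypothesis p01 : 0 <= p <= 1.

Notation Q := (canonical_law hX).
Let Qind := canonical_ind hX.
Let Qgood := canonical_good hmu hX.
Let Qrefl := canonical_refl hX.
Let Qvel := canonical_vel hX.
Let Qout := canonical_out hX.
Let q := survival Q.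

Lemma ae_history : {ae law X, forall w, good (data w) /\
  follows_rules (xpos (data w)) (velo (data w)) (outs (data w)) (hist X w)}.
Proof.
have [_ _ _ _ h] := hX; apply: filterS2 (ae_data Qgood) h => w g h; split=> //.
have -> : xpos (data w) = start X ^~ w by apply/funext => k; exact: (xpos_data hX).
have -> : velo (data w) = vel X ^~ w by apply/funext => k; exact: velo_data.
rewrite (_ : outs (data w) = fun c q r => result X c q r w) //.
by do 3 (apply/funext => ?); exact: outs_data.
Qed.

Lemma all_destroyed : q = 1 ->
  {ae law X, forall w, no_blockade_survives (vel X ^~ w) (hist X w)}.
Proof.
move=> q1; have cl : {ae Q, forall d, forall j : int, cleared j d}.
  apply: ae_forall_count => j; exists (~` [set d | cleared j d]); split=> //.
  - by apply: measurableC; exact: evt_cleared.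
  apply: etrans (probability_setC Q (evt_cleared j)) _.
  rewrite (PrE Q (evt_cleared j)).
  by rewrite (cleared_subcritical Qind Qgood Qrefl Qout be01 j q1) subee.
apply: filterS2 (ae_data cl) ae_history => w hc [[xlt xgen] hr] j vj.
have [n [rn nz]] := hc j.
by apply: (blockade_destroyed xlt xgen hr _ rn nz); rewrite velo_data.
Qed.

Lemma some_survive : 0 < p -> q < 1 ->
  ~ {ae law X, forall w, no_blockade_survives (vel X ^~ w) (hist X w)}.
Proof.
move=> p0 q1 h; pose A (d : Omega R) := velo d 0 = vzero /\ (sheltered d /\ sheltered (reflect 0 d)).
have mA : evt A.
  apply: evt_and; first exact: evt_velo.
  by apply: evt_and; [exact: evt_sheltered|apply: evt_reflect; exact: evt_sheltered].
have PA : Pr Q A = p * (1 - q) ^+ 2 := isolated_blockade Qind Qgood Qrefl Qvel.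
have : {ae law X, forall w, ~ A (data w)}.
  apply: filterS2 h ae_history => w hw [[xlt xgen] hr] [v0 [hR hL]].
  apply: (blockade_survives xlt xgen hr v0).
  - by move=> k; exact: sheltered_exitL hR k.
  - by move=> i; exact: sheltered_exitR hL i.
  by apply: hw; rewrite -velo_data.
move=> [N [mN N0 hN]].
have : (law X (@data R X @^-1` [set d | A d]) <= law X N)%E.
  apply: le_measure; rewrite ?inE //.
    by have := measurable_data hX measurableT mA; rewrite setTI.
  by move=> w Aw; apply: hN => /=; apply.
rewrite N0 -[X in (X <= _)%E]/(Q [set d | A d]) PrE // PA lee_fin leNgt => /negP; apply.
by rewrite mulr_gt0 // exprn_gt0 // subr_gt0.
Qed.

Let Den := 4 - (a + b) * (1 - al) - be * (3 - al - be) - 3 * al.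
Let Num := (1 - be) ^+ 2 - b * (1 - al).

Lemma destroyed_below : {ae law X, forall w, no_blockade_survives (vel X ^~ w) (hist X w)} ->
  0 < p -> p * Den <= Num.
Proof.
move=> h p0; have := survival_le1 Qgood; rewrite le_eqVlt => /orP[/eqP q1|q1].
  exact: (survival_subcritical Qind Qgood Qrefl Qvel Qout a01 b01 al01 be01 ab1 albe1 p01 q1).
by case: (some_survive p0 q1 h).
Qed.

Lemma below_destroyed : p * Den < Num ->
  {ae law X, forall w, no_blockade_survives (vel X ^~ w) (hist X w)}.
Proof.
move=> h; have := survival_le1 Qgood; rewrite le_eqVlt => /orP[/eqP q1|q1].
  exact: all_destroyed.
have := survival_supercritical Qind Qgood Qrefl Qvel Qout a01 b01 al01 be01 ab1 albe1 p01 q1.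
by rewrite -/Den -/Num leNgt h.
Qed.

Lemma no_blockades : p = 0 ->
  {ae law X, forall w, no_blockade_survives (vel X ^~ w) (hist X w)}.
Proof.
move=> p0; have [_ _ h _ _] := hX.
have : {ae law X, forall w, forall k : int, vel X k w <> vzero}.
  apply: ae_forall_count => k; exists (vel X k @^-1` [set vzero]); split.
  - exact: (measurable_vel hX).
  - by apply: etrans (h k vzero) _; rewrite /= p0.
  by move=> w /= /contrapT.
by apply: filterS => w hw k /hw.
Qed.

End Phases.

Theorem theorem1 (R : realType) (a b alpha beta : R)
  (ha : 0 <= a < 1) (hb : 0 <= b < 1)
  (halpha : 0 <= alpha < 1) (hbeta : 0 <= beta < 1)
  (hab : a + b <= 1) (halphabeta : alpha + beta <= 1)
  (mu : probability (measurableTypeR R) R) (hmu : admissible_spacing mu)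
  (X : R -> process R)
  (hX : forall p : R, 0 <= p <= 1 -> is_fcba mu a b alpha beta p (X p)) :
  critical_density X =
  Num.max 0
    (((1 - beta) ^+ 2 - b * (1 - alpha)) /
     (4 - (a + b) * (1 - alpha) - beta * (3 - alpha - beta) - 3 * alpha)).
Proof.
set Nu := (1 - beta) ^+ 2 - b * (1 - alpha).
set Den := 4 - _ - _ - _; set ps := Nu / Den.
have /andP[a0 a1] := ha; have /andP[b0 b1] := hb; have /andP[al0 al1] := halpha.
have /andP[be0 be1] := hbeta.
have al10 : 0 < 1 - alpha by rewrite subr_gt0.
have be10 : 0 < 1 - beta by rewrite subr_gt0.
(* This form shows both Den > 0 and Nu <= Den, the second factor being positive because a + b <= 1
   and beta < 1. *)
have DenE : Den = (1 - beta) ^+ 2 + (1 - alpha) * (3 - a - b - beta) by rewrite /Den; ring.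
have c0 : 0 < 3 - a - b - beta by lra.
have Den0 : 0 < Den by rewrite DenE ltr_wpDl ?sqr_ge0 // mulr_gt0.
have NuDen : Nu <= Den.
  by rewrite DenE /Nu lerD2l (le_trans (y := 0)) ?oppr_le0 ?mulr_ge0 // ltW.
have ps1 : ps <= 1 by rewrite ler_pdivrMr // mul1r.
rewrite /critical_density; set S := [set p | _].
(* At p = 0 there is no initial blockade; this is where the maximum with 0 comes from when Nu is
   negative. *)
have S0 : S 0.
  have h01 : 0 <= (0 : R) <= 1 by rewrite lexx ler01.
  by split=> //; exact: (no_blockades (hX 0 h01) erefl).
have Sle p : S p -> p <= Num.max 0 ps.
  move=> [p01 h]; have /andP[p0 p1] := p01; rewrite le_max.
  case: (ltrP 0 p) => [pp|_] //; apply/orP; right; rewrite ler_pdivlMr //.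
  exact: (destroyed_below hmu (hX p p01) ha hb halpha hbeta hab halphabeta p01 h pp).
have Sge p : 0 <= p -> p < ps -> S p.
  move=> p0 pps; have p01 : 0 <= p <= 1 by rewrite p0 ltW // (lt_le_trans pps).
  split=> //; apply: (below_destroyed hmu (hX p p01)) => //.
  by rewrite -ltr_pdivlMr.
have hsup : has_sup S by split; [exists 0|exists (Num.max 0 ps) => p; exact: Sle].
apply/eqP; rewrite eq_le; apply/andP; split.
  by apply: ge_sup; [exists 0|move=> p; exact: Sle].
have sup0 : 0 <= sup S by apply: (ub_le_sup hsup.2).
rewrite ge_max sup0 /= leNgt; apply/negP => lt.
(* If the supremum were below [ps], their midpoint would be a member of S above the supremum. *)
have : (sup S + ps) / 2 <= sup S.
  by apply: (ub_le_sup hsup.2); apply: Sge; lra.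
lra.
Qed.
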